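(* Let $N=\binom{n}{2}$ and let $(e_{1,1},\dots,e_{N,1})$ and $(e_{1,2},\dots,e_{N,2})$ be two independent uniformly random orderings of the edge set of the complete graph $K_n$. For $I\subseteq [N]$ let $E_{I,j}=\{e_{i,j}:i\in I\}$, $j=1,2$. Call $I\subseteq[N]$ a MultiTree if both $E_{I,1}$ and $E_{I,2}$ form spanning trees of $K_n$. Let $m^*$ be the smallest $m$ such that $[m]$ contains a MultiTree. For $j=1,2$ let $\Gamma_{j,m}$ be the graph $([n],E_{[m],j})$ and let $m_j=\min\{m:\Gamma_{j,m}\text{ is connected}\}$. Then with high probability $m^*=\max\{m_1,m_2\}$.
   Context: With high probability means with probability tending to 1 as $n\to\infty$. *)

(* Defs.v *)
From mathcomp Require Import all_boot all_order all_algebra reals.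

Set Implicit Arguments.
Unset Strict Implicit.
Unset Printing Implicit Defensive.

Import GRing.Theory.

(* A simple graph on [n] is given by its edge set F, a set of two-element
   subsets of 'I_n.  For such F, [adj F] is symmetric and irreflexive, since
   [set x; x] is a singleton. *)

Definition K_edges (n : nat) : {set {set 'I_n}} := [set e : {set 'I_n} | #|e| == 2].

Definition adj (n : nat) (F : {set {set 'I_n}}) : rel 'I_n :=
  [rel x y | [set x; y] \in F].

Definition graph_connected (n : nat) (F : {set {set 'I_n}}) : bool :=
  [forall x, forall y, connect (adj F) x y].

(* Bounding the length of the cycles by n loses nothing: see [acyclicP]. *)
Definition acyclic (n : nat) (F : {set {set 'I_n}}) : bool :=
  [forall k : 'I_n.+1, forall c : k.-tuple 'I_n,
     (2 < k) ==> ~~ (cycle (adj F) c && uniq c)].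

Lemma acyclicP (n : nat) (F : {set {set 'I_n}}) :
  reflect (forall c : seq 'I_n, 2 < size c -> ~ ucycle (adj F) c) (acyclic F).
Proof.
apply: (iffP forallP) => [acF c c_gt2 /andP[cyc_c uniq_c] | acF k].
  have c_le : size c < n.+1.
    by rewrite ltnS -(card_uniqP uniq_c) (leq_trans (max_card _)) ?card_ord.
  have /forallP/(_ (in_tuple c)) := acF (Ordinal c_le).
  by rewrite /= c_gt2 cyc_c uniq_c.
apply/forallP => c; apply/implyP => k_gt2; apply/negP.
by apply: acF; rewrite size_tuple.
Qed.

Definition spanning_tree (n : nat) (F : {set {set 'I_n}}) : bool :=
  [&& F \subset K_edges n, graph_connected F & acyclic F].

(* Positions are numbered from 0: [e i] is the (i+1)-st edge, and the set of
   the first m positions is [initial n m]. *)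

Definition edge_seq (n : nat) : finType := {ffun 'I_'C(n, 2) -> {set 'I_n}}.

Definition orderings (n : nat) : {set edge_seq n} :=
  [set e : edge_seq n | injectiveb e & e @: [set: 'I_'C(n, 2)] == K_edges n].

Definition initial (n m : nat) : {set 'I_'C(n, 2)} := [set i : 'I_'C(n, 2) | i < m].

Definition multitree (n : nat) (e1 e2 : edge_seq n) (I : {set 'I_'C(n, 2)}) : bool :=
  spanning_tree (e1 @: I) && spanning_tree (e2 @: I).

(* The least m in {0, ..., b} satisfying p, and b.+1 if there is none. *)
Definition least_upto (b : nat) (p : pred nat) : nat := find p (iota 0 b.+1).

(* [m_star e1 e2] is 'C(n, 2).+1 if there is no MultiTree at all; this value is
   never the maximum of two connectivity times when n > 0, because the complete
   graph is connected. *)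
Definition m_star (n : nat) (e1 e2 : edge_seq n) : nat :=
  least_upto 'C(n, 2)
    (fun m => [exists I : {set 'I_'C(n, 2)},
                 (I \subset initial n m) && multitree e1 e2 I]).

Definition m_conn (n : nat) (e : edge_seq n) : nat :=
  least_upto 'C(n, 2) (fun m => graph_connected (e @: initial n m)).

Local Open Scope ring_scope.

Definition uniform (R : realType) (T : finType) (A : {set T}) (x : T) : R :=
  if x \in A then #|A|%:R^-1 else 0.

(* Probability that (X, Y) satisfies E, where X and Y are independent and both
   uniform on A. *)
Definition prob_indep_uniform (R : realType) (T : finType) (A : {set T})
    (E : T -> T -> bool) : R :=
  \sum_(x : T) \sum_(y : T | E x y) uniform R A x * uniform R A y.

(* Main.v *)
Require Import Defs.
From mathcomp Require Import all_boot all_order all_algebra perm.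
From mathcomp Require Import reals exp sequences.
From mathcomp Require Import zify ring lra.

Set Implicit Arguments.
Unset Strict Implicit.
Unset Printing Implicit Defensive.
Import Order.TTheory GRing.Theory Num.Theory.

(** By the matroid intersection theorem, [m] contains no MultiTree iff there
    are labellings q1, q2 of the vertices, with at least n + 2 labels in total,
    such that for every i <= m the edge e1 i is constant under q1 or the edge
    e2 i is constant under q2.  By symmetry q1 has n - a labels with a < n/2 and
    q2 has at least a + 2; hence every edge of the second graph cut by
    q2 sits at a position whose edge in the first graph is constant under q1.

    If q2 has no class containing almost all vertices, this contradicts edge
    counting: a set of w vertices cuts about 2(w/n)(1 - w/n)m edges of the second
    graph, whereas the labels of q1 leave only about (a/n)^2 m constant edges.
    Otherwise let T be the complement of the large class.  The edges at vertices
    of low degree in the second graph correspond, with high probability, to a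
    matching in the first graph, and low vertices are pairwise at distance at
    least three; so the low vertices of T provide almost |T| independent
    constraints on q1, while each high vertex of T cuts many edges, which by
    sparsity of the first graph meet a number of vertices much larger than the
    number of high vertices.  This forces n - a + |T| <= n, although |T| > a.

    Everything random is monotone or holds simultaneously for all m in a window
    m0 <= m <= m1 of the form [c1 n log n, c2 n log n]; the graph is disconnected
    at m0 (second moment of the number of isolated vertices) and connected at m1,
    so the window contains the larger connectivity time, and no conditioning on
    the stopping times is needed. *)

(** * Matroid intersection *)

(** There are far too many pairs of labellings for a union bound, so they enter only through vertex
    sets. Sets of at most [s0] vertices, a small constant fraction of n, are controlled by sparsity;
    larger ones by edge densities, where the 2^n choices are beaten by an exponent of order n log n.
    Densities are too coarse when few vertices lie outside the main class of [q2]: the surplus of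
    labels over n + 1 may be a single one, so that labels have to be counted exactly there. All
    quantities hang on one scale x, about (ln n) / 1000: n is e^(1000 x) up to a constant factor,
    and every error is an explicit e^(-c x). Sparsity allows K = x edges per vertex. The degree
    threshold D = 16 x exceeds 14 K + 1, as the local argument requires, and m0 = 400 x n makes the
    cost of 2 K edges per lost label a two-hundredth of the edges in proportion. *)

Record rank_function (T : finType) (r : {set T} -> nat) : Prop := RankFunction {
  rank0 : r set0 = 0;
  rankS : forall A B : {set T}, A \subset B -> r A <= r B;
  rankU1 : forall x (A : {set T}), r (x |: A) <= (r A).+1;
  rank_submod : forall A B : {set T}, r (A :|: B) + r (A :&: B) <= r A + r B }.

Lemma rank_le_card (T : finType) (r : {set T} -> nat) (A : {set T}) :
  rank_function r -> r A <= #|A|.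
Proof.
move=> rr; have [k] := ubnP #|A|; elim: k A => // k IHk A.
have [->|[x xA]] := set_0Vmem A; first by rewrite (rank0 rr).
rewrite (cardsD1 x) xA add1n ltnS => /IHk leA.
by have := rankU1 rr x (A :\ x); rewrite setD1K //; lia.
Qed.

Lemma rank_eq0 (T : finType) (r : {set T} -> nat) (A : {set T}) :
  rank_function r -> (forall x, x \in A -> r [set x] = 0) -> r A = 0.
Proof.
move=> rr; have [k] := ubnP #|A|; elim: k A => // k IHk A.
have [->|[x xA]] := set_0Vmem A; first by rewrite (rank0 rr).
rewrite (cardsD1 x) xA add1n ltnS => /IHk rA r0.
have := rank_submod rr [set x] (A :\ x); rewrite setD1K // r0 // rA; first by lia.
by move=> y; rewrite inE => /andP[_]; apply: r0.
Qed.

(** Contraction of a non-loop; the predecessor is a true subtraction because [x |: A] has rank at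
    least one. *)
Lemma rank_contract (T : finType) (r : {set T} -> nat) (x : T) :
  rank_function r -> r [set x] = 1 -> rank_function (fun A => (r (x |: A)).-1).
Proof.
move=> rr r1.
have rpos A : 0 < r (x |: A) by rewrite -r1 (rankS rr) // subsetUl.
split.
- by rewrite setU0 r1.
- by move=> A B sAB; have := rankS rr (setUS [set x] sAB); lia.
- by move=> y A; rewrite setUCA; have := rankU1 rr y (x |: A); have := rpos A; lia.
move=> A B; have := rank_submod rr (x |: A) (x |: B).
rewrite -setUUr -setUIr; have := (rpos A, rpos B, rpos (A :|: B), rpos (A :&: B)).
by move=> [[[]]]; lia.
Qed.

(** Edmonds' theorem, from the rank inequality to a common independent set, by induction on E: an
    element x of rank one in both matroids is deleted or contracted. If both inequalities fail, at A
    and at B, submodularity uncrosses A and [x |: B] into their union and intersection; the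
    hypotheses for these add up to 2k, the failures to at most 2k - 1. *)
Theorem matroid_intersection (T : finType) (r1 r2 : {set T} -> nat)
    (E : {set T}) (k : nat) :
  rank_function r1 -> rank_function r2 ->
  (forall A : {set T}, A \subset E -> k <= r1 A + r2 (E :\: A)) ->
  exists2 J : {set T}, J \subset E & [/\ #|J| = k, r1 J = k & r2 J = k].
Proof.
have [l] := ubnP #|E|; elim: l => // l IHl in E k r1 r2 *.
rewrite ltnS => leEl rr1 rr2 minE.
have [->|k_gt0] := posnP k.
  by exists set0; rewrite ?sub0set // cards0 (rank0 rr1) (rank0 rr2).
have [x /and3P[xE /eqP x1 /eqP x2]|no_x] :=
    pickP [pred x | [&& x \in E, r1 [set x] == 1 & r2 [set x] == 1]]; last first.
  (* Without such an x every element is a loop of one of the matroids. For A the loops of [r1] both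
     ranks vanish, which forces k = 0. *)
  pose A := [set x in E | r1 [set x] == 0].
  have := minE A; rewrite (rank_eq0 rr1) ?(rank_eq0 rr2); last 2 first.
  - move=> x; rewrite !inE => /andP[+ xE]; rewrite xE /= => r1x.
    have := no_x x; rewrite /= xE /=.
    have := rank_le_card [set x] rr1; have := rank_le_card [set x] rr2.
    rewrite !cards1; move: (r1 _) (r2 _) r1x => [|[|?]] [|[|?]] //.
  - by move=> x; rewrite inE => /andP[_ /eqP].
  have AE: A \subset E by apply/subsetP=> x; rewrite inE => /andP[].
  by move/(_ AE); lia.
have cardEx : #|E :\ x| < l by rewrite (leq_trans _ leEl) // (cardsD1 x E) xE.
have [/forallP minD | /forallPn [A]] := boolP [forall A : {set T},
    (A \subset E :\ x) ==> (k <= r1 A + r2 ((E :\ x) :\: A))].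
  have [J JE [cJ J1 J2]] := IHl _ k _ _ cardEx rr1 rr2 (fun A => implyP (minD A)).
  by exists J => //; apply: subset_trans JE (subD1set _ _).
rewrite negb_imply -ltnNge => /andP[sAE ltA].
have rr1' := rank_contract rr1 x1; have rr2' := rank_contract rr2 x2.
have rpos (r : {set T} -> nat) (B : {set T}) :
  rank_function r -> r [set x] = 1 -> 0 < r (x |: B).
  by move=> rr rx; rewrite -rx (rankS rr) // subsetUl.
have [/forallP minC | /forallPn [B]] := boolP [forall A : {set T},
    (A \subset E :\ x) ==>
    (k.-1 <= (r1 (x |: A)).-1 + (r2 (x |: ((E :\ x) :\: A))).-1)].
  have [J JE [cJ J1 J2]] :=
    IHl _ k.-1 _ _ cardEx rr1' rr2' (fun A => implyP (minC A)).
  exists (x |: J).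
    by rewrite subUset sub1set xE (subset_trans JE (subD1set _ _)).
  have xJ : x \notin J by apply: contraTN JE => xJ; apply/subsetPn; exists x; rewrite ?setD11.
  have := (rpos _ J rr1 x1, rpos _ J rr2 x2).
  by rewrite cardsU1 xJ => -[]; split; lia.
rewrite negb_imply -ltnNge => /andP[sBE ltB].
have := rank_submod rr1 A (x |: B).
have := rank_submod rr2 ((E :\ x) :\: A) (x |: ((E :\ x) :\: B)).
have := (rpos _ B rr1 x1, rpos _ ((E :\ x) :\: B) rr2 x2).
have subE (F : {set T}) : F \subset E :\ x -> {subset F <= [pred y | (y != x) && (y \in E)]}.
  by move/subsetP=> sF y /sF; rewrite !inE.
have sA := subE _ sAE; have sB := subE _ sBE.
have /minE : A :|: (x |: B) \subset E.
  by apply/subsetP=> y; rewrite !inE => /or3P[/sA /= /andP[]|/eqP->|/sB /= /andP[]].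
have -> : E :\: (A :|: (x |: B)) =
    ((E :\ x) :\: A) :&: (x |: ((E :\ x) :\: B)).
  apply/setP=> y; rewrite !inE; case: eqVneq => //= _; rewrite ?andbF ?orbT //=;
  by case: (y \in A); case: (y \in B); case: (y \in E).
have /minE : A :&: (x |: B) \subset E.
  by apply/subsetP=> y; rewrite !inE => /andP[/sA /= /andP[]].
have -> : E :\: (A :&: (x |: B)) =
    ((E :\ x) :\: A) :|: (x |: ((E :\ x) :\: B)).
  apply/setP=> y; rewrite !inE; have := sA y; rewrite inE /=.
  case: eqVneq => [->|_] //= Hy.
    by rewrite xE; case: (x \in A) Hy => // /(_ isT).
  by case: (y \in A); case: (y \in B); case: (y \in E).
by move=> ? ? [] *; lia.
Qed.

(** * The cycle matroid of a graph *)

Section KernelRank.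
Variables (K : fieldType) (vT wT : vectType K) (T : finType) (f : T -> 'Hom(vT, wT)).

Definition common_kernel (A : {set T}) : {vspace vT} := (\bigcap_(i in A) lker (f i))%VS.

(** The rank of the span of the functionals, read off from their common zeros: submodularity becomes
    the dimension formula for a sum and an intersection of subspaces. *)
Definition kernel_rank (A : {set T}) : nat := \dim {:vT} - \dim (common_kernel A).

Lemma common_kernelP (A : {set T}) u :
  reflect (forall i, i \in A -> f i u = 0%R) (u \in common_kernel A).
Proof.
apply: (iffP idP) => [uA i iA|uA].
  have : u \in lker (f i) by apply: subvP uA; apply: bigcapv_inf iA _.
  by rewrite memv_ker => /eqP.
rewrite memvE; apply/subv_bigcapP => i iA.
by rewrite -memvE memv_ker uA.
Qed.

Lemma dim_common_kernel_le (A : {set T}) : \dim (common_kernel A) <= \dim {:vT}.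
Proof. exact: dimvS (subvf _). Qed.

Lemma kernel_rank_function : \dim {:wT} <= 1 -> rank_function kernel_rank.
Proof.
move=> dim1; have le_n := dim_common_kernel_le.
split=> [|A B sAB|x A|A B]; rewrite /kernel_rank.
- by rewrite /common_kernel big_set0 subnn.
- apply: leq_sub2l; apply: dimvS; apply/subvP => u /common_kernelP uB.
  by apply/common_kernelP => i /(subsetP sAB); apply: uB.
- have -> : common_kernel (x |: A) = (common_kernel A :&: lker (f x))%VS.
    apply/vspaceP => u; rewrite memv_cap memv_ker.
    apply/common_kernelP/andP => [uA|[/common_kernelP uA /eqP ux] i].
      split; last by rewrite uA ?setU11.
      by apply/common_kernelP => i iA; apply: uA; rewrite setU1r.
    by rewrite in_setU1 => /predU1P[->|/uA].
  have := limg_ker_dim (f x) (common_kernel A).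
  have := dimvS (subvf (f x @: common_kernel A)).
  by have := le_n A; lia.
have -> : common_kernel (A :|: B) = (common_kernel A :&: common_kernel B)%VS.
  apply/vspaceP => u; rewrite memv_cap; apply/common_kernelP/andP => [uAB|[]].
    by split; apply/common_kernelP=> i iA; apply: uAB; rewrite inE iA ?orbT.
  by move=> /common_kernelP uA /common_kernelP uB i; rewrite inE => /orP[/uA|/uB].
have sI : (common_kernel A + common_kernel B <= common_kernel (A :&: B))%VS.
  rewrite subv_add; apply/andP; split; apply/subvP => u /common_kernelP uA;
  by apply/common_kernelP => i; rewrite inE => /andP[iA iB]; apply: uA.
have := dimv_sum_cap (common_kernel A) (common_kernel B); have := dimvS sI.
have := dimvS (subvf (common_kernel A :&: common_kernel B)).
by have := (le_n A, le_n B, le_n (A :&: B)) => -[[]]; lia.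
Qed.

End KernelRank.

Definition ends (n : nat) (s : {set 'I_n}) : 'cV['F_2]_n := (\col_v (v \in s)%:R)%R.

Definition edge_functional (n : nat) (T : finType) (e : T -> {set 'I_n}) (i : T) :
  'Hom('rV['F_2]_n, 'rV['F_2]_1) := linfun (mulmxr (ends (e i))).

(* Over F_2 the functional attached to the edge {x, y} is u x + u y, so the
   common kernel consists of the functions constant on connected components. *)
Definition grank (n : nat) (T : finType) (e : T -> {set 'I_n}) : {set T} -> nat :=
  kernel_rank (edge_functional e).

Lemma grank_rank (n : nat) (T : finType) (e : T -> {set 'I_n}) :
  rank_function (grank e).
Proof. by apply: kernel_rank_function; rewrite dimvf dim_matrix. Qed.

Lemma dim_rV (n : nat) : \dim {:'rV['F_2]_n} = n.
Proof. by rewrite dimvf dim_matrix mul1r. Qed.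

Lemma mul_ends (n : nat) (u : 'rV['F_2]_n) x y : x != y ->
  (u *m ends [set x; y] == 0)%R = (u ord0 x == u ord0 y).
Proof.
move=> xy.
have -> : (u *m ends [set x; y])%R = ((u ord0 x + u ord0 y)%:M)%R.
  apply/matrixP => i j; rewrite !ord1 !mxE eqxx mulr1n.
  rewrite (bigD1 x) //= (bigD1 y) 1?eq_sym //= big1 => [|z /andP[zx zy]].
    by rewrite !mxE !inE !eqxx orbT !mulr1 addr0.
  by rewrite mxE !inE (negPf zx) (negPf zy) mulr0.
have -> : (u ord0 x == u ord0 y) = (u ord0 x + u ord0 y == 0)%R.
  by rewrite addr_eq0; congr (_ == _); move: (u ord0 y) => [[|[|]]] // ?; apply: val_inj.
apply/eqP/eqP => [/matrixP/(_ ord0 ord0)|->] //.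
  by rewrite !mxE.
by apply/matrixP => i j; rewrite !mxE mul0rn.
Qed.

Lemma connect_pair (n : nat) (F : {set {set 'I_n}}) x y :
  [set x; y] \in F -> connect (adj F) x y.
Proof. by move=> xyF; apply: connect1. Qed.

Lemma adj_sym (n : nat) (F : {set {set 'I_n}}) : symmetric (adj F).
Proof. by move=> x y; rewrite /adj /= setUC. Qed.

Lemma adj_connect_sym (n : nat) (F : {set {set 'I_n}}) : connect_sym (adj F).
Proof. exact: (sym_connect_sym (@adj_sym n F)). Qed.

Section GraphRank.
Variables (n : nat) (T : finType) (e : T -> {set 'I_n}) (A : {set T}).
Hypothesis eE : forall i, #|e i| = 2.

Lemma gkernelP (u : 'rV['F_2]_n) :
  reflect (forall i x y, i \in A -> e i = [set x; y] -> u ord0 x = u ord0 y)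
          (u \in common_kernel (edge_functional e) A).
Proof.
apply: (iffP (common_kernelP _ _ _)) => [uA i x y iA eixy|uA i iA].
  have xy : x != y by have := eE i; rewrite eixy cards2; case: (x != y).
  have := uA _ iA; rewrite lfunE /= eixy => /eqP.
  by rewrite mul_ends // => /eqP.
rewrite lfunE /=; have /eqP/cards2P [x [y [xy eixy]]] := eE i.
by apply/eqP; rewrite eixy mul_ends //; apply/eqP; apply: uA iA eixy.
Qed.

Lemma gkernel_connect (u : 'rV['F_2]_n) x y : u \in common_kernel (edge_functional e) A ->
  connect (adj (e @: A)) x y -> u ord0 x = u ord0 y.
Proof.
move=> /gkernelP uA /connectP [p pP ->]; elim: p x pP => //= z p IHp x /andP[xz /IHp <-].
by case/imsetP: xz => i iA /esym; apply: uA.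
Qed.

Lemma gkernel_closed (u : 'rV['F_2]_n) :
  (forall x y, connect (adj (e @: A)) x y -> u ord0 x = u ord0 y) ->
  u \in common_kernel (edge_functional e) A.
Proof.
move=> uA; apply/gkernelP => i x y iA eixy; apply: uA; apply: connect_pair.
by rewrite -eixy imset_f.
Qed.

(** A function in the kernel is determined by its values at the roots of the components, so the
    kernel embeds into a space with one coordinate per root. *)
Lemma components_rank :
  n <= #|[set fingraph.root (adj (e @: A)) x | x in 'I_n]| + grank e A.
Proof.
pose q := fingraph.root (adj (e @: A)); pose S := [set q x | x in 'I_n].
rewrite -/S /grank /kernel_rank dim_rV.
suff leS : \dim (common_kernel (edge_functional e) A) <= #|S|.
  have := dim_common_kernel_le (edge_functional e) A; rewrite dim_rV.
  by move: (\dim _) leS; lia.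
pose g : 'Hom('rV['F_2]_n, 'rV['F_2]_(#|S|)) :=
  linfun (mulmxr (\matrix_(v < n, j < #|S|) ((v == enum_val j)%:R : 'F_2))%R).
have gE u j : g u ord0 j = u ord0 (enum_val j).
  rewrite lfunE /= mxE (bigD1 (enum_val j)) //= !mxE eqxx mulr1 big1 ?addr0 //.
  by move=> v /negPf vj; rewrite mxE vj mulr0.
have <- : \dim (g @: common_kernel (edge_functional e) A) = \dim (common_kernel (edge_functional e) A).
  apply: limg_dim_eq; apply/eqP; rewrite -subv0; apply/subvP => u.
  rewrite memv_cap memv_ker memv0 => /andP[uK /eqP gu0]; apply/eqP/rowP => x.
  have qxS : q x \in S by apply: imset_f.
  rewrite (gkernel_connect uK (connect_root _ x)) -/(q x).
  by rewrite -(enum_rankK_in qxS qxS) -gE gu0 !mxE.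
by rewrite -[X in _ <= X]dim_rV; apply: dimvS (subvf _).
Qed.

(** The kernel is then a line, spanned by the constant 1; it contains the indicator of each
    component, which must be constant. *)
Lemma grank_connected : 0 < n -> grank e A = n.-1 -> graph_connected (e @: A).
Proof.
move=> n_gt0; rewrite /grank /kernel_rank dim_rV => rA.
have dimK : \dim (common_kernel (edge_functional e) A) = 1.
  by have := dim_common_kernel_le (edge_functional e) A; rewrite dim_rV; lia.
pose w : 'rV['F_2]_n := const_mx 1%R.
have wK : w \in common_kernel (edge_functional e) A by apply: gkernel_closed => x y _; rewrite !mxE.
have w0 : w != 0%R.
  apply/eqP => /rowP/(_ (Ordinal n_gt0)); rewrite !mxE => /eqP; apply/negP; exact: oner_neq0.
have defK : common_kernel (edge_functional e) A = <[w]>%VS.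
  by apply/esym/eqP; rewrite eqEdim dimK dim_vline w0 -memvE wK.
apply/forallP => x; apply/forallP => y.
pose chi : 'rV['F_2]_n := (\row_z (connect (adj (e @: A)) x z)%:R)%R.
have : chi \in common_kernel (edge_functional e) A.
  apply: gkernel_closed => z t zt; rewrite !mxE; congr ((nat_of_bool _)%:R)%R.
  by apply/idP/idP => H; apply: connect_trans H _ => //; rewrite adj_connect_sym.
rewrite defK => /vlineP[k chiE].
move/rowP: chiE => chiE.
have := chiE x; have := chiE y; rewrite !mxE connect0 => cy cx.
by move: cy; rewrite -cx; case: connect => // /eqP.
Qed.

End GraphRank.

Lemma rank_spanning_tree (n : nat) (T : finType) (e : T -> {set 'I_n}) (J : {set T}) :
  (forall i, #|e i| = 2) -> 0 < n -> #|J| = n.-1 -> grank e J = n.-1 ->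
  spanning_tree (e @: J).
Proof.
move=> eE n_gt0 cJ rJ; apply/and3P; split.
- by apply/subsetP => _ /imsetP[i _ ->]; rewrite inE eE.
- exact: grank_connected.
apply/acyclicP => -[|x [|y [|z p]]] // _ /andP[].
rewrite /cycle [path _ _ _]/= [uniq _]/= => /and3P[xy yz zp].
rewrite !inE !negb_or => /and3P[/and3P[nxy nxz xp] /andP[nyz yp] _].
case/imsetP: xy => i0 i0J ei0.
pose F' := e @: (J :\ i0).
have F'E a b : [set a; b] \in e @: J -> a != x -> a != y -> adj F' a b.
  case/imsetP => i iJ eiab ax ay; apply/imsetP; exists i => //.
  rewrite !inE iJ andbT; apply: contraNneq ay => ii0; move/setP/(_ a): eiab.
  by rewrite ii0 -ei0 !inE eqxx (negPf ax).
have zx : connect (adj F') z x.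
  apply/connectP; exists (rcons p x); last by rewrite last_rcons.
  have : x \notin z :: p by rewrite inE negb_or nxz.
  have : y \notin z :: p by rewrite inE negb_or nyz.
  elim: p z zp {nyz nxz yz yp xp} => [|t p IHp] z /=.
    by rewrite !inE !andbT => zx ? ?; apply: F'E; rewrite // eq_sym.
  move=> /andP[zt tp]; rewrite in_cons negb_or => /andP[yz ytp].
  rewrite in_cons negb_or => /andP[xz xtp].
  by apply/andP; split; [apply: F'E; rewrite // eq_sym | apply: IHp].
have yx : connect (adj F') y x.
  apply: connect_trans zx; rewrite adj_connect_sym; apply: connect1.
  by apply: F'E; rewrite 1?setUC // eq_sym.
(* The ends of the removed edge stay connected along the rest of the cycle, so the kernel does not
   grow, and n - 2 edges would have rank n - 1. *)
have : grank e J <= grank e (J :\ i0).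
  apply: leq_sub2l; apply: dimvS; apply/subvP => u uK'.
  apply/gkernelP => // i a b iJ eiab.
  have [ii0|ni] := eqVneq i i0; last first.
    by move/gkernelP: uK' => /(_ eE i a b); apply; rewrite // !inE ni.
  have uxy := gkernel_connect eE uK' yx.
  have : a \in [set x; y] by rewrite ei0 -ii0 eiab set21.
  have : b \in [set x; y] by rewrite ei0 -ii0 eiab set22.
  by rewrite !inE => /orP[]/eqP-> /orP[]/eqP->.
have := rank_le_card (J :\ i0) (grank_rank e).
by have := cardsD1 i0 J; rewrite i0J rJ cJ; move: n_gt0; clear; lia.
Qed.

(** Matroid intersection with k = n - 1: the labels are the component roots of the edges of A in the
    first graph and of the remaining edges in the second. Each edge is constant under one of them,
    and the ranks add up to at least 2n - (n + 1). *)
Lemma multitree_of_label_bound (n : nat) (e1 e2 : edge_seq n) (E : {set 'I_'C(n, 2)}) :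
  0 < n -> (forall i, #|e1 i| = 2) -> (forall i, #|e2 i| = 2) ->
  (forall q1 q2 : 'I_n -> 'I_n,
    (forall i, i \in E -> {in e1 i &, forall x y, q1 x = q1 y} \/
                          {in e2 i &, forall x y, q2 x = q2 y}) ->
    #|q1 @: 'I_n| + #|q2 @: 'I_n| <= n.+1) ->
  exists2 J : {set 'I_'C(n, 2)}, J \subset E & multitree e1 e2 J.
Proof.
move=> n_gt0 e1E e2E noq.
have [|J JE [cJ J1 J2]] :=
    @matroid_intersection _ _ _ E n.-1 (grank_rank e1) (grank_rank e2).
  move=> A AE; pose q1 := fingraph.root (adj (e1 @: A)).
  pose q2 := fingraph.root (adj (e2 @: (E :\: A))).
  have h1 : n <= #|q1 @: 'I_n| + grank e1 A := components_rank A e1E.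
  have h2 : n <= #|q2 @: 'I_n| + grank e2 (E :\: A) := components_rank (E :\: A) e2E.
  suff h : #|q1 @: 'I_n| + #|q2 @: 'I_n| <= n.+1.
    by move: #|q1 @: _| #|q2 @: _| h h1 h2; lia.
  apply: noq => i iE; have [iA|iA] := boolP (i \in A); [left|right] => x y xe ye;
    apply/eqP; rewrite (root_connect (adj_connect_sym _)).
    have [->|nxy] := eqVneq x y; first exact: connect0.
    apply: connect_pair; suff -> : [set x; y] = e1 i by apply: imset_f.
    apply/eqP; rewrite eqEcard e1E cards2 nxy andbT.
    by apply/subsetP => z; rewrite !inE => /orP[]/eqP->.
  have [->|nxy] := eqVneq x y; first exact: connect0.
  apply: connect_pair; suff -> : [set x; y] = e2 i.
    by apply: imset_f; rewrite inE iA.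
  apply/eqP; rewrite eqEcard e2E cards2 nxy andbT.
  by apply/subsetP => z; rewrite !inE => /orP[]/eqP->.
by exists J => //; apply/andP; split; apply: rank_spanning_tree.
Qed.

(** * A deterministic criterion: few cut edges *)

Lemma ordering_inj (n : nat) (e : edge_seq n) : e \in orderings n -> injective e.
Proof. by rewrite inE => /andP[/injectiveP]. Qed.

Lemma ordering_card (n : nat) (e : edge_seq n) i : e \in orderings n -> #|e i| = 2.
Proof.
rewrite inE => /andP[_ /eqP eK]; apply/eqP.
by have := imset_f e (in_setT i); rewrite eK inE.
Qed.

Lemma ordering_surj (n : nat) (e : edge_seq n) (s : {set 'I_n}) :
  e \in orderings n -> #|s| = 2 -> exists i, e i = s.
Proof.
rewrite inE => /andP[_ /eqP eK] s2.
have : s \in K_edges n by rewrite inE s2.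
by rewrite -eK => /imsetP[i _ ->]; exists i.
Qed.

Lemma ordering_pair (n : nat) (e : edge_seq n) i x y :
  e \in orderings n -> x \in e i -> y \in e i -> x != y -> e i = [set x; y].
Proof.
move=> eO xi yi xy; apply/eqP; rewrite eq_sym eqEcard (ordering_card _ eO) cards2 xy.
by rewrite andbT; apply/subsetP => z; rewrite !inE => /orP[]/eqP->.
Qed.

Definition deg (n : nat) (e : edge_seq n) (m : nat) (v : 'I_n) : nat :=
  #|[set i in initial n m | v \in e i]|.

Definition inside (n : nat) (e : edge_seq n) (m : nat) (S : {set 'I_n}) : nat :=
  #|[set i in initial n m | e i \subset S]|.

Definition const_on (n : nat) (q : 'I_n -> 'I_n) (s : {set 'I_n}) : bool :=
  [forall x in s, forall y in s, q x == q y].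

Lemma const_onP (n : nat) (q : 'I_n -> 'I_n) (s : {set 'I_n}) :
  reflect {in s &, forall x y, q x = q y} (const_on q s).
Proof.
apply: (iffP forall_inP) => [H x y xs ys|H x xs].
  by apply/eqP; move/forall_inP: (H x xs); apply.
by apply/forall_inP => y ys; apply/eqP/H.
Qed.

Lemma leq_inside (n : nat) (e : edge_seq n) (m m' : nat) (S : {set 'I_n}) :
  m <= m' -> inside e m S <= inside e m' S.
Proof.
move=> mm'; apply: subset_leq_card; apply/subsetP => i; rewrite !inE.
by move=> /andP[im ->]; rewrite (leq_trans im).
Qed.

Lemma sum_card_rel (S T : finType) (A : {set S}) (B : {set T}) (r : S -> T -> bool) :
  \sum_(a in A) #|[set b in B | r a b]| = \sum_(b in B) #|[set a in A | r a b]|.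
Proof.
transitivity (\sum_(a in A) \sum_(b in B | r a b) 1).
  by apply: eq_bigr => a _; rewrite -sum1_card; apply: eq_bigl => b; rewrite inE.
rewrite (exchange_big_dep (mem B)) //=; last by move=> a b _ /andP[].
apply: eq_bigr => b bB; rewrite -sum1_card; apply: eq_bigl => a.
by rewrite inE bB.
Qed.

Lemma leq_card_rel (S T : finType) (A : {set S}) (B : {set T}) (r : S -> T -> bool) :
  (forall a, a \in A -> exists2 b, b \in B & r a b) ->
  (forall a a' b, a \in A -> a' \in A -> b \in B -> r a b -> r a' b -> a = a') ->
  #|A| <= #|B|.
Proof.
move=> rA rinj; rewrite -!sum1_card.
apply: (@leq_trans (\sum_(a in A) #|[set b in B | r a b]|)).
  apply: leq_sum => a /rA[b bB rab]; rewrite card_gt0; apply/set0Pn; exists b.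
  by rewrite inE bB.
rewrite sum_card_rel; apply: leq_sum => b bB.
apply/card_le1_eqP => a a'; rewrite !inE => /andP[aA ra] /andP[a'A ra'].
exact: (rinj a' a b).
Qed.

Lemma card_fibers (n : nat) (q : 'I_n -> 'I_n) (U : {set 'I_n}) :
  #|U| = \sum_(z in q @: 'I_n) #|U :&: q @^-1: [set z]|.
Proof.
rewrite -sum1_card (partition_big q (mem (q @: 'I_n))) /=; last first.
  by move=> v _; apply: imset_f.
apply: eq_bigr => z _; rewrite -sum1_card; apply: eq_bigl => v.
by rewrite !inE.
Qed.

(** Scaled by six to stay in the integers. A class of size c loses c - 1 labels; the hypothesis says
    that this loss pays one half for each vertex of V and one sixth for each vertex of U in the
    class. *)
Lemma class_count (n : nat) (q : 'I_n -> 'I_n) (V U : {set 'I_n}) :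
  (forall z, z \in q @: 'I_n ->
     3 * #|V :&: q @^-1: [set z]| + #|U :&: q @^-1: [set z]| + 6
       <= 6 * #|q @^-1: [set z]|) ->
  3 * #|V| + #|U| + 6 * #|q @: 'I_n| <= 6 * n.
Proof.
move=> H; rewrite -[X in _ <= 6 * X](card_ord n) -cardsT.
rewrite (card_fibers q V) (card_fibers q U) (card_fibers q setT).
rewrite -[#|q @: _|]sum1_card !big_distrr /= -!big_split /=.
by apply: leq_sum => z zq; rewrite muln1 setTI; apply: H.
Qed.

Section SmallCase.
Variables (n : nat) (e1 e2 : edge_seq n) (m0 m K D s0 : nat) (L : {set 'I_n}).
Variables (q1 q2 : 'I_n -> 'I_n) (p : 'I_n).
Hypotheses (e1O : e1 \in orderings n) (e2O : e2 \in orderings n).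
Hypotheses (le_m0m : m0 <= m) (gtD : 14 * K + 1 < D).
Hypothesis highL : forall v, v \notin L -> D <= deg e2 m0 v.
Hypothesis sepL : forall u v i j, u \in L -> v \in L -> u != v ->
  i \in initial n m -> j \in initial n m -> u \in e2 i -> v \in e2 j ->
  [disjoint e2 i & e2 j].
Hypothesis sparse1 : forall S : {set 'I_n}, #|S| <= s0 -> inside e1 m S <= K * #|S|.
Hypothesis sparse2 : forall S : {set 'I_n}, #|S| <= s0 -> inside e2 m S <= K * #|S|.
Hypothesis matchL : forall i j, i \in initial n m -> j \in initial n m -> i != j ->
  ~~ [disjoint e2 i & L] -> ~~ [disjoint e2 j & L] -> [disjoint e1 i & e1 j].
Hypothesis noiso : forall v, exists2 i, i \in initial n m & v \in e2 i.
Hypothesis cover : forall i, i \in initial n m -> const_on q1 (e1 i) || const_on q2 (e2 i).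

Let T := [set v | q2 v != p].
Let TH := T :\: L.
(** The cut edges at low vertices of T; by [matchL] their partners in the first graph form a
    matching. *)
Let M := [set i in initial n m | ~~ const_on q2 (e2 i) & ~~ [disjoint e2 i & T :&: L]].
(** Confined to positions below [m0], where the lower bound on degrees holds, and kept away from
    [L], so that no such edge belongs to [M]. *)
Let Y := [set i in initial n m0 | (#|e2 i :&: TH| == 1) && [disjoint e2 i & L]].

Let not_disj (A B : {set 'I_n}) x : x \in A -> x \in B -> [disjoint A & B] -> False.
Proof. by move=> xA xB /pred0P/(_ x); rewrite /= xA xB. Qed.

Let m0P i : i \in initial n m0 -> i \in initial n m.
Proof. by rewrite !inE => /leq_trans; apply. Qed.

(** A low vertex of T without an edge in [M] still has some edge, which [q2] does not cut; its other
    end is in T, and is high because low vertices are not adjacent. Two low vertices share no edge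
    and no neighbour, so both assignments are injective. *)
Let lowM : #|T :&: L| <= #|M| + #|TH|.
Proof.
pose Lx := [set v in T :&: L | [exists i in M, v \in e2 i]].
have -> : #|T :&: L| = #|Lx| + #|(T :&: L) :\: Lx|.
  by rewrite -(cardsID Lx (T :&: L)) (setIidPr _) //; apply/subsetP => v; rewrite inE => /andP[].
apply: leq_add.
  apply: (@leq_card_rel _ _ _ _ (fun v i => v \in e2 i)) => [v|u v i].
    by rewrite inE => /andP[_ /exists_inP].
  rewrite !inE => /andP[/andP[_ uL] _] /andP[/andP[_ vL] _] /and3P[im _ _] ui vi.
  apply/eqP; apply/negPn/negP => uv.
  by have := sepL uL vL uv; move/(_ i i); rewrite !inE => /(_ im im ui vi) /(not_disj ui ui).
apply: (@leq_card_rel _ _ _ _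
    (fun v w => [exists i in initial n m, (v \in e2 i) && (w \in e2 i)])) => [v|u v w].
  rewrite inE => /andP[vx vTL]; have [i im vi] := noiso v.
  have cq : const_on q2 (e2 i).
    apply: contraNT vx => ncq; rewrite inE vTL; apply/exists_inP; exists i => //.
    by rewrite inE im ncq; apply/negP => /(not_disj vi vTL).
  have /eqP/cards2P[x [y [xy ei]]] := ordering_card i e2O.
  have [w [wi wv]] : exists w, w \in e2 i /\ w != v.
    move: vi; rewrite ei !inE => /orP[]/eqP->; [exists y | exists x];
    by rewrite !inE eqxx ?orbT // eq_sym.
  exists w; last by apply/exists_inP; exists i; rewrite ?vi.
  have wq : q2 w = q2 v by apply: (const_onP _ _ cq).
  move: vTL; rewrite !inE wq => /andP[-> vL]; rewrite andbT.
  apply/negP => wL; have := sepL wL vL wv im im wi vi.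
  exact: (not_disj vi vi).
rewrite !inE => /andP[_ /andP[_ uL]] /andP[_ /andP[_ vL]] _.
move=> /exists_inP[i im /andP[ui wi]] /exists_inP[j jm /andP[vj wj]].
apply/eqP; apply/negPn/negP => uv.
exact: (not_disj wi wj (sepL uL vL uv im jm ui vj)).
Qed.

(** The degrees in [TH] count an edge of [Y] once, an edge inside [TH] at most twice, and an edge to
    [L] at most once per vertex, since a common neighbour would bring two low vertices within
    distance two. Sparsity bounds the edges inside [TH]. *)
Let degY : #|TH| <= s0 -> D * #|TH| <= #|Y| + (2 * K + 1) * #|TH|.
Proof.
move=> THs0; pose A1 := [set i in initial n m0 | e2 i \subset TH].
pose A2 := [set i in initial n m0 | ~~ [disjoint e2 i & L]].
have degE w : w \in TH -> D <= #|[set i in Y | w \in e2 i]| +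
    (#|[set i in A1 | w \in e2 i]| + #|[set i in A2 | w \in e2 i]|).
  move=> wTH; have /highL/leq_trans : w \notin L by move: wTH; rewrite inE => /andP[].
  apply; rewrite /deg.
  apply: leq_trans (leq_trans (leq_card_setU _ _) (leq_add (leqnn _) (leq_card_setU _ _))).
  apply: subset_leq_card; apply/subsetP => i; rewrite inE => /andP[im wi].
  have memE (B : {set 'I_'C(n, 2)}) : (i \in [set i in B | w \in e2 i]) = (i \in B).
    by rewrite inE wi andbT.
  rewrite !in_setU !memE; case: (boolP (i \in A2)); rewrite ?orbT // orbF => iA2.
  case: (boolP (i \in A1)); rewrite ?orbT // orbF => iA1.
  have im0 : i < m0 by move: im; rewrite inE.
  move: iA1 iA2; rewrite !in_set im0 /= negbK => iTH ->; rewrite andbT.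
  rewrite eqn_leq card_gt0; apply/andP; split.
    rewrite leqNgt; apply: contraNN iTH => c2; apply/setIidPl/eqP.
    by rewrite eqEcard subsetIl (ordering_card i e2O).
  by apply/set0Pn; exists w; rewrite inE wi.
have : \sum_(w in TH) D <= \sum_(w in TH) (#|[set i in Y | w \in e2 i]| +
    (#|[set i in A1 | w \in e2 i]| + #|[set i in A2 | w \in e2 i]|)).
  exact: leq_sum.
rewrite sum_nat_const mulnC !big_split /= => /leq_trans; apply.
rewrite mulnDl mul1n; apply: leq_add; last apply: leq_add.
- rewrite (sum_card_rel TH Y) -sum1_card; apply: leq_sum => i.
  rewrite inE => /and3P[_ /eqP c1 _].
  apply: (@leq_trans #|e2 i :&: TH|); last by rewrite c1.
  by apply: subset_leq_card; apply/subsetP => w; rewrite !inE andbC.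
- rewrite (sum_card_rel TH A1).
  apply: (@leq_trans (\sum_(i in A1) 2)).
    apply: leq_sum => i _; apply: (@leq_trans #|e2 i|); last by rewrite (ordering_card i e2O).
    by apply: subset_leq_card; apply/subsetP => w; rewrite inE => /andP[].
  have : #|A1| <= K * #|TH|.
    by apply: leq_trans (leq_inside e2 TH le_m0m) _; apply: sparse2.
  by move=> cA1; rewrite sum_nat_const -mulnA [X in X <= _]mulnC leq_mul2l.
rewrite -sum1_card; apply: leq_sum => w wTH.
apply/card_le1_eqP => i j; rewrite !inE.
move=> /andP[/andP[im /pred0Pn[u /andP[/= ui uL]]] wi].
move=> /andP[/andP[jm /pred0Pn[v /andP[/= vj vL]]] wj].
have wL : w \notin L by move: wTH; rewrite inE => /andP[].
have [uv|uv] := eqVneq u v.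
  apply: (ordering_inj e2O); have wu : w != u by apply: contraNneq wL => ->.
  rewrite (ordering_pair e2O wi ui wu).
  by rewrite uv in wu *; rewrite (ordering_pair e2O wj vj wu).
have := sepL uL vL uv _ _ ui vj; rewrite !inE.
by move=> /(_ (leq_trans im le_m0m) (leq_trans jm le_m0m)) /(not_disj wi wj).
Qed.

Let Y_cross i : i \in Y -> ~~ const_on q2 (e2 i).
Proof.
rewrite inE => /and3P[_ /cards1P[w wE] eL].
have : w \in e2 i :&: TH by rewrite wE set11.
rewrite !inE => /and3P[wi wL wT].
have /eqP/cards2P[x [y [xy ei]]] := ordering_card i e2O.
have [v [vi vw]] : exists v, v \in e2 i /\ v != w.
  move: wi; rewrite ei !inE => /orP[]/eqP->; [exists y | exists x];
  by rewrite !inE eqxx ?orbT // eq_sym.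
have vL : v \notin L by apply/negP => vL; apply: not_disj eL; eassumption.
have : v \notin e2 i :&: TH by rewrite wE inE.
rewrite !inE vi vL /= => vp; apply: contraNN vp => /const_onP cq.
by rewrite (cq v w).
Qed.

Let M_q1 i : i \in M -> const_on q1 (e1 i).
Proof.
rewrite inE => /and3P[im nc _]; have := cover im.
by rewrite (negPf nc) orbF.
Qed.

Let Y_q1 i : i \in Y -> const_on q1 (e1 i).
Proof.
move=> iY; have := Y_cross iY.
move: iY; rewrite inE => /andP[/m0P/cover + _].
by case/orP=> // ->.
Qed.

(** Otherwise the weighted class count and #|T| <= #|M| + 2 * #|TH| give #|U| < 12 * #|TH|, where U
    is the union of the classes of [q1] containing a [Y]-edge. As 12 * #|T| <= s0, sparsity of the
    first graph yields #|Y| <= 12 * K * #|TH|, while the degrees yield at least (D - 2 * K - 1) *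
    #|TH|. This is the origin of 14 * K + 1 < D. *)
Lemma small_case : 0 < #|T| -> 12 * #|T| <= s0 -> #|q1 @: 'I_n| + #|T| <= n.
Proof.
move=> T0 Ts0; rewrite leqNgt; apply/negP => gtn.
pose V := \bigcup_(i in M) e1 i.
pose U := [set v | [exists i in Y, [exists x in e1 i, q1 x == q1 v]]].
have cardV : 2 * #|M| <= #|V|.
  apply: (@leq_trans (\sum_(i in M) #|[set v in V | v \in e1 i]|)).
    rewrite mulnC -sum_nat_const; apply: leq_sum => i iM.
    apply: (@leq_trans #|e1 i|); first by rewrite (ordering_card i e1O).
    apply: subset_leq_card; apply/subsetP => v vi.
    by rewrite inE vi andbT; apply/bigcupP; exists i.
  rewrite sum_card_rel -sum1_card; apply: leq_sum => v _.
  apply/card_le1_eqP => i j; rewrite !inE.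
  move=> /andP[/and3P[im _ iL] vi] /andP[/and3P[jm _ jL] vj].
  apply/eqP/negPn/negP => ij.
  have sub i' : ~~ [disjoint e2 i' & T :&: L] -> ~~ [disjoint e2 i' & L].
    by apply: contraNN => /disjointWr; apply; apply: subsetIr.
  have im' : i \in initial n m by rewrite inE.
  have jm' : j \in initial n m by rewrite inE.
  exact: (not_disj vj vi (matchL jm' im' ij (sub _ jL) (sub _ iL))).
have eQ i z v : const_on q1 (e1 i) -> v \in e1 i -> q1 v = z -> e1 i \subset q1 @^-1: [set z].
  by move=> /const_onP cq vi <-; apply/subsetP => x xi; rewrite !inE (cq x v).
have UQ z v : v \in U :&: q1 @^-1: [set z] -> exists2 i, i \in Y & e1 i \subset q1 @^-1: [set z].
  rewrite !inE => /andP[/exists_inP[i iY /exists_inP[x xi /eqP qx]] /eqP qv].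
  by exists i => //; apply: eQ xi _; rewrite ?Y_q1 // qx.
have VQ z v : v \in V :&: q1 @^-1: [set z] -> exists2 i, i \in M & e1 i \subset q1 @^-1: [set z].
  rewrite !inE => /andP[/bigcupP[i iM vi] /eqP qv].
  by exists i => //; apply: eQ vi _; rewrite ?M_q1.
(* Each vertex of the matching M saves half a label, and each vertex in a class
   with a Y-edge at least a sixth more, because a class of size two cannot
   contain both an M-edge and a Y-edge. *)
have main : 3 * #|V| + #|U| + 6 * #|q1 @: 'I_n| <= 6 * n.
  apply: class_count => z zq; set Q := q1 @^-1: [set z].
  have Q0 : 0 < #|Q|.
    by case/imsetP: zq => v _ zv; rewrite card_gt0; apply/set0Pn; exists v; rewrite !inE zv.
  have VQc : #|V :&: Q| <= #|Q| by rewrite subset_leq_card // subsetIr.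
  have UQc : #|U :&: Q| <= #|Q| by rewrite subset_leq_card // subsetIr.
  have Q2 i : e1 i \subset Q -> 2 <= #|Q|.
    by move/subset_leq_card; rewrite (ordering_card i e1O).
  have [V0|[v vV]] := set_0Vmem (V :&: Q); have [U0|[u uU]] := set_0Vmem (U :&: Q).
  - by rewrite V0 U0 !cards0 muln0 (leq_mul2l 6 1).
  - have [i _ /Q2] := UQ _ _ uU; move: UQc; rewrite V0 cards0.
    by move: #|U :&: Q| #|Q| => a b; lia.
  - have [i _ /Q2] := VQ _ _ vV; move: VQc; rewrite U0 cards0.
    by move: #|V :&: Q| #|Q| => a b; lia.
  have [i iY iQ] := UQ _ _ uU; have [j jM jQ] := VQ _ _ vV.
  have ij : i != j.
    apply: contraTneq iY => ->; rewrite inE; move: jM; rewrite inE => /and3P[_ _].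
    by apply: contraNN => /and3P[_ _ /disjointWr]; apply; apply: subsetIr.
  have : 2 < #|Q|.
    rewrite ltnNge; apply: contraNN ij => leQ2; apply/eqP/(ordering_inj e1O).
    transitivity Q; last apply/esym; apply/eqP;
    by rewrite eqEcard ?iQ ?jQ (ordering_card _ e1O).
  by move: VQc UQc; move: #|V :&: Q| #|U :&: Q| #|Q| => a b c; clear; lia.
have cardT : #|T| = #|T :&: L| + #|TH| by rewrite /TH cardsID.
have ltU : #|U| < 12 * #|TH|.
  move: lowM cardT cardV main gtn.
  by move: #|T :&: L| #|T| #|TH| #|M| #|V| #|U| #|q1 @: 'I_n| => a b c d f g h; lia.
have leTH : #|TH| <= #|T| by rewrite cardT leq_addl.
have leY : #|Y| <= K * #|U|.
  apply: leq_trans (sparse1 _); last first.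
    by move: ltU leTH Ts0; move: #|U| #|TH| #|T| => a b c; lia.
  apply: subset_leq_card; apply/subsetP => i iY; rewrite inE; apply/andP; split.
    by move: iY; rewrite inE => /andP[/m0P].
  apply/subsetP => x xi; rewrite inE; apply/exists_inP; exists i => //.
  by apply/exists_inP; exists x.
have : #|Y| <= K * (12 * #|TH|) by rewrite (leq_trans leY) // leq_mul2l ltnW ?orbT.
have : #|TH| <= s0 by apply: leq_trans leTH _; apply: leq_trans Ts0; rewrite leq_pmull.
move=> /degY; move: ltU.
move: #|U| #|TH| #|Y| => u h y ltU hD yK.
have h_gt0 : 0 < h by case: h ltU {hD yK}; rewrite ?muln0.
by nia.
Qed.

End SmallCase.

(** * A deterministic criterion: many cut edges *)

(** Degrees are measured at [m0], but the edges at low vertices are followed up to [m1]. Both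
    choices only enlarge the sets concerned, so one event serves every time in the window. *)
Definition low (n : nat) (e : edge_seq n) (m0 D : nat) : {set 'I_n} :=
  [set v | deg e m0 v < D].

Definition separated (n : nat) (e : edge_seq n) (m0 m1 D : nat) : bool :=
  [forall u in low e m0 D, forall v in low e m0 D,
     forall i in initial n m1, forall j in initial n m1,
     [&& u != v, u \in e i & v \in e j] ==> [disjoint e i & e j]].

Definition sparse (n : nat) (e : edge_seq n) (m K s0 : nat) : bool :=
  [forall S : {set 'I_n}, (#|S| <= s0) ==> (inside e m S <= K * #|S|)].

Definition low_edges (n : nat) (e : edge_seq n) (m0 m1 D : nat) : {set 'I_'C(n, 2)} :=
  [set i in initial n m1 | ~~ [disjoint e i & low e m0 D]].

Definition matched (n : nat) (e1 : edge_seq n) (I : {set 'I_'C(n, 2)}) : bool :=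
  [forall i in I, forall j in I, (i != j) ==> [disjoint e1 i & e1 j]].

(** With w the relative size of S, w^2 and w^2 + (1 - w)^2 are the limiting probabilities that a
    random edge lies in S and that it is not cut by S. *)
Definition balanced (R : realFieldType) (n : nat) (e : edge_seq n) (eps : R) (m : nat) : bool :=
  [forall S : {set 'I_n},
    ((inside e m S)%:R <= ((#|S|%:R / n%:R) ^+ 2 + eps) * m%:R)%R &&
    ((inside e m S + inside e m (~: S))%:R <=
       ((#|S|%:R / n%:R) ^+ 2 + (1 - #|S|%:R / n%:R) ^+ 2 + eps) * m%:R)%R].

(** * Lost labels against constant and cut edges *)

Section LabelCount.
Variables (n : nat) (e : edge_seq n) (m K s0 : nat) (q : 'I_n -> 'I_n).
Hypotheses (eO : e \in orderings n) (spe : sparse e m K s0).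

Let cl z := q @^-1: [set z].
Definition big_classes := [set v | s0 < #|q @^-1: [set q v]|].
Let big := [set z in q @: 'I_n | s0 < #|cl z|].

Let sum_cl : \sum_(z in q @: 'I_n) #|cl z| = n.
Proof.
rewrite -[RHS]card_ord -[in RHS]cardsT (card_fibers q setT).
by apply: eq_bigr => z _; rewrite setTI.
Qed.

Let cl_gt0 z : z \in q @: 'I_n -> 0 < #|cl z|.
Proof.
by case/imsetP => v _ ->; rewrite card_gt0; apply/set0Pn; exists v; rewrite !inE.
Qed.

Lemma sum_classes_pred : \sum_(z in q @: 'I_n) (#|cl z|.-1) + #|q @: 'I_n| = n.
Proof.
rewrite -[X in _ = X]sum_cl -sum1_card -big_split /=; apply: eq_bigr => z /cl_gt0.
by rewrite addn1; case: #|_|.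
Qed.

(** The losses #|C| - 1 over all classes C add up to n minus the number of labels; the big classes
    alone lose #|big_classes| - b, where b is their number. *)
Lemma card_big_classes : exists2 b, #|big_classes| + #|q @: 'I_n| <= n + b & b * s0 <= n.
Proof.
clear eO spe.
have cU : #|big_classes| = \sum_(z in big) #|cl z|.
  rewrite (card_fibers q) (big_setID big) /= [X in _ + X]big1 ?addn0 => [|z].
    rewrite (setIidPr _); last by apply/subsetP => z; rewrite inE => /andP[].
    apply: eq_bigr => z; rewrite inE => /andP[_ zb]; congr #|pred_of_set _|.
    by apply/setP => v; rewrite !inE andbC; case: eqP => //= ->.
  rewrite !inE andbC => /andP[zq]; rewrite zq /= => zb; apply/eqP.
  rewrite cards_eq0; apply/eqP/setP => v; rewrite !inE andbC; case: eqP => //= ->.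
  exact: negPf.
exists #|big|; last first.
  rewrite -[X in _ <= X](card_ord n) -sum_nat_const (@leq_trans #|big_classes|) ?max_card //.
  by rewrite cU; apply: leq_sum => z; rewrite inE => /andP[_ /ltnW].
have sB : \sum_(z in big) (#|cl z|.-1) <= \sum_(z in q @: 'I_n) (#|cl z|.-1).
  rewrite [leqRHS](big_setID big) /= (setIidPr _) ?leq_addr //.
  by apply/subsetP => z; rewrite inE => /andP[].
have -> : #|big_classes| = \sum_(z in big) (#|cl z|.-1) + #|big|.
  rewrite cU -[#|big|]sum1_card -big_split /=; apply: eq_bigr => z.
  by rewrite inE => /andP[/cl_gt0]; rewrite addn1; case: #|_|.
have := sum_classes_pred; move: sB.
by move: (\sum_(z in big) _) (\sum_(z in q @: _) _) #|big| #|q @: _| => a b c d; lia.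
Qed.

(** A constant edge not inside [big_classes] lies in a class of size c with 2 <= c <= s0. Such a
    class spans at most K * c <= 2 * K * (c - 1) edges, that is, 2 * K per lost label. *)
Lemma card_const_on :
  #|[set i in initial n m | const_on q (e i)]| + 2 * K * #|q @: 'I_n|
    <= inside e m big_classes + 2 * K * n.
Proof.
pose Z := [set z in q @: 'I_n | 1 < #|cl z| <= s0].
pose B := [set i in initial n m | const_on q (e i) && ~~ (e i \subset big_classes)].
have leB : #|B| <= \sum_(z in Z) inside e m (cl z).
  apply: (@leq_trans (\sum_(i in B) #|[set z in Z | e i \subset cl z]|)).
    rewrite -sum1_card; apply: leq_sum => i; rewrite inE => /and3P[im /const_onP cq].
    case/subsetPn => v vi; rewrite inE -leqNgt => vs; rewrite card_gt0.
    have sub : e i \subset cl (q v) by apply/subsetP => x xi; rewrite !inE (cq x v).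
    apply/set0Pn; exists (q v); rewrite !inE sub vs imset_f //= !andbT.
    by have := subset_leq_card sub; rewrite (ordering_card _ eO).
  rewrite sum_card_rel; apply: leq_sum => z _; apply: subset_leq_card.
  by apply/subsetP => i; rewrite !inE => /andP[/andP[-> _] ->].
have leZ : \sum_(z in Z) inside e m (cl z) <= \sum_(z in q @: 'I_n) 2 * K * (#|cl z|.-1).
  rewrite [leqRHS](big_setID Z) /= (setIidPr _); last first.
    by apply/subsetP => z; rewrite inE => /andP[].
  apply: leq_trans (leq_addr _ _); apply: leq_sum => z.
  rewrite inE => /and3P[_ z1 zs0].
  have := forallP spe (cl z); rewrite zs0 /= => /leq_trans; apply.
  by move: #|_| z1 => c; nia.
have := sum_classes_pred; move: leB leZ; rewrite -big_distrr /= => leB leZ sumE.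
have : #|[set i in initial n m | const_on q (e i)]| <= inside e m big_classes + #|B|.
  apply: leq_trans (leq_card_setU _ _); apply: subset_leq_card.
  apply/subsetP => i; rewrite !inE => /andP[im ci]; rewrite im ci /=.
  by case: (_ \subset _).
move: leB leZ sumE; move: (\sum_(z in q @: _) _) (\sum_(z in Z) _) #|q @: _| => a b c.
by move: (inside _ _ _) #|B| #|[set i in initial n m | _]| => d f g; nia.
Qed.

End LabelCount.

Lemma card_initial (n m : nat) : m <= 'C(n, 2) -> #|initial n m| = m.
Proof.
move=> mN; rewrite -[RHS]card_ord -[in RHS]cardsT.
have winj : injective (widen_ord mN) by move=> i j /(congr1 val) /= /val_inj.
rewrite -(card_imset setT winj); apply: eq_card => i; rewrite inE.
apply/idP/imsetP => [im|[j _ ->]]; last by rewrite /= ltn_ord.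
by exists (Ordinal im); rewrite ?inE //; apply: val_inj.
Qed.

Lemma cover_count (n : nat) (e1 e2 : edge_seq n) (m : nat) (q1 q2 : 'I_n -> 'I_n)
    (W : {set 'I_n}) : m <= 'C(n, 2) ->
  (forall i, i \in initial n m -> const_on q1 (e1 i) || const_on q2 (e2 i)) ->
  (forall x y, q2 x = q2 y -> x \in W -> y \in W) ->
  m <= #|[set i in initial n m | const_on q1 (e1 i)]| +
       (inside e2 m W + inside e2 m (~: W)).
Proof.
move=> mN cover clW; rewrite -[X in X <= _](card_initial mN).
apply: leq_trans (leq_trans (leq_card_setU _ _) (leq_add (leqnn _) (leq_card_setU _ _))).
apply: subset_leq_card; apply/subsetP => i im; rewrite !in_setU !in_set.
rewrite (_ : (i < m) = true) /=; last by rewrite inE in im.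
case/orP: (cover _ im) => [->//|/const_onP cq]; apply/orP; right.
have [dis|/pred0Pn[x /andP[/= xi xW]]] := boolP [disjoint e2 i & W].
  by rewrite -(disjoints_subset (e2 i)) dis orbT.
by apply/orP; left; apply/subsetP => y yi; apply: clW xW; apply: cq.
Qed.

(** Here u, w and a are the proportions of vertices in big classes, of vertices in W and of lost
    labels. Since w^2 + (1 - w)^2 = 1 - 2w(1 - w), the cut edges must outweigh the rest: if a <= w,
    through 3w^2 - 2w <= - w/2; if w >= 1/4, because u^2 is at most about 1/4 and 2w(1 - w) >=
    3/8. *)
Lemma large_case_real (R : realFieldType) (u w a eps : R) :
  (0 <= a -> a <= 1 / 2 -> 0 <= u -> u <= a + eps -> 0 < eps -> eps <= 1 / 100 ->
  10 * eps < w -> w <= 1 / 2 -> (a <= w) || (1 / 4 <= w) ->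
  u ^+ 2 + a / 200 + w ^+ 2 + (1 - w) ^+ 2 + 2 * eps < 1)%R.
Proof.
move=> a0 a1 u0 ua e0 e1 we w1 aw.
have [aw'|wa] := leP a w.
  have h : (u ^+ 2 <= (w + eps) ^+ 2)%R by rewrite lerXn2r ?nnegrE; lra.
  have h2 : ((w + eps) ^+ 2 <= w ^+ 2 + 2 * eps)%R by nra.
  have h3 : (w ^+ 2 <= w / 2)%R by nra.
  nra.
have w4 : (1 / 4 <= w)%R by case/orP: aw => //; lra.
have h : (u ^+ 2 <= (1 / 2 + eps) ^+ 2)%R by rewrite lerXn2r ?nnegrE; lra.
have h2 : ((1 / 2 + eps) ^+ 2 <= 1 / 4 + 2 * eps)%R by nra.
have h3 : (w * (1 - w) >= 3 / 16)%R by nra.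
nra.
Qed.

Section LargeCase.
Variables (R : realFieldType) (n : nat) (e1 e2 : edge_seq n) (m K s0 : nat) (eps : R).
Variables (q1 q2 : 'I_n -> 'I_n) (W : {set 'I_n}).
Hypotheses (e1O : e1 \in orderings n) (mN : m <= 'C(n, 2)).
Hypotheses (sp1 : sparse e1 m K s0) (bal1 : balanced e1 eps m) (bal2 : balanced e2 eps m).
Hypothesis cover :
  forall i, i \in initial n m -> const_on q1 (e1 i) || const_on q2 (e2 i).
Hypothesis clW : forall x y, q2 x = q2 y -> x \in W -> y \in W.
Hypotheses (n_gt0 : 0 < n) (m_gt0 : 0 < m) (leKm : 400 * K * n <= m).
Hypotheses (eps_gt0 : (0 < eps)%R) (eps_le : (eps <= 1 / 100)%R).
Hypotheses (eps_s0 : (1 <= eps * s0%:R)%R) (epsW : (10 * eps * n%:R < #|W|%:R)%R).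
Hypotheses (q1_large : n <= 2 * #|q1 @: 'I_n|) (W_half : 2 * #|W| <= n).

(** Every edge is constant under [q1] or uncut by W. In this count [leKm] makes the cost 2 * K per
    lost label at most the fraction a/200 of m, and [eps_s0] allows at most eps * n big classes,
    whence u <= a + eps in [large_case_real]. *)
Lemma large_case : (n <= #|q1 @: 'I_n| + #|W|) || (n <= 4 * #|W|) -> False.
Proof.
move=> orW.
have q1n : #|q1 @: 'I_n| <= n by rewrite (leq_trans (leq_imset_card _ _)) ?card_ord.
have := cover_count mN cover clW; have := card_const_on q1 e1O sp1.
have [b] := card_big_classes s0 q1.
have /andP[] := forallP bal2 W; have /andP[] := forallP bal1 (big_classes s0 q1).
move: (inside e1 m (big_classes s0 q1)) (inside e2 m W + _) => i1 i2.
move: #|big_classes s0 q1| #|[set i in initial n m | _]| q1_large q1n orW => u c.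
move: #|q1 @: 'I_n| => k k2 kn orW.
move: #|W| W_half epsW orW => w wn we orW h1 _ _ hu hb hc hm hm'.
pose N : R := (n%:R)%R; have N0 : (0 < N)%R by rewrite ltr0n.
have M0 : (0 < (m%:R : R))%R by rewrite ltr0n.
pose al : R := ((n - k)%:R / n%:R)%R.
have E : (m%:R + 2 * K%:R * k%:R <= i1%:R + 2 * K%:R * n%:R + i2%:R :> R)%R.
  by rewrite -!natrM -!natrD ler_nat; move: hm hm'; clear; lia.
have b_le : ((b%:R : R) <= eps * n%:R)%R.
  have : (b%:R * s0%:R <= n%:R :> R)%R by rewrite -natrM ler_nat.
  have b0 : (0 <= b%:R :> R)%R by []. 
  move=> bs; apply: (@le_trans _ _ (b%:R * (eps * s0%:R))%R).
    by rewrite ler_peMr.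
  by rewrite mulrCA ler_pM2l.
have key := @large_case_real R (u%:R / n%:R) (w%:R / n%:R) al eps.
suff : (m%:R < m%:R :> R)%R by rewrite ltxx.
have {}key : ((u%:R / n%:R) ^+ 2 + al / 200 + (w%:R / n%:R) ^+ 2 +
     (1 - w%:R / n%:R) ^+ 2 + 2 * eps < 1)%R.
  apply: key => //.
  - by rewrite divr_ge0.
  - rewrite /al ler_pdivrMr // natrB //.
    have : (n%:R <= 2 * k%:R :> R)%R by rewrite -natrM ler_nat.
    by lra.
  - by rewrite divr_ge0.
  - rewrite /al ler_pdivrMr // mulrDl divfK ?gt_eqF // natrB //.
    have : (u%:R + k%:R <= n%:R + b%:R :> R)%R by rewrite -!natrD ler_nat.
    by lra.
  - by rewrite ltr_pdivlMr.
  - rewrite ler_pdivrMr //.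
    have : (2 * w%:R <= n%:R :> R)%R by rewrite -natrM ler_nat.
    by lra.
  - rewrite /al ler_pM2r ?invr_gt0 // ler_nat leq_subLR ler_pdivlMr //.
    case/orP: orW => [->//|h]; apply/orP; right.
    have : (n%:R <= 4 * w%:R :> R)%R by rewrite -natrM ler_nat.
    by lra.
have al0 : (0 <= al)%R by rewrite divr_ge0.
have Kal : (2 * K%:R * (n%:R - k%:R) <= al / 200 * m%:R :> R)%R.
  rewrite -natrB // -[X in (_ * X)%R](@divfK _ (n%:R)%R) ?gt_eqF // -/al.
  have : (400 * K%:R * n%:R <= m%:R :> R)%R by rewrite -!natrM ler_nat.
  by nra.
nra.
Qed.

End LargeCase.

(** * A deterministic criterion: conclusion *)

Lemma connected_degree (n : nat) (e : edge_seq n) (I : {set 'I_'C(n, 2)}) v :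
  1 < n -> graph_connected (e @: I) -> exists2 i, i \in I & v \in e i.
Proof.
move=> n_gt1 /forallP/(_ v)/forallP conn.
have [w wv] : exists w : 'I_n, w != v.
  have n_gt0 : 0 < n by lia.
  have [v0|v0] := eqVneq v (Ordinal n_gt0); last by exists (Ordinal n_gt0); rewrite eq_sym.
  by exists (Ordinal n_gt1); rewrite v0.
have /connectP[[|x p] /=] := conn w; first by move=> _ wE; rewrite wE eqxx in wv.
move=> /andP[/imsetP[i iI eix] _] _.
by exists i; rewrite // -eix set21.
Qed.

Lemma sparse_le (n : nat) (e : edge_seq n) (m m' K s0 : nat) :
  m <= m' -> sparse e m' K s0 -> sparse e m K s0.
Proof.
move=> mm' /forallP sp; apply/forallP => S; apply/implyP => Ss.
exact: leq_trans (leq_inside _ _ mm') (implyP (sp S) Ss).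
Qed.

(** Take a union of classes that is largest among those of size at most n/2. Each single class
    competes, hence is no larger; if the union had fewer than n/4 elements, adding a missing class
    would keep it below n/2. *)
Lemma half_union (n : nat) (q : 'I_n -> 'I_n) :
  (forall z, 2 * #|q @^-1: [set z]| <= n) ->
  exists2 Z : {set 'I_n}, 2 * #|q @^-1: Z| <= n & n <= 4 * #|q @^-1: Z|.
Proof.
move=> small; pose P := [pred Z : {set 'I_n} | 2 * #|q @^-1: Z| <= n].
have P0 : P set0 by rewrite /= preimset0 cards0.
have [Z /= Zn maxZ] := arg_maxnP (fun Z : {set 'I_n} => #|q @^-1: Z|) P0.
exists Z => //; rewrite leqNgt; apply/negP => ltZ.
have [v vZ] : exists v, v \notin q @^-1: Z.
  apply/existsP; rewrite -negb_forall; apply/negP => /forallP allZ.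
  have ZT : q @^-1: Z = setT by apply/setP => w; rewrite [RHS]inE allZ.
  by move: ltZ; rewrite ZT cardsT card_ord; lia.
have zZ := maxZ [set q v] (small _).
have qE : q @^-1: (q v |: Z) = q @^-1: [set q v] :|: q @^-1: Z by rewrite preimsetU.
have dis : #|q @^-1: (q v |: Z)| = #|q @^-1: [set q v]| + #|q @^-1: Z|.
  rewrite qE cardsU (_ : _ :&: _ = set0) ?cards0 ?subn0 //.
  apply/setP => w; rewrite !inE; apply/negP => /andP[/eqP wv wZ].
  by move: vZ; rewrite inE -wv wZ.
have pos : 0 < #|q @^-1: [set q v]| by rewrite card_gt0; apply/set0Pn; exists v; rewrite !inE.
have := maxZ (q v |: Z); rewrite /= dis; move: zZ pos ltZ Zn.
by move: #|q @^-1: [set q v]| #|q @^-1: Z| => a b ab a0 bn b2 /(_ _); lia.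
Qed.

Section NoLabellings.
Variables (R : realFieldType) (n : nat) (m0 m m1 K D s0 : nat) (eps : R).
Hypotheses (n_gt1 : 1 < n) (le0 : m0 <= m) (le1 : m <= m1) (mN : m <= 'C(n, 2)).
Hypotheses (gtD : 14 * K + 1 < D) (leKm : 400 * K * n <= m0) (m0_gt0 : 0 < m0).
Hypotheses (eps_gt0 : (0 < eps)%R) (eps_le : (eps <= 1 / 100)%R).
Hypotheses (eps_s0 : (1 <= eps * s0%:R)%R) (eps_n : (120 * eps * n%:R <= s0%:R)%R).

Lemma no_labellings_wlog (e1 e2 : edge_seq n) (q1 q2 : 'I_n -> 'I_n) :
  e1 \in orderings n -> e2 \in orderings n ->
  sparse e1 m1 K s0 -> sparse e2 m1 K s0 -> balanced e1 eps m -> balanced e2 eps m ->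
  separated e2 m0 m1 D -> matched e1 (low_edges e2 m0 m1 D) ->
  graph_connected (e2 @: initial n m) ->
  (forall i, i \in initial n m -> const_on q1 (e1 i) || const_on q2 (e2 i)) ->
  #|q2 @: 'I_n| <= #|q1 @: 'I_n| ->
  #|q1 @: 'I_n| + #|q2 @: 'I_n| <= n.+1.
Proof.
move=> e1O e2O sp1 sp2 bal1 bal2 sep2 mat conn cover le21; rewrite leqNgt; apply/negP => gtn.
have q1n : #|q1 @: 'I_n| <= n by rewrite (leq_trans (leq_imset_card _ _)) ?card_ord.
have m_gt0 := leq_trans m0_gt0 le0; have leKm' := leq_trans leKm le0.
have n_gt0 := ltnW n_gt1.
have q1_large : n <= 2 * #|q1 @: 'I_n|.
  by move: le21 gtn; move: #|q1 @: _| #|q2 @: _|; clear; lia.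
have sp1' := sparse_le le1 sp1; have sp2' := sparse_le le1 sp2.
(* Without a class of more than half the vertices, classes are grouped into a W with n/4 <= #|W| <=
   n/2. Otherwise the complement T of that class is used, and the size of 12 * #|T| against [s0]
   decides between the two criteria. *)
have [/existsP[p p_big]|] := boolP [exists p, n < 2 * #|q2 @^-1: [set p]|]; last first.
  rewrite negb_exists => /forallP nobig.
  have [z|Z Zn Zn4] := half_union (q := q2); first by rewrite leqNgt.
  apply: (@large_case R n e1 e2 m K s0 eps q1 q2 (q2 @^-1: Z)); rewrite ?Zn4 ?orbT //.
    by move=> x y xy; rewrite !inE xy.
  have : (n%:R <= 4 * #|q2 @^-1: Z|%:R :> R)%R by rewrite -natrM ler_nat.
  have : (0 < n%:R :> R)%R by rewrite ltr0n.
  have : (eps * n%:R <= 1 / 100 * n%:R)%R by rewrite ler_wpM2r.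
  by rewrite -[X in _ -> _ -> _ -> (X < _)%R]mulrA; move: (eps * _)%R => y; lra.
pose T := [set v | q2 v != p].
have cardT : #|q2 @^-1: [set p]| + #|T| = n.
  rewrite -[RHS]card_ord -(cardsC (q2 @^-1: [set p])); congr (_ + #|pred_of_set _|).
  by apply/setP => v; rewrite !inE.
have im2T : #|q2 @: 'I_n| <= #|T|.+1.
  apply: (@leq_trans #|p |: q2 @: T|).
    apply: subset_leq_card; apply/subsetP => _ /imsetP[v _ ->]; rewrite !inE.
    by have [//|vp] := eqVneq (q2 v) p; rewrite imset_f // inE.
  by rewrite cardsU1 -add1n leq_add ?leq_b1 ?leq_imset_card.
have T_gt0 : 0 < #|T|.
  by move: im2T gtn q1n; move: #|q1 @: _| #|q2 @: _| #|T|; clear; lia.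
have [small|large] := leqP (12 * #|T|) s0.
  suff : #|q1 @: 'I_n| + #|T| <= n.
    by move: im2T gtn; move: #|q1 @: _| #|q2 @: _| #|T|; clear; lia.
  apply: (@small_case n e1 e2 m0 m K D s0 (low e2 m0 D) q1 q2 p) => //.
  - by move=> v; rewrite inE -leqNgt.
  - move=> u v i j uL vL uv im jm ui vj.
    have m1P k : k \in initial n m -> k \in initial n m1.
      by rewrite !inE => /leq_trans; apply.
    move/forall_inP: sep2 => /(_ u uL)/forall_inP/(_ v vL)/forall_inP.
    move=> /(_ i (m1P _ im))/forall_inP/(_ j (m1P _ jm)).
    by rewrite uv ui vj.
  - by move=> S sS; apply: (implyP (forallP sp1' S)).
  - by move=> S sS; apply: (implyP (forallP sp2' S)).
  - move=> i j im jm ij iL jL.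
    have lowP k : k \in initial n m -> ~~ [disjoint e2 k & low e2 m0 D] ->
        k \in low_edges e2 m0 m1 D.
      by rewrite !inE => /leq_trans -> //.
    move/forall_inP: mat => /(_ i (lowP _ im iL))/forall_inP/(_ j (lowP _ jm jL)).
    by rewrite ij.
  by move=> v; apply: connected_degree.
apply: (@large_case R n e1 e2 m K s0 eps q1 q2 T) => //.
- by move=> x y; rewrite !inE => ->.
- have : (s0%:R < 12 * #|T|%:R :> R)%R by rewrite -natrM ltr_nat.
  rewrite -mulrA; move: eps_n; rewrite -mulrA.
  by move: (eps * _)%R (#|T|%:R)%R (s0%:R)%R => x y z; lra.
- by move: cardT p_big; move: #|q2 @^-1: _| #|T|; clear; lia.
apply/orP; left.
by move: im2T gtn; move: #|q1 @: _| #|q2 @: _| #|T|; clear; lia.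
Qed.

Lemma no_labellings (e1 e2 : edge_seq n) (q1 q2 : 'I_n -> 'I_n) :
  e1 \in orderings n -> e2 \in orderings n ->
  sparse e1 m1 K s0 -> sparse e2 m1 K s0 -> balanced e1 eps m -> balanced e2 eps m ->
  separated e1 m0 m1 D -> separated e2 m0 m1 D ->
  matched e1 (low_edges e2 m0 m1 D) -> matched e2 (low_edges e1 m0 m1 D) ->
  graph_connected (e1 @: initial n m) -> graph_connected (e2 @: initial n m) ->
  (forall i, i \in initial n m -> const_on q1 (e1 i) || const_on q2 (e2 i)) ->
  #|q1 @: 'I_n| + #|q2 @: 'I_n| <= n.+1.
Proof.
move=> e1O e2O sp1 sp2 bal1 bal2 sep1 sep2 mat1 mat2 conn1 conn2 cover.
have [le21|/ltnW le12] := leqP #|q2 @: 'I_n| #|q1 @: 'I_n|.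
  exact: (no_labellings_wlog e1O e2O).
rewrite addnC; apply: (no_labellings_wlog e2O e1O) => // i im.
by rewrite orbC cover.
Qed.

Theorem multitree_exists (e1 e2 : edge_seq n) :
  e1 \in orderings n -> e2 \in orderings n ->
  sparse e1 m1 K s0 -> sparse e2 m1 K s0 -> balanced e1 eps m -> balanced e2 eps m ->
  separated e1 m0 m1 D -> separated e2 m0 m1 D ->
  matched e1 (low_edges e2 m0 m1 D) -> matched e2 (low_edges e1 m0 m1 D) ->
  graph_connected (e1 @: initial n m) -> graph_connected (e2 @: initial n m) ->
  exists2 J : {set 'I_'C(n, 2)}, J \subset initial n m & multitree e1 e2 J.
Proof.
move=> e1O e2O sp1 sp2 bal1 bal2 sep1 sep2 mat1 mat2 conn1 conn2.
apply: multitree_of_label_bound; first exact: ltnW.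
- by move=> i; apply: ordering_card.
- by move=> i; apply: ordering_card.
move=> q1 q2 cover; apply: (@no_labellings e1 e2) => // i im.
by case: (cover i im) => [/const_onP->|/const_onP->] //; rewrite orbT.
Qed.

End NoLabellings.

(** * Expectations over random orderings *)

Lemma least_upto_le (b m : nat) (p : pred nat) : m <= b -> p m -> least_upto b p <= m.
Proof.
move=> mb pm; rewrite leqNgt; apply/negP => /(before_find 0).
by rewrite nth_iota // add0n pm.
Qed.

Lemma least_uptoP (b : nat) (p : pred nat) : least_upto b p <= b -> p (least_upto b p).
Proof.
move=> lb; have hp : has p (iota 0 b.+1) by rewrite has_find size_iota ltnS.
by have := nth_find 0 hp; rewrite nth_iota ?ltnS // add0n.
Qed.

Lemma graph_connectedS (n : nat) (F F' : {set {set 'I_n}}) :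
  F \subset F' -> graph_connected F -> graph_connected F'.
Proof.
move=> /subsetP FF' /forallP conn; apply/forallP => x; apply/forallP => y.
have /forallP/(_ y) := conn x; apply: connect_sub => u v uv.
exact: connect1 (FF' _ uv).
Qed.

Lemma initialS (n m m' : nat) : m <= m' -> initial n m \subset initial n m'.
Proof. by move=> mm'; apply/subsetP => i; rewrite !inE => /leq_trans; apply. Qed.

(** A MultiTree inside [m] makes both graphs connected by time m, so [m_star] is not below the
    maximum. Conversely the maximum lies in the window: above [m0] because the first graph is
    disconnected there, and at most [m1], which also excludes the default value of [least_upto]. *)
Lemma m_star_eq (n : nat) (e1 e2 : edge_seq n) (m0 m1 : nat) :
  m1 <= 'C(n, 2) ->
  ~~ graph_connected (e1 @: initial n m0) ->
  graph_connected (e1 @: initial n m1) -> graph_connected (e2 @: initial n m1) ->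
  (forall m, m0 <= m -> m <= m1 ->
     graph_connected (e1 @: initial n m) -> graph_connected (e2 @: initial n m) ->
     exists2 J : {set 'I_'C(n, 2)}, J \subset initial n m & multitree e1 e2 J) ->
  m_star e1 e2 == maxn (m_conn e1) (m_conn e2).
Proof.
move=> m1N dis1 conn1 conn2 exJ.
have le1 : m_conn e1 <= m1 by apply: least_upto_le.
have le2 : m_conn e2 <= m1 by apply: least_upto_le.
have c1 : graph_connected (e1 @: initial n (m_conn e1)).
  exact: (@least_uptoP _ (fun m => graph_connected (e1 @: initial n m)) (leq_trans le1 m1N)).
have c2 : graph_connected (e2 @: initial n (m_conn e2)).
  exact: (@least_uptoP _ (fun m => graph_connected (e2 @: initial n m)) (leq_trans le2 m1N)).
have gt0 : m0 < m_conn e1.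
  rewrite ltnNge; apply: contraNN dis1 => le; apply: graph_connectedS c1.
  by apply/imsetS/initialS.
set m := maxn _ _.
have mm1 : m <= m1 by rewrite geq_max le1.
have le_star : m_star e1 e2 <= m.
  apply: least_upto_le; first exact: leq_trans mm1 m1N.
  have [|||J JI mJ] := exJ m _ mm1.
  - by rewrite (leq_trans (ltnW gt0)) // leq_maxl.
  - by apply: graph_connectedS c1; apply/imsetS/initialS; rewrite leq_maxl.
  - by apply: graph_connectedS c2; apply/imsetS/initialS; rewrite leq_maxr.
  by apply/existsP; exists J; rewrite JI.
have starN := leq_trans le_star (leq_trans mm1 m1N).
rewrite eqn_leq le_star geq_max /=.
have /existsP[J /and3P[JI /and3P[_ t1 _] /and3P[_ t2 _]]] := least_uptoP starN.
by apply/andP; split; apply: least_upto_le => //;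
  [apply: graph_connectedS t1 | apply: graph_connectedS t2]; apply: imsetS.
Qed.

Local Open Scope ring_scope.

Section Expectation.
Variables (R : realFieldType) (n : nat).
Implicit Types (f g : edge_seq n -> R) (e : edge_seq n) (G : {set {set 'I_n}}).
Local Notation N := 'C(n, 2).

Definition Ex (f : edge_seq n -> R) : R :=
  (\sum_(e in orderings n) f e) / #|orderings n|%:R.

Lemma orderings_gt0 : (0 < #|orderings n|)%N.
Proof.
have cK : #|K_edges n| = N by rewrite card_draws card_ord.
apply/card_gt0P; exists [ffun i => enum_val (cast_ord (esym cK) i)].
have inj : injective [ffun i => enum_val (cast_ord (esym cK) i)].
  by move=> i j; rewrite !ffunE => /enum_val_inj/cast_ord_inj.
rewrite inE; apply/andP; split; first exact/injectiveP.
rewrite eqEcard; apply/andP; split; last by rewrite card_imset // cardsT card_ord cK.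
by apply/subsetP => _ /imsetP[i _ ->]; rewrite ffunE enum_valP.
Qed.

Let O0 : (#|orderings n|%:R : R) != 0.
Proof. by rewrite pnatr_eq0 -lt0n orderings_gt0. Qed.

Lemma ExD f g : Ex (fun e => f e + g e) = Ex f + Ex g.
Proof. by rewrite /Ex big_split /= mulrDl. Qed.

Lemma ExZ a f : Ex (fun e => a * f e) = a * Ex f.
Proof. by rewrite /Ex -big_distrr /= mulrA. Qed.

Lemma Ex_sum (I : finType) (P : pred I) (F : I -> edge_seq n -> R) :
  Ex (fun e => \sum_(i | P i) F i e) = \sum_(i | P i) Ex (F i).
Proof. by rewrite /Ex exchange_big /= big_distrl. Qed.

Lemma Ex_cst a : Ex (fun=> a) = a.
Proof. by rewrite /Ex sumr_const -(mulr_natr a) mulfK. Qed.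

Lemma eq_Ex f g : (forall e, e \in orderings n -> f e = g e) -> Ex f = Ex g.
Proof. by move=> fg; congr (_ / _); apply: eq_bigr. Qed.

Lemma le_Ex f g : (forall e, e \in orderings n -> f e <= g e) -> Ex f <= Ex g.
Proof. by move=> fg; rewrite ler_wpM2r ?invr_ge0 //; apply: ler_sum. Qed.

Lemma Ex_ge0 f : (forall e, e \in orderings n -> 0 <= f e) -> 0 <= Ex f.
Proof. by move=> f0; rewrite -[0](Ex_cst 0); apply: le_Ex. Qed.

Definition swap (i j : 'I_N) e : edge_seq n := [ffun k => e (tperm i j k)].

Lemma swapK i j : involutive (swap i j).
Proof. by move=> e; apply/ffunP => k; rewrite !ffunE tpermK. Qed.

Lemma swap_ordering i j e : (swap i j e \in orderings n) = (e \in orderings n).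
Proof.
suff imp e' : e' \in orderings n -> swap i j e' \in orderings n.
  by apply/idP/idP => [/imp|/imp //]; rewrite swapK.
rewrite !inE => /andP[/injectiveP e'i /eqP e'K]; apply/andP; split.
  by apply/injectiveP => k l; rewrite !ffunE => /e'i/perm_inj.
rewrite -e'K; apply/eqP/setP => s; apply/imsetP/imsetP => -[k _ ->].
  by exists (tperm i j k); rewrite ?ffunE.
by exists (tperm i j k); rewrite ?ffunE ?tpermK.
Qed.

Lemma Ex_swap i j f : Ex (fun e => f (swap i j e)) = Ex f.
Proof.
congr (_ / _); rewrite [RHS](reindex_inj (inv_inj (swapK i j))) /=.
by apply: eq_bigl => e; rewrite swap_ordering.
Qed.

(* f depends on e only through its values at the positions in s and the set of
   its values elsewhere. *)
Definition supported (s : {set 'I_N}) (f : edge_seq n -> R) : Prop :=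
  forall i j e, i \notin s -> j \notin s -> f (swap i j e) = f e.

(* The positions outside s are exchangeable given f, and exactly g of them carry
   an edge of G. *)
Lemma Ex_step (s : {set 'I_N}) f G (g : nat) i :
  supported s f -> i \notin s ->
  (forall e, e \in orderings n -> f e != 0 -> #|[set j | (j \notin s) && (e j \in G)]| = g) ->
  (N - #|s|)%:R * Ex (fun e => f e * (e i \in G)%:R) = g%:R * Ex f.
Proof.
move=> sf is_ Gg.
have -> : g%:R * Ex f = Ex (fun e => \sum_(j | j \notin s) f e * (e j \in G)%:R).
  rewrite -ExZ; apply: eq_Ex => e eO; rewrite -big_distrr /= mulrC.
  have [->|fe0] := eqVneq (f e) 0; first by rewrite !mul0r.
  congr (_ * _); rewrite -(Gg e eO fe0) -sum1_card natr_sum.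
  rewrite big_mkcond [RHS]big_mkcond /=; apply: eq_bigr => j _.
  by rewrite inE; case: (j \in s) => //=; case: (e j \in G).
rewrite Ex_sum (eq_bigr (fun=> Ex (fun e => f e * (e i \in G)%:R))) => [|j js].
  rewrite sumr_const mulr_natl; congr (_ *+ _).
  have cardCs : (N - #|s|)%N = #|[predC s]|.
    by have := cardC (mem s); rewrite card_ord => {1}<-; rewrite addKn.
  by rewrite cardCs; apply: eq_card => j; rewrite !inE.
rewrite -(Ex_swap i j); apply: eq_Ex => e _; rewrite sf // ffunE.
by rewrite tpermR.
Qed.

End Expectation.

Lemma card_preim_ordering (n : nat) (e : edge_seq n) (G : {set {set 'I_n}}) :
  e \in orderings n -> G \subset K_edges n -> #|[set j | e j \in G]| = #|G|.
Proof.
move=> eO /subsetP GK; rewrite -(card_imset _ (ordering_inj eO)); apply: eq_card => s.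
apply/imsetP/idP => [[j + ->]|sG]; first by rewrite inE.
have [j ejs] : exists j, e j = s.
  by apply: (ordering_surj eO); apply/eqP; have := GK s sG; rewrite inE.
by exists j; rewrite // inE ejs.
Qed.

Lemma disjoint_setU1l (T : finType) (x : T) (A B : {set T}) :
  [disjoint x |: A & B] = (x \notin B) && [disjoint A & B].
Proof. by rewrite -disjointU1; apply: eq_disjoint => y; rewrite !inE. Qed.

(** * Exponential moments of edge counts without replacement *)

Section MGF.
Variables (R : realFieldType) (n : nat).
Local Notation N := 'C(n, 2).
Variables (s : {set 'I_N}) (f : edge_seq n -> R) (G : {set {set 'I_n}}).
Hypotheses (sf : supported s f) (f_ge0 : forall e, 0 <= f e) (GK : G \subset K_edges n).
Hypothesis f_out : forall e j, f e != 0 -> j \in s -> e j \notin G.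

Definition hit (J : {set 'I_N}) (e : edge_seq n) : R :=
  f e * \prod_(j in J) (e j \in G)%:R.

Lemma hit_ge0 J e : 0 <= hit J e.
Proof. by apply: mulr_ge0 => //; apply: prodr_ge0. Qed.

Lemma hit_setU1 (J : {set 'I_N}) i (e : edge_seq n) : i \notin J -> hit (i |: J) e = hit J e * (e i \in G)%:R.
Proof. by move=> iJ; rewrite /hit big_setU1 //= mulrAC mulrA. Qed.

(** Once the positions of J have hit G, exactly #|G| - #|J| edges of G remain outside s and J, since
    by [f_out] none sits at a position of s. *)
Lemma hit_step (J : {set 'I_N}) i : [disjoint s & J] -> i \notin s -> i \notin J ->
  (N - (#|s| + #|J|))%:R * Ex (hit (i |: J)) = (#|G| - #|J|)%:R * Ex (hit J).
Proof.
move=> sJ is_ iJ; have -> : (#|s| + #|J|)%N = #|s :|: J|.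
  by rewrite cardsU (disjoint_setI0 sJ) cards0 subn0.
rewrite -(@Ex_step R n (s :|: J) (hit J) G (#|G| - #|J|) i).
- by congr (_ * _); apply: eq_Ex => e _; rewrite hit_setU1.
- move=> k l e; rewrite !inE !negb_or => /andP[ks kJ] /andP[ls lJ].
  rewrite /hit sf //; congr (_ * _); apply: eq_bigr => j jJ.
  by rewrite ffunE tpermD //; apply: contraTneq jJ => <-.
- by rewrite inE negb_or is_.
move=> e eO; rewrite /hit mulf_eq0 negb_or prodf_seq_neq0 => /andP[fe /allP inG].
have JG j : j \in J -> e j \in G.
  by move=> jJ; have := inG j (mem_index_enum j); rewrite jJ /=; case: (_ \in G); rewrite ?eqxx.
rewrite -(card_preim_ordering eO GK) -[X in (X - _)%N](cardsID J).
rewrite (setIidPr _) ?addKn; last by apply/subsetP => j /JG; rewrite inE.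
apply: eq_card => j; rewrite !inE negb_or -andbA andbCA; case: (j \in J) => //=.
have [js|//] := boolP (j \in s).
by rewrite (negPf (f_out fe js)).
Qed.

Hypothesis Gle : (#|G| <= N - #|s|)%N.
Let p : R := #|G|%:R / (N - #|s|)%:R.

(** Each further hit is less likely than the first: (g - j) / (M - j) <= g / M when g <= M. *)
Lemma hit_le (J : {set 'I_N}) : [disjoint s & J] -> Ex (hit J) <= p ^+ #|J| * Ex f.
Proof.
have [k] := ubnP #|J|; elim: k J => // k IHk J.
have [->|[i iJ]] := set_0Vmem J.
  rewrite cards0 expr0 mul1r => _ _; rewrite (@eq_Ex R n _ f) // => e _.
  by rewrite /hit big_set0 mulr1.
rewrite (cardsD1 i) iJ add1n ltnS => ltk sJ.
have sJ' : [disjoint s & J :\ i] by apply: disjointWr sJ; apply: subD1set.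
have is_ : i \notin s by apply: contraTN iJ => is_; rewrite (disjointFr sJ is_).
have := hit_step sJ' is_ (negbT (setD11 i J)); rewrite setD1K // => stepE.
have ltd : (#|s| + #|J :\ i| < N)%N.
  have := subset_leq_card (subsetT (i |: (s :|: J :\ i))).
  rewrite cardsT card_ord cardsU1 cardsU (disjoint_setI0 sJ') cards0 subn0.
  by rewrite !inE negb_or is_ eqxx.
have IH := IHk _ ltk sJ'.
rewrite exprS -mulrA; apply: (@le_trans _ _ (p * Ex (hit (J :\ i)))); last first.
  by rewrite ler_wpM2l // divr_ge0.
have E0 : 0 <= Ex (hit (J :\ i)) by apply: Ex_ge0 => e _; apply: hit_ge0.
have d0 : 0 < (N - (#|s| + #|J :\ i|))%:R :> R by rewrite ltr0n subn_gt0.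
have d1 : 0 < (N - #|s|)%:R :> R.
  by rewrite ltr0n subn_gt0 (leq_ltn_trans _ ltd) // leq_addr.
rewrite -(ler_pM2l d0) stepE [X in _ <= X]mulrA; apply: ler_wpM2r => //.
rewrite /p mulrA ler_pdivlMr // -!natrM ler_nat.
have arith (g t j M : nat) : (g <= M - t -> (g - j) * (M - t) <= (M - (t + j)) * g)%N.
  by clear; rewrite subnDA; move: (M - t)%N => d gd; nia.
exact: arith.
Qed.

Variables (al be : R).
Hypotheses (al0 : 0 <= al) (be0 : 0 <= be).

(** Expanding one factor moves its position from B to A or drops it. As [al] and [be] are
    nonnegative, the upper bounds on joint hits can replace independence. *)
Lemma mgf_hit (A B : {set 'I_N}) :
  [disjoint s & A] -> [disjoint s & B] -> [disjoint A & B] ->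
  Ex (fun e => hit A e * \prod_(j in B) (al + be * (e j \in G)%:R)) <=
    (al + be * p) ^+ #|B| * (p ^+ #|A| * Ex f).
Proof.
have [k] := ubnP #|B|; elim: k A B => // k IHk A B.
have [->|[i iB]] := set_0Vmem B.
  rewrite cards0 expr0 mul1r => _ sA _ _; apply: le_trans (hit_le sA).
  by apply: le_Ex => e _; rewrite big_set0 mulr1.
rewrite (cardsD1 i) iB add1n ltnS => ltk sA sB AB.
have sB' : [disjoint s & B :\ i] by apply: disjointWr sB; apply: subD1set.
have AB' : [disjoint A & B :\ i] by apply: disjointWr AB; apply: subD1set.
have iA : i \notin A by apply: contraTN iB => iA; rewrite (disjointFr AB iA).
have is_ : i \notin s by apply: contraTN iB => is_; rewrite (disjointFr sB is_).
have sA' : [disjoint s & i |: A].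
  by rewrite disjoint_sym disjoint_setU1l is_ disjoint_sym.
have AB'' : [disjoint i |: A & B :\ i] by rewrite disjoint_setU1l setD11.
have := IHk _ _ ltk sA sB' AB'; have := IHk _ _ ltk sA' sB' AB''.
set q := (_ + _) ^+ _; rewrite cardsU1 iA add1n !exprS => H1 H2.
rewrite (@eq_Ex _ _ _ (fun e =>
  al * (hit A e * \prod_(j in B :\ i) (al + be * (e j \in G)%:R)) +
  be * (hit (i |: A) e * \prod_(j in B :\ i) (al + be * (e j \in G)%:R)))); last first.
  move=> e _; rewrite hit_setU1 // (big_setD1 i iB) /=; ring.
rewrite ExD !ExZ.
apply: (le_trans (lerD (ler_wpM2l al0 H2) (ler_wpM2l be0 H1))).
rewrite -/q le_eqVlt; apply/orP; left; apply/eqP; ring.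
Qed.

Lemma mgf (B : {set 'I_N}) : [disjoint s & B] ->
  Ex (fun e => f e * \prod_(j in B) (al + be * (e j \in G)%:R)) <=
    (al + be * p) ^+ #|B| * Ex f.
Proof.
move=> sB; have := @mgf_hit set0 B; rewrite cards0 expr0 mul1r.
rewrite !(disjoint_sym _ set0) -!setI_eq0 !set0I eqxx => /(_ isT) H.
apply: le_trans (H _ isT); last by rewrite setI_eq0.
by apply: le_Ex => e _; rewrite /hit big_set0 mulr1.
Qed.

End MGF.

Lemma prod_if_count (R : realFieldType) (T : finType) (B : {set T}) (P : pred T) (th : R) :
  \prod_(j in B) (if P j then th else 1) = th ^+ #|[set j in B | P j]|.
Proof.
by rewrite -big_mkcondr /= -prodr_const; apply: eq_bigl => j; rewrite inE.
Qed.

Section Tails.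
Variables (R : realFieldType) (n : nat).
Local Notation N := 'C(n, 2).
Variables (s B : {set 'I_N}) (f : edge_seq n -> R) (G : {set {set 'I_n}}).
Hypotheses (sf : supported s f) (f_ge0 : forall e, 0 <= f e) (GK : G \subset K_edges n).
Hypothesis f_out : forall e j, f e != 0 -> j \in s -> e j \notin G.
Hypotheses (Gle : (#|G| <= N - #|s|)%N) (sB : [disjoint s & B]).
Let p : R := #|G|%:R / (N - #|s|)%:R.

Lemma upper_tail (th : R) (r : nat) : 1 <= th ->
  Ex (fun e => f e * (r <= #|[set j in B | e j \in G]|)%N%:R) <=
    (1 + (th - 1) * p) ^+ #|B| / th ^+ r * Ex f.
Proof.
move=> th1; have th0 : 0 < th by lra.
have thr : 0 < th ^+ r by rewrite exprn_gt0.
rewrite -(ler_pM2l thr) [X in _ <= X]mulrA [X in _ <= X * _]mulrC divfK ?gt_eqF // -ExZ.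
have th10 : 0 <= th - 1 by lra.
apply: le_trans (mgf sf f_ge0 GK f_out Gle ler01 th10 sB).
apply: le_Ex => e _; rewrite mulrCA; apply: ler_wpM2l => //.
rewrite (eq_bigr (fun j => if e j \in G then th else 1)) => [|j _]; last first.
  by case: (_ \in G); rewrite ?mulr1 ?mulr0 ?addr0 // addrC subrK.
rewrite prod_if_count; case: leqP => [le|_]; last by rewrite mulr0 exprn_ge0 // ltW.
by rewrite mulr1 ler_weXn2l.
Qed.

(** A miss gets weight th and a hit weight 1. This is th + (1 - th) times the indicator of a hit,
    again with nonnegative coefficients, so [mgf] covers this tail as well. *)
Lemma lower_tail (th : R) (r : nat) : 0 < th -> th <= 1 ->
  Ex (fun e => f e * (#|[set j in B | e j \notin G]| <= r)%N%:R) <=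
    (th + (1 - th) * p) ^+ #|B| / th ^+ r * Ex f.
Proof.
move=> th0 th1.
have thr : 0 < th ^+ r by rewrite exprn_gt0.
rewrite -(ler_pM2l thr) [X in _ <= X]mulrA [X in _ <= X * _]mulrC divfK ?gt_eqF // -ExZ.
have th10 : 0 <= 1 - th by lra.
apply: le_trans (mgf sf f_ge0 GK f_out Gle (ltW th0) th10 sB).
apply: le_Ex => e _; rewrite mulrCA; apply: ler_wpM2l => //.
rewrite (eq_bigr (fun j => if e j \notin G then th else 1)) => [|j _]; last first.
  by case: (_ \in G); rewrite ?mulr1 ?mulr0 ?addr0 //= addrC subrK.
rewrite prod_if_count; case: leqP => [le|_]; last by rewrite mulr0 exprn_ge0 // ltW.
by rewrite mulr1 ler_wiXn2l // ltW.
Qed.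

End Tails.

(** * Elementary probability estimates *)

Definition inner (n : nat) (S : {set 'I_n}) : {set {set 'I_n}} :=
  [set s in K_edges n | s \subset S].

Lemma innerK (n : nat) (S : {set 'I_n}) : inner S \subset K_edges n.
Proof. by apply/subsetP => s; rewrite inE => /andP[]. Qed.

Lemma card_inner (n : nat) (S : {set 'I_n}) : #|inner S| = 'C(#|S|, 2).
Proof.
rewrite -cards_draws; apply: eq_card => s.
by rewrite !inE andbC.
Qed.

Lemma card_K_edges (n : nat) : #|K_edges n| = 'C(n, 2).
Proof. by rewrite card_draws card_ord. Qed.

Lemma in_inner (n : nat) (e : edge_seq n) i S :
  e \in orderings n -> (e i \in inner S) = (e i \subset S).
Proof. by move=> eO; rewrite !inE (ordering_card i eO). Qed.

Section Union.
Variables (R : realFieldType) (n : nat).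
Local Notation N := 'C(n, 2).

Lemma Ex_union (I : finType) (P : pred I) (E : I -> edge_seq n -> bool)
    (A : edge_seq n -> bool) :
  (forall e, e \in orderings n -> A e -> exists2 i, P i & E i e) ->
  Ex (fun e => (A e)%:R : R) <= \sum_(i | P i) Ex (fun e => (E i e)%:R).
Proof.
move=> AE; rewrite -Ex_sum; apply: le_Ex => e eO; case: (boolP (A e)) => [/(AE e eO)|_].
  by move=> [i Pi Ei]; rewrite (bigD1 i) //= Ei lerDl sumr_ge0.
exact: sumr_ge0.
Qed.

Lemma Ex_le1 (A : edge_seq n -> bool) : Ex (fun e => (A e)%:R : R) <= 1.
Proof.
by rewrite -[leRHS](Ex_cst n); apply: le_Ex => e _; case: (A e); rewrite ?ler01.
Qed.

Variables (B : {set 'I_N}) (G : {set {set 'I_n}}).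
Hypothesis GK : G \subset K_edges n.

Let one : edge_seq n -> R := fun=> 1.
Let supp1 : supported set0 one. Proof. by []. Qed.
Let one_ge0 e : 0 <= one e. Proof. exact: ler01. Qed.
Let one_out e j : one e != 0 -> j \in (set0 : {set 'I_N}) -> e j \notin G.
Proof. by rewrite inE. Qed.
Let GN : (#|G| <= N - #|(set0 : {set 'I_N})|)%N.
Proof. by rewrite cards0 subn0 -card_K_edges subset_leq_card. Qed.
Let dis0 : [disjoint (set0 : {set 'I_N}) & B].
Proof. by rewrite -setI_eq0 set0I. Qed.

Lemma all_hit :
  Ex (fun e => [forall i in B, e i \in G]%:R) <= (#|G|%:R / N%:R : R) ^+ #|B|.
Proof.
have := hit_le supp1 one_ge0 GK one_out GN dis0.
rewrite cards0 subn0 (_ : Ex one = 1) ?mulr1; last exact: Ex_cst.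
move=> H; apply: (le_trans _ H); apply: le_Ex => e _; rewrite /hit mul1r.
case: (boolP [forall i in B, e i \in G]) => [/forall_inP all|_]; last exact: prodr_ge0.
by rewrite big1 // => i iB; rewrite all.
Qed.

Lemma upper_tail1 (th : R) (r : nat) : 1 <= th ->
  Ex (fun e => (r <= #|[set j in B | e j \in G]|)%N%:R) <=
    (1 + (th - 1) * (#|G|%:R / N%:R)) ^+ #|B| / th ^+ r.
Proof.
move=> th1; have := upper_tail supp1 one_ge0 GK one_out GN dis0 r th1.
rewrite cards0 subn0 (_ : Ex one = 1) ?mulr1; last exact: Ex_cst.
by move=> H; apply: (le_trans _ H); apply: le_Ex => e _; rewrite mul1r.
Qed.

End Union.

Section Meet.
Variables (R : realFieldType) (n : nat).
Local Notation N := 'C(n, 2).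

Lemma bin2R (k : nat) : ('C(k, 2)%:R : R) = k%:R * (k%:R - 1) / 2.
Proof.
apply: (@mulIf _ 2); rewrite ?pnatr_eq0 // divfK ?pnatr_eq0 //.
case: k => [|k]; first by rewrite bin0n !mul0r.
have -> : k.+1%:R - 1 = k%:R :> R by rewrite -natr1 addrK.
rewrite -!natrM; congr (_%:R).
by rewrite mulnC -mul_bin_diag /= bin1.
Qed.

(** Condition on e i = g. Removing g and the edges inside its complement leaves at most 2n - 4 edges
    that meet g, and (2n - 4) / (N - 1) = 4 / (n + 1). *)
Lemma meet_prob (i j : 'I_N) : (1 < n)%N -> i != j ->
  Ex (fun e : edge_seq n => (~~ [disjoint e i & e j])%:R : R) <= 4 / n%:R.
Proof.
move=> n_gt1 ij.
pose G g := [set s in K_edges n | (s != g) && ~~ [disjoint g & s]].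
pose f g : edge_seq n -> R := fun e => (e i == g)%:R.
have supf g : supported [set i] (f g).
  by move=> k l e; rewrite !inE => ki li; rewrite /f ffunE tpermD.
have f0 g e : 0 <= f g e by [].
have GK g : G g \subset K_edges n by apply/subsetP => s; rewrite inE => /andP[].
have fout g e k : f g e != 0 -> k \in [set i] -> e k \notin G g.
  rewrite /f !inE => fe /eqP->; move: fe; case: (eqVneq (e i) g) => [->|_]; last by rewrite eqxx.
  by rewrite andbF.
have N2 : (1 < N)%N.
  have := max_card [set i; j]; rewrite cards2 ij card_ord //.
have cG g : g \in K_edges n -> (#|G g| + 1 + 'C(n - 2, 2) <= N)%N.
  move=> gK; have g2 : #|g| = 2 by apply/eqP; move: gK; rewrite inE.
  have -> : 'C(n - 2, 2) = #|inner (~: g)|.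
    by rewrite card_inner cardsCs setCK card_ord g2.
  have -> : (#|G g| + 1 + #|inner (~: g)| = #|(g |: G g) :|: inner (~: g)|)%N.
    rewrite cardsU cardsU1 !inE eqxx andbF (_ : _ :&: _ = set0) ?cards0 ?subn0 1?[in LHS]addnC //.
      by rewrite addnC [(_ + 1)%N]addnC.
    apply/setP => s; rewrite !inE; apply/negP => /andP[/orP[/eqP->|/and3P[_ _ gs]] /andP[sK]].
      move/subsetP => sub; have /set0Pn[x xg] : g != set0 by rewrite -card_gt0 g2.
      by have := sub x xg; rewrite inE xg.
    by apply/negP; move: gs; rewrite disjoint_sym disjoints_subset.
  rewrite -card_K_edges subset_leq_card // !subUset sub1set gK GK innerK //.
rewrite (@le_trans _ _ (\sum_(g in K_edges n) Ex (fun e => f g e * (e j \in G g)%:R))) //.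
  rewrite -Ex_sum; apply: le_Ex => e eO.
  case: (boolP [disjoint e i & e j]) => dis; first by apply: sumr_ge0 => g _; apply: mulr_ge0.
  have eiK : e i \in K_edges n by rewrite inE (ordering_card i eO).
  rewrite (bigD1 (e i)) //= /f eqxx mul1r !inE (ordering_card j eO) eqxx dis.
  rewrite (inj_eq (ordering_inj eO)) eq_sym ij /= lerDl.
  by apply: sumr_ge0 => g _; apply: mulr_ge0.
have -> : 4 / n%:R = \sum_(g in K_edges n) 4 / n%:R * Ex (f g).
  rewrite -big_distrr /= -Ex_sum -[LHS]mulr1; congr (_ * _).
  rewrite -[LHS](Ex_cst n); apply: eq_Ex => e eO.
  have eiK : e i \in K_edges n by rewrite inE (ordering_card i eO).
  rewrite (bigD1 (e i)) //= /f eqxx big1 ?addr0 // => g /andP[_ /negPf].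
  by rewrite eq_sym => ->.
apply: ler_sum => g gK.
have E0 : 0 <= Ex (f g) by apply: Ex_ge0.
have Gle : (#|G g| <= N - #|[set i]|)%N by rewrite cards1; have := cG g gK; lia.
have := @hit_le R n [set i] (f g) (G g) (supf g) (f0 g) (GK g) (fout g) Gle [set j].
rewrite disjoints1 inE ij !cards1 expr1 => /(_ isT) H.
rewrite (le_trans (le_trans _ H)) //.
  by apply: le_Ex => e _; rewrite /hit big_set1.
apply: ler_wpM2r => //.
have N1 : (0 : R) < (N - 1)%:R by rewrite ltr0n; lia.
have n0 : (0 : R) < n%:R by rewrite ltr0n; lia.
rewrite ler_pdivrMr // mulrAC ler_pdivlMr //.
have := cG g gK; rewrite -(ler_nat R) !natrD !bin2R !natrB // ?bin2R; last by lia.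
move: n0; have : (2 : R) <= n%:R by rewrite ler_nat.
by move: (#|G g|%:R) (n%:R : R) => x y; nra.
Qed.

End Meet.

(** * Typical orderings *)

Lemma sum_powerset (R : comNzRingType) (n : nat) (q : R) :
  \sum_(S : {set 'I_n}) q ^+ #|S| = (1 + q) ^+ n.
Proof.
have := @bigA_distr _ 0 1 *%R +%R 'I_n (fun=> q) (fun=> 1).
rewrite prodr_const card_ord addrC => ->; apply: eq_big => [S|S _]; first by rewrite inE.
by rewrite -big_mkcond /= prodr_const.
Qed.

Section ExpBounds.
Variable (R : realType).

Lemma exprn_le_expR (y z : R) (k : nat) : 0 <= y -> y <= expR z -> y ^+ k <= expR (k%:R * z).
Proof. by move=> y0 yz; rewrite expRM_natl lerXn2r // nnegrE expR_ge0. Qed.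

Lemma expR_le_quad (y : R) : 0 <= y -> y <= 1 / 2 -> expR y <= 1 + y + 2 * y ^+ 2.
Proof.
move=> y0 y1; have := expR_ge1Dx (- y); rewrite expRN => h.
have e0 := expR_gt0 y; have : (1 - y) * expR y <= 1 by rewrite -ler_pdivlMr // div1r.
by move: (expR y) e0 => z; nra.
Qed.

(** For union bounds over vertex sets with a price q per vertex: the sum is (1 + q)^n - 1. *)
Lemma sum_nonempty_sets (n : nat) (q : R) : 0 <= q -> n%:R * q <= 1 / 2 ->
  \sum_(S : {set 'I_n} | S != set0) q ^+ #|S| <= 2 * (n%:R * q).
Proof.
move=> q0 nq; have := sum_powerset n q; rewrite (bigD1 set0) //= cards0 expr0 => E.
have : (1 + q) ^+ n <= expR (n%:R * q) by apply: exprn_le_expR (expR_ge1Dx q); lra.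
have nq0 : 0 <= n%:R * q by rewrite mulr_ge0.
have := expR_le_quad nq0 nq; rewrite -E; move: (n%:R * q) nq nq0 => y.
by move: (\sum_(_ | _) _) (expR _) => a b; nra.
Qed.

End ExpBounds.

Lemma card_inner_split (n : nat) (S : {set 'I_n}) :
  (#|inner S :|: inner (~: S)| <= 'C(#|S|, 2) + 'C(n - #|S|, 2))%N.
Proof.
rewrite (leq_trans (leq_card_setU _ _)) // !card_inner leq_add2l.
by rewrite -[X in (_ <= 'C(X - _, _))%N](card_ord n) cardsCs setCK.
Qed.

Lemma card_set_le (n : nat) (S : {set 'I_n}) : (#|S| <= n)%N.
Proof. by rewrite -[leqRHS](card_ord n) max_card. Qed.

Section Densities.
Variables (R : realFieldType) (n : nat).
Hypothesis n_gt1 : (1 < n)%N.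

Let n2 : (2 : R) <= n%:R. Proof. by rewrite ler_nat. Qed.
Let N0 : (0 : R) < 'C(n, 2)%:R. Proof. by rewrite ltr0n bin_gt0. Qed.

Lemma inner_density (S : {set 'I_n}) :
  (#|inner S|%:R / 'C(n, 2)%:R : R) <= (#|S|%:R / n%:R) ^+ 2.
Proof.
have n0 : (0 : R) < n%:R by rewrite ltr0n ltnW.
rewrite ler_pdivrMr // card_inner !bin2R expr_div_n [leRHS]mulrAC ler_pdivlMr ?exprn_gt0 //.
have : (#|S|%:R : R) <= n%:R by rewrite ler_nat card_set_le.
have : (0 : R) <= #|S|%:R by [].
move: n2 n0; move: (#|S|%:R : R) (n%:R : R) => s t t2 t0 s0 st.
rewrite -subr_ge0.
rewrite (_ : _ - _ = s * t * (t - s) / 2); last by field.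
by rewrite divr_ge0 // !mulr_ge0 //; lra.
Qed.

Lemma split_density (S : {set 'I_n}) :
  (#|inner S :|: inner (~: S)|%:R / 'C(n, 2)%:R : R) <=
    (#|S|%:R / n%:R) ^+ 2 + (1 - #|S|%:R / n%:R) ^+ 2.
Proof.
have n0 : (0 : R) < n%:R by rewrite ltr0n ltnW.
apply: (@le_trans _ _ ((#|inner S|%:R + #|inner (~: S)|%:R) / 'C(n, 2)%:R)).
  by apply: ler_wpM2r; [rewrite invr_ge0 ltW | rewrite -natrD ler_nat leq_card_setU].
rewrite mulrDl; apply: lerD; first exact: inner_density.
rewrite (le_trans (inner_density _)) //.
rewrite cardsCs setCK card_ord natrB ?card_set_le // mulrBl divff ?gt_eqF //.
Qed.

(** Linear in #|S|, so that the probability that [m1] edges all avoid the cut becomes a price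
    e^(-2000 x) per vertex of S. *)
Lemma split_density_small (S : {set 'I_n}) : (2 * #|S| <= n)%N ->
  (#|inner S :|: inner (~: S)|%:R / 'C(n, 2)%:R : R) <= 1 - #|S|%:R / n%:R.
Proof.
move=> Sn; have n0 : (0 : R) < n%:R by rewrite ltr0n ltnW.
rewrite ler_pdivrMr //.
apply: (@le_trans _ _ (('C(#|S|, 2) + 'C(n - #|S|, 2))%:R)).
  by rewrite ler_nat card_inner_split.
have Sn' : 2 * #|S|%:R <= n%:R :> R by rewrite -natrM ler_nat.
have s0 : (0 : R) <= #|S|%:R by [].
rewrite natrD !bin2R natrB ?card_set_le //.
move: n2 n0 Sn' s0; move: (#|S|%:R : R) (n%:R : R) => s t t2 t0 st s0.
rewrite -subr_ge0.
rewrite (_ : _ - _ = s * (t + 1 - 2 * s) / 2); last by field; lra.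
by rewrite divr_ge0 // !mulr_ge0 //; lra.
Qed.

End Densities.

(* Here x stands for the integer part of (ln n) / 1000, so that m0 is about
   0.4 n ln n and m1 about 2 n ln n: below and above the connectivity threshold
   0.5 n ln n.  Any m0 = c n ln n with 1/4 < c < 1/2 leaves fewer than n^(1/2)
   low vertices, which is what the matching condition needs. *)
Section SingleOrdering.
Variables (R : realType) (n m0 m1 K D : nat) (x : R).
Local Notation N := 'C(n, 2).
Hypotheses (n_gt1 : (1 < n)%N) (m1N : (m1 <= N)%N) (m01 : (m0 <= m1)%N).
Hypotheses (x_ge0 : 0 <= x) (KE : K%:R = x) (DE : D%:R = 16 * x).
Hypotheses (m0E : m0%:R = 400 * x * n%:R) (m1E : m1%:R = 2000 * x * n%:R).

Let n2 : (2 : R) <= n%:R. Proof. by rewrite ler_nat. Qed.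
Let n0 : (0 : R) < n%:R. Proof. by rewrite ltr0n ltnW. Qed.
Let N0 : (0 : R) < N%:R. Proof. by rewrite ltr0n bin_gt0. Qed.

Lemma disconnected_cut (e : edge_seq n) (I : {set 'I_N}) :
  e \in orderings n -> ~~ graph_connected (e @: I) ->
  exists2 S : {set 'I_n}, (S != set0) && (2 * #|S| <= n)%N &
    [forall i in I, e i \in inner S :|: inner (~: S)].
Proof.
move=> eO /forallPn[a /forallPn[b nab]].
pose W := [set z | connect (adj (e @: I)) a z].
have side S : S = W \/ S = ~: W -> [forall i in I, e i \in inner S :|: inner (~: S)].
  have Wside : [forall i in I, e i \in inner W :|: inner (~: W)].
    apply/forall_inP => i iI; rewrite inE !in_inner //.
    have cl u v : u \in e i -> v \in e i -> u \in W -> v \in W.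
      move=> ui vi; rewrite !inE => au; apply: connect_trans au _.
      have [->|uv] := eqVneq u v; first exact: connect0.
      by apply: connect_pair; rewrite -(ordering_pair eO ui vi uv) imset_f.
    have [dis|/pred0Pn[u /andP[/= ui uW]]] := boolP [disjoint e i & W].
      by rewrite -(disjoints_subset (e i)) dis orbT.
    by apply/orP; left; apply/subsetP => v vi; apply: cl uW.
  by case=> -> //; rewrite setCK; apply/forall_inP => i iI; rewrite setUC (forall_inP Wside).
have cW : (#|W| + #|~: W| = n)%N by rewrite cardsC card_ord.
have W0 : W != set0 by apply/set0Pn; exists a; rewrite inE connect0.
have CW0 : ~: W != set0 by apply/set0Pn; exists b; rewrite !inE.
have [le|lt] := leqP (2 * #|W|) n.
  by exists W; [rewrite W0 | apply: side; left].
exists (~: W); last by apply: side; right.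
by rewrite CW0 /=; move: cW lt; move: #|W| #|~: W|; clear; lia.
Qed.

Lemma prob_disconnected : n%:R * expR (- (2000 * x)) <= 1 / 2 ->
  Ex (fun e : edge_seq n => (~~ graph_connected (e @: initial n m1))%:R : R) <=
    2 * (n%:R * expR (- (2000 * x))).
Proof.
move=> nq; apply: (le_trans _ (sum_nonempty_sets (expR_ge0 _) nq)).
apply: (@le_trans _ _ (\sum_(S : {set 'I_n} | (S != set0) && (2 * #|S| <= n)%N)
   Ex (fun e : edge_seq n => [forall i in initial n m1, e i \in inner S :|: inner (~: S)]%:R : R))).
  apply: Ex_union => e eO /(disconnected_cut eO)[S S2 HS]; by exists S.
rewrite [leRHS](bigID (fun S : {set 'I_n} => (2 * #|S| <= n)%N)) /=.
rewrite ler_wpDr //; first by apply: sumr_ge0 => S _; rewrite exprn_ge0 // expR_ge0.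
apply: ler_sum => S /andP[_ Sn].
have GK : inner S :|: inner (~: S) \subset K_edges n by rewrite subUset !innerK.
apply: (le_trans (all_hit R (initial n m1) GK)).
rewrite card_initial // -expRM_natl.
have -> : #|S|%:R * - (2000 * x) = m1%:R * - (#|S|%:R / n%:R).
  by rewrite m1E; field; rewrite gt_eqF.
apply: exprn_le_expR; first by rewrite divr_ge0.
by rewrite (le_trans (split_density_small R n_gt1 Sn)) // expR_ge1Dx.
Qed.

End SingleOrdering.

(** * Deviations of edge counts *)

Section Deviation.
Variables (R : realType) (n : nat) (G : {set {set 'I_n}}).
Local Notation N := 'C(n, 2).
Hypothesis GK : G \subset K_edges n.

Lemma upper_tail_expR (B : {set 'I_N}) (P t : R) (r : nat) : 0 <= t ->
  #|G|%:R / N%:R <= P ->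
  Ex (fun e => (r <= #|[set j in B | e j \in G]|)%N%:R) <=
    expR (#|B|%:R * ((expR t - 1) * P) - r%:R * t).
Proof.
move=> t0 GP; have th1 : 1 <= expR t by rewrite (le_trans _ (expR_ge1Dx t)) // lerDl.
apply: (le_trans (upper_tail1 B GK r th1)).
rewrite expRB; apply: ler_pM; rewrite ?invr_ge0 ?exprn_ge0 ?expR_ge0 //.
- by rewrite addr_ge0 // mulr_ge0 ?subr_ge0 // divr_ge0.
- apply: exprn_le_expR; first by rewrite addr_ge0 // mulr_ge0 ?subr_ge0 // divr_ge0.
  rewrite (le_trans _ (expR_ge1Dx _)) // lerD2l ler_wpM2l // subr_ge0 //.
by rewrite expRM_natl.
Qed.

Lemma deviation (B : {set 'I_N}) (P eps : R) : 0 < eps -> eps <= 1 -> P <= 1 ->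
  #|G|%:R / N%:R <= P ->
  Ex (fun e => ((P + eps) * #|B|%:R < #|[set j in B | e j \in G]|%:R)%R%:R) <=
    expR (- (#|B|%:R * (eps ^+ 2 / 8))).
Proof.
move=> e0 e1 P1 GP; have P0 : 0 <= P by rewrite (le_trans _ GP) // divr_ge0.
pose r := (Num.truncn ((P + eps) * #|B|%:R)).+1.
have rge : (P + eps) * #|B|%:R <= r%:R by rewrite ltW // truncnS_gt.
(* The tilt t = eps / 4 minimises 2 t^2 - eps t, with value - eps^2 / 8. *)
have t0 : 0 <= eps / 4 by lra.
apply: (@le_trans _ _ (Ex (fun e => (r <= #|[set j in B | e j \in G]|)%N%:R))).
  apply: le_Ex => e _; rewrite ler_nat; case: ltP => // lt.
  by rewrite lt0b /r truncn_lt_nat ?lt // mulr_ge0 // addr_ge0 // ltW.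
apply: (le_trans (upper_tail_expR B r t0 GP)); rewrite ler_expR.
have h2 : expR (eps / 4) <= 1 + eps / 4 + 2 * (eps / 4) ^+ 2 by apply: expR_le_quad; lra.
have B0 : 0 <= #|B|%:R :> R by [].
have h3 : (expR (eps / 4) - 1) * P <= (eps / 4 + 2 * (eps / 4) ^+ 2) * P.
  by apply: ler_wpM2r => //; lra.
have h4 : (eps / 4 + 2 * (eps / 4) ^+ 2) * P <= eps / 4 * P + 2 * (eps / 4) ^+ 2.
  by have := sqr_ge0 eps; nra.
have h5 := ler_wpM2l B0 (le_trans h3 h4).
have h6 : (P + eps) * #|B|%:R * (eps / 4) <= r%:R * (eps / 4) by apply: ler_wpM2r.
move: h5 h6; move: (#|B|%:R * (_ * P)) (r%:R * _) => a b h5 h6.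
have -> : - (#|B|%:R * (eps ^+ 2 / 8)) =
  #|B|%:R * (eps / 4 * P + 2 * (eps / 4) ^+ 2) - (P + eps) * #|B|%:R * (eps / 4) by field.
by lra.
Qed.

End Deviation.

Section Estimates.
Variables (R : realType) (n m0 m1 K D : nat) (x : R).
Local Notation N := 'C(n, 2).
Hypotheses (n_gt1 : (1 < n)%N) (m1N : (m1 <= N)%N) (m01 : (m0 <= m1)%N).
Hypotheses (x_ge0 : 0 <= x) (KE : K%:R = x) (DE : D%:R = 16 * x).
Hypotheses (m0E : m0%:R = 400 * x * n%:R) (m1E : m1%:R = 2000 * x * n%:R).

Let n0 : (0 : R) < n%:R. Proof. by rewrite ltr0n ltnW. Qed.
Let N0 : (0 : R) < N%:R. Proof. by rewrite ltr0n bin_gt0. Qed.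

Lemma insideE (e : edge_seq n) m S : e \in orderings n ->
  inside e m S = #|[set j in initial n m | e j \in inner S]|.
Proof.
by move=> eO; apply: eq_card => j; rewrite !in_set -!in_inner // !inE (ordering_card j eO).
Qed.

Lemma prob_unbalanced (eps : R) (m : nat) : 0 < eps -> eps <= 1 -> (m <= N)%N ->
  Ex (fun e : edge_seq n => (~~ balanced e eps m)%:R) <=
    2 * (2 ^+ n * expR (- (m%:R * (eps ^+ 2 / 8)))).
Proof.
move=> e0 e1 mN.
have sw (S : {set 'I_n}) : 0 <= (#|S|%:R / n%:R : R) <= 1.
  rewrite divr_ge0 //= ler_pdivrMr // mul1r ler_nat; exact: card_set_le.
pose c (S : {set 'I_n}) : R := #|S|%:R / n%:R.
pose E1 S (e : edge_seq n) := ((c S ^+ 2 + eps) * m%:R < (inside e m S)%:R).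
pose E2 S (e : edge_seq n) := ((c S ^+ 2 + (1 - c S) ^+ 2 + eps) * m%:R <
  (inside e m S + inside e m (~: S))%:R).
have dev S : Ex (fun e => (E1 S e)%:R) <= expR (- (m%:R * (eps ^+ 2 / 8))).
  have P1 : c S ^+ 2 <= 1 by have /andP[c0 c1] := sw S; rewrite expr_le1.
  have := deviation (innerK S) (initial n m) e0 e1 P1 (inner_density R n_gt1 S).
  rewrite card_initial // => H; apply: le_trans H; apply: le_Ex => e eO.
  by rewrite /E1 insideE.
have dev2 S : Ex (fun e => (E2 S e)%:R) <= expR (- (m%:R * (eps ^+ 2 / 8))).
  have P1 : c S ^+ 2 + (1 - c S) ^+ 2 <= 1 by have /andP[] := sw S; rewrite -/(c S); nra.
  have GK : inner S :|: inner (~: S) \subset K_edges n by rewrite subUset !innerK.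
  have := deviation GK (initial n m) e0 e1 P1 (split_density R n_gt1 S).
  rewrite card_initial // => H; apply: le_trans H; apply: le_Ex => e eO.
  rewrite /E2 !insideE //; set a := (_ + _)%N; set b := #|_|.
  suff -> : a = b by [].
  rewrite /a /b -cardsUI [X in (_ + X)%N](_ : _ = 0%N) ?addn0.
    by apply: eq_card => j; rewrite !inE -andb_orr.
  apply/eqP; rewrite cards_eq0; apply/eqP/setP => j; rewrite in_setI !in_set0.
  rewrite !(in_set (fun j => (_ \in initial n m) && _)) !in_inner //.
  apply/negP => /andP[/andP[_ s1] /andP[_ s2]].
  have : e j \subset S :&: ~: S by rewrite subsetI s1.
  rewrite setICr subset0 => /eqP ej0; have := ordering_card j eO.
  by rewrite ej0 cards0.
apply: (@le_trans _ _ (\sum_(S : {set 'I_n}) (Ex (fun e => (E1 S e)%:R) + Ex (fun e => (E2 S e)%:R)))).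
  rewrite (eq_bigr (fun S => Ex (fun e => (E1 S e)%:R + (E2 S e)%:R))) => [|S _]; last by rewrite ExD.
  rewrite -Ex_sum; apply: le_Ex => e _.
  have [_|/forallPn[S]] := boolP (balanced e eps m); first by apply: sumr_ge0 => S _; rewrite addr_ge0.
  rewrite negb_and -!ltNge -/(E1 S e) -/(E2 S e) (bigD1 S) //= => H.
  rewrite ler_wpDr //; first by apply: sumr_ge0 => T _; rewrite addr_ge0.
  rewrite -natrD ler_nat.
  by case: (E1 S e) (E2 S e) H => [] [].
apply: (@le_trans _ _ (\sum_(S : {set 'I_n}) 2 * expR (- (m%:R * (eps ^+ 2 / 8))))).
  by apply: ler_sum => S _; rewrite mulr_natl mulr2n lerD.
rewrite sumr_const -[X in X <= _]mulr_natr.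
have -> : #|xpredT : pred {set 'I_n}| = (2 ^ n)%N.
  transitivity #|powerset [set: 'I_n]|; last by rewrite card_powerset cardsT card_ord.
  by apply: eq_card => S; rewrite [RHS]inE subsetT.
by rewrite natrX -mulrA [X in 2 * X <= _]mulrC.
Qed.

(** The tilt t is tied to the size bound: #|S| <= e^(-t) n caps the first exponent at 2000 x per
    vertex of S, while x edges per vertex gain t x. *)
Lemma prob_not_sparse (s0 : nat) (t : R) : 0 <= t -> s0%:R <= expR (- t) * n%:R ->
  n%:R * expR (- ((t - 2000) * x)) <= 1 / 2 ->
  Ex (fun e : edge_seq n => (~~ sparse e m1 K s0)%:R) <= 2 * (n%:R * expR (- ((t - 2000) * x))).
Proof.
move=> t0 s0E nq; apply: (le_trans _ (sum_nonempty_sets (expR_ge0 _) nq)).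
apply: (@le_trans _ _ (\sum_(S : {set 'I_n} | (S != set0) && (#|S| <= s0)%N)
   Ex (fun e : edge_seq n => (K * #|S| <= #|[set j in initial n m1 | e j \in inner S]|)%N%:R))).
  apply: Ex_union => e eO /forallPn[S]; rewrite negb_imply -ltnNge => /andP[Ss lt].
  exists S; last by rewrite -insideE // ltnW.
  rewrite Ss andbT; apply: contraTneq lt => ->.
  rewrite -leqNgt /inside (_ : [set _ in _ | _] = set0) ?cards0 //.
  apply/setP => i; rewrite !inE subset0; apply/negP => /andP[_ /eqP ei0].
  by have := ordering_card i eO; rewrite ei0 cards0.
rewrite [leRHS](bigID (fun S : {set 'I_n} => (#|S| <= s0)%N)) /=.
rewrite ler_wpDr //; first by apply: sumr_ge0 => S _; rewrite exprn_ge0 // expR_ge0.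
apply: ler_sum => S /andP[_ Sn].
apply: (le_trans (upper_tail_expR (innerK S) (initial n m1) (K * #|S|) t0 (inner_density R n_gt1 S))).
rewrite card_initial // -expRM_natl ler_expR natrM KE.
have sn : #|S|%:R <= expR (- t) * n%:R :> R by rewrite (le_trans _ s0E) // ler_nat.
have e1 : expR t * expR (- t) = 1 :> R by rewrite expRxMexpNx_1.
have h : m1%:R * ((expR t - 1) * (#|S|%:R / n%:R) ^+ 2) <= 2000 * x * #|S|%:R :> R.
  rewrite m1E -!mulrA; do 2! apply: ler_wpM2l => //.
  apply: (@le_trans _ _ (n%:R * (expR t * (#|S|%:R / n%:R) ^+ 2))).
    by apply: ler_wpM2l => //; apply: ler_wpM2r; rewrite ?sqr_ge0 // lerBlDr lerDl.
  rewrite (_ : _ * (_ * _) = #|S|%:R * (expR t * #|S|%:R / n%:R)); last first.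
    by field; rewrite gt_eqF.
  rewrite -[leRHS]mulr1; apply: ler_wpM2l => //.
  rewrite ler_pdivrMr // mul1r (le_trans (ler_wpM2l (expR_ge0 t) sn)) //.
  by rewrite mulrA e1 mul1r.
have s_ge0 : 0 <= #|S|%:R :> R by [].
have -> : #|S|%:R * - ((t - 2000) * x) = 2000 * x * #|S|%:R - x * #|S|%:R * t :> R by ring.
by rewrite lerB.
Qed.

Definition star (v : 'I_n) : {set {set 'I_n}} := K_edges n :\: inner (~: [set v]).

Lemma in_star (e : edge_seq n) v i : e \in orderings n -> (e i \in star v) = (v \in e i).
Proof.
move=> eO; rewrite inE in_inner // !inE (ordering_card i eO) eqxx andbT.
by rewrite subsetC sub1set inE negbK.
Qed.

Lemma card_inner1 (v : 'I_n) : #|inner (~: [set v])|%:R / N%:R = 1 - 2 / n%:R :> R.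
Proof.
have -> : #|inner (~: [set v])|%:R = (n%:R - 1) * (n%:R - 2) / 2 :> R.
  rewrite card_inner cardsC1 card_ord bin2R -subn1 (natrB R (ltnW n_gt1)).
  ring.
rewrite bin2R; have y0 : n%:R != 0 :> R by rewrite gt_eqF.
have y1 : n%:R - 1 != 0 :> R by rewrite subr_eq0 gt_eqF // ltr1n.
by field; rewrite y0 y1.
Qed.

Lemma card_star (v : 'I_n) : #|star v|%:R / N%:R = 2 / n%:R :> R.
Proof.
have := card_inner1 v; rewrite /star cardsD (setIidPr (innerK _)) natrB; last first.
  by rewrite subset_leq_card ?innerK.
rewrite card_K_edges mulrBl divff ?gt_eqF // => ->.
by rewrite opprB addrC subrK.
Qed.

(** The mean degree at time [m1] is 4000 x. With tilt 1/2 the exponent is at most 4000 x - 6000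
    x. *)
Lemma prob_maxdeg (r : nat) (v : 'I_n) : r%:R = 12000 * x ->
  Ex (fun e : edge_seq n => (r <= deg e m1 v)%N%:R) <= expR (- (2000 * x)).
Proof.
move=> rE; have t0 : (0 : R) <= 1 / 2 by rewrite divr_ge0.
have GK : star v \subset K_edges n by rewrite subsetDl.
have Gd : #|star v|%:R / N%:R <= 2 / n%:R :> R by rewrite card_star.
have H := upper_tail_expR GK (initial n m1) r t0 Gd.
apply: (@le_trans _ _ (expR (#|initial n m1|%:R * ((expR (1 / 2) - 1) * (2 / n%:R)) - r%:R * (1 / 2)))).
  apply: (le_trans _ H); apply: le_Ex => e eO; rewrite ler_nat.
  rewrite (_ : #|[set j in _ | _]| = deg e m1 v) //.
  by apply: eq_card => j; rewrite !(in_set (fun i => (i \in _) && _)) in_star.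
rewrite ler_expR card_initial // m1E rE.
have h2 : expR (1 / 2 : R) <= 1 + 1 / 2 + 2 * (1 / 2) ^+ 2 by apply: expR_le_quad.
have -> : 2000 * x * n%:R * ((expR (1 / 2) - 1) * (2 / n%:R)) = 4000 * x * (expR (1 / 2) - 1).
  by field; rewrite gt_eqF.
have : 4000 * x * (expR (1 / 2) - 1) <= 4000 * x * 1.
  by apply: ler_wpM2l; [rewrite mulr_ge0 | lra].
by move: (4000 * x * (_ - 1)) x_ge0 => a x0; lra.
Qed.

End Estimates.

(** * Lower tails and low vertices *)

Section LowerTail.
Variables (R : realType) (n : nat).
Local Notation N := 'C(n, 2).
Variables (s B : {set 'I_N}) (f : edge_seq n -> R) (G : {set {set 'I_n}}).
Hypotheses (sf : supported s f) (f_ge0 : forall e, 0 <= f e) (GK : G \subset K_edges n).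
Hypothesis f_out : forall e j, f e != 0 -> j \in s -> e j \notin G.
Hypotheses (Gle : (#|G| <= N - #|s|)%N) (sB : [disjoint s & B]).

(** Weight e^(-3) <= 1/4 per miss of G: the r misses allowed cost 3 r, and each position of B gains
    3/4 of the lower bound [rho] on the miss probability. *)
Lemma lower_tail_expR (rho : R) (r : nat) : 0 <= rho ->
  #|G|%:R / (N - #|s|)%:R <= 1 - rho ->
  Ex (fun e => f e * (#|[set j in B | e j \notin G]| <= r)%N%:R) <=
    expR (3 * r%:R - #|B|%:R * (3 / 4 * rho)) * Ex f.
Proof.
move=> rho0 pr.
have th0 := expR_gt0 (- (3 : R)).
have th4 : expR (- (3 : R)) <= 1 / 4.
  rewrite expRN -div1r; apply: ler_pM => //; first by rewrite invr_ge0 expR_ge0.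
  rewrite lef_pV2 ?posrE ?expR_gt0 //; apply: le_trans (expR_ge1Dx 3).
  by rewrite -(natrD _ 1 3).
have th1 : expR (- (3 : R)) <= 1 by lra.
apply: (le_trans (lower_tail sf f_ge0 GK f_out Gle sB r th0 th1)).
apply: ler_wpM2r; first by apply: Ex_ge0.
rewrite [3 * _ - _]addrC expRD; apply: ler_pM.
- have p0 : 0 <= #|G|%:R / (N - #|s|)%:R :> R by rewrite divr_ge0.
  apply: exprn_ge0; apply: addr_ge0; first exact: (ltW th0).
  by apply: mulr_ge0 => //; rewrite subr_ge0.
- by rewrite invr_ge0 exprn_ge0 // (ltW th0).
- rewrite -mulrN; apply: exprn_le_expR.
    have p0 : 0 <= #|G|%:R / (N - #|s|)%:R :> R by rewrite divr_ge0.
    apply: addr_ge0; first exact: (ltW th0).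
    by apply: mulr_ge0 => //; rewrite subr_ge0.
  apply: (le_trans _ (expR_ge1Dx _)).
  move: (_ / _) (expR _) pr th0 th4 th1 => p th pr th0 th4 th1.
  have h1 : (1 - th) * p <= (1 - th) * (1 - rho) by apply: ler_wpM2l => //; lra.
  have h2 : 3 / 4 * rho <= (1 - th) * rho by apply: ler_wpM2r => //; lra.
  by lra.
by rewrite -exprVn -expRN opprK mulrC expRM_natl.
Qed.

End LowerTail.

Section LowVertices.
Variables (R : realType) (n m0 m1 K D : nat) (x : R).
Local Notation N := 'C(n, 2).
Hypotheses (n_gt1 : (1 < n)%N) (m1N : (m1 <= N)%N) (m01 : (m0 <= m1)%N).
Hypotheses (x_ge0 : 0 <= x) (DE : D%:R = 16 * x).
Hypotheses (m0E : m0%:R = 400 * x * n%:R) (m1E : m1%:R = 2000 * x * n%:R).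

Let n0 : (0 : R) < n%:R. Proof. by rewrite ltr0n ltnW. Qed.

(** The mean degree at time [m0] is 800 x, so the exponent is 3 * 16 x - 600 x. *)
Lemma prob_low (v : 'I_n) :
  Ex (fun e : edge_seq n => (v \in low e m0 D)%:R) <= expR (- (552 * x)).
Proof.
pose one : edge_seq n -> R := fun=> 1.
have s1 : supported set0 one by [].
have o0 e : 0 <= one e by rewrite ler01.
have oo e (j : 'I_N) : one e != 0 -> j \in (set0 : {set 'I_N}) -> e j \notin inner (~: [set v]).
  by rewrite inE.
have Gle : (#|inner (~: [set v])| <= N - #|(set0 : {set 'I_N})|)%N.
  by rewrite cards0 subn0 -card_K_edges subset_leq_card ?innerK.
have dis : [disjoint (set0 : {set 'I_N}) & initial n m0] by rewrite -setI_eq0 set0I.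
have r0 : 0 <= 2 / n%:R :> R by rewrite divr_ge0.
have pr : #|inner (~: [set v])|%:R / (N - #|(set0 : {set 'I_N})|)%:R <= 1 - 2 / n%:R :> R.
  by rewrite cards0 subn0 (card_inner1 R n_gt1).
have := lower_tail_expR s1 o0 (innerK _) oo Gle dis D r0 pr.
rewrite (_ : Ex one = 1) ?mulr1; last exact: Ex_cst.
rewrite card_initial ?(leq_trans m01) // m0E DE.
have -> : 3 * (16 * x) - 400 * x * n%:R * (3 / 4 * (2 / n%:R)) = - (552 * x).
  by field; rewrite gt_eqF.
move=> H; apply: (le_trans _ H); apply: le_Ex => e eO; rewrite mul1r ler_nat.
rewrite inE; case: ltnP => // lt; rewrite lt0b (leq_trans _ (ltnW lt)) //.
apply: subset_leq_card; apply/subsetP => j /setIdP[jm].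
by rewrite in_inner // subsetC sub1set inE negbK => vj; apply/setIdP.
Qed.

(** Unless some degree reaches r by time [m1], there are at most r low edges per low vertex. The
    expected number of low vertices is at most n e^(-552 x), of order e^(448 x), so Markov's
    inequality at e^(460 x) leaves a margin of e^(-12 x), and the square of e^(460 x) is still far
    below n. *)
Lemma prob_low_edges (r : nat) : r%:R = 12000 * x ->
  Ex (fun e : edge_seq n => (expR (460 * x) * r%:R < #|low_edges e m0 m1 D|%:R :> R)%R%:R)
    <= n%:R * (expR (- (2000 * x)) + expR (- (1012 * x))).
Proof.
move=> rE; pose big (e : edge_seq n) := [exists v, (r <= deg e m1 v)%N].
have Ebig : Ex (fun e => (big e)%:R) <= n%:R * expR (- (2000 * x)) :> R.
  apply: (@le_trans _ _ (\sum_(v : 'I_n) Ex (fun e : edge_seq n => (r <= deg e m1 v)%N%:R))).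
    by apply: Ex_union => e _ /existsP[v vr]; exists v.
  apply: (@le_trans _ _ (\sum_(v : 'I_n) expR (- (2000 * x)))).
    by apply: ler_sum => v _; apply: (prob_maxdeg n_gt1 m1N x_ge0 m1E).
  by rewrite sumr_const card_ord [leRHS]mulr_natl.
have Elow : Ex (fun e : edge_seq n => #|low e m0 D|%:R) <= n%:R * expR (- (552 * x)) :> R.
  apply: (@le_trans _ _ (\sum_(v : 'I_n) expR (- (552 * x)))).
    apply: (@le_trans _ _ (\sum_(v : 'I_n) Ex (fun e : edge_seq n => (v \in low e m0 D)%:R))).
      rewrite -Ex_sum; apply: le_Ex => e _; rewrite -sum1_card natr_sum big_mkcond /=.
      by apply: ler_sum => v _; case: (v \in _).
    by apply: ler_sum => v _; apply: prob_low.
  by rewrite sumr_const card_ord [leRHS]mulr_natl.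
rewrite mulrDr; apply: (@le_trans _ _ (Ex (fun e : edge_seq n =>
    (big e)%:R + expR (- (460 * x)) * #|low e m0 D|%:R))).
  apply: le_Ex => e eO; have [b|nb] := boolP (big e).
    by rewrite (@le_trans _ _ 1) ?lern1 ?leq_b1 // lerDl mulr_ge0 ?expR_ge0.
  rewrite add0r; case: ltP => [lt|_]; last by rewrite mulr_ge0 ?expR_ge0.
  have : (#|low_edges e m0 m1 D| <= #|low e m0 D| * r)%N.
    apply: (@leq_trans (\sum_(v in low e m0 D) deg e m1 v)).
      rewrite /deg (sum_card_rel (low e m0 D) (initial n m1) (fun v i => v \in e i)).
      rewrite /low_edges -sum1_card [leqRHS]big_mkcond [leqLHS]big_mkcond /=.
      apply: leq_sum => i _; rewrite inE; case: (i \in _) => //=.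
      case: (boolP [disjoint e i & low e m0 D]) => //= /pred0Pn[v /andP[/= vi vl]].
      by rewrite card_gt0; apply/set0Pn; exists v; rewrite inE vl.
    rewrite -sum_nat_const; apply: leq_sum => v _; apply: ltnW.
    by move: nb; rewrite negb_exists => /forallP/(_ v); rewrite -ltnNge.
  rewrite -(ler_nat R) natrM => le; have := lt_le_trans lt le => {le lt}.
  have [->|r0] := posnP r; first by rewrite !mulr0 ltxx.
  rewrite ltr_pM2r ?ltr0n // => /ltW h.
  by rewrite expRN [leRHS]mulrC ler_pdivlMr ?expR_gt0 // mul1r.
rewrite ExD ExZ; apply: lerD => //.
have -> : n%:R * expR (- (1012 * x)) = expR (- (460 * x)) * (n%:R * expR (- (552 * x))).
  by rewrite mulrCA -expRD; congr (_ * expR _); ring.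
by rewrite ler_wpM2l ?expR_ge0.
Qed.

(** I will be the set of low edges of the other, independent ordering. *)
Lemma prob_not_matched (I : {set 'I_N}) :
  Ex (fun e : edge_seq n => (~~ matched e I)%:R) <= #|I|%:R ^+ 2 * (4 / n%:R) :> R.
Proof.
pose P (p : 'I_N * 'I_N) := [&& p.1 \in I, p.2 \in I & p.1 != p.2].
apply: (@le_trans _ _ (\sum_(p | P p) Ex (fun e : edge_seq n => (~~ [disjoint e p.1 & e p.2])%:R))).
  apply: Ex_union => e _ /forallPn[i]; rewrite negb_imply => /andP[iI /forallPn[j]].
  rewrite negb_imply => /andP[jI]; rewrite negb_imply => /andP[ij dis].
  by exists (i, j); rewrite // /P /= iI jI.
apply: (@le_trans _ _ (\sum_(p | P p) (4 / n%:R))).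
  by apply: ler_sum => p /and3P[_ _ p12]; apply: meet_prob.
rewrite sumr_const -[X in X <= _]mulr_natl; apply: ler_wpM2r; first by rewrite divr_ge0.
rewrite -natrX ler_nat -mulnn -cardsX; apply: subset_leq_card.
by apply/subsetP => p /and3P[p1 p2 _]; rewrite inE p1.
Qed.

End LowVertices.

Lemma card_inner2 (R : realFieldType) (n : nat) (u v : 'I_n) : (1 < n)%N -> u != v ->
  #|inner (~: [set u; v])|%:R = (n%:R - 2) * (n%:R - 3) / 2 :> R.
Proof.
move=> n_gt1 uv; rewrite card_inner cardsCs setCK card_ord cards2 uv bin2R.
by rewrite (natrB R n_gt1); ring.
Qed.

Lemma ler_term_sum (R : realFieldType) (I : finType) (P : pred I) (F : I -> R) i :
  (forall j, 0 <= F j) -> P i -> F i <= \sum_(j | P j) F j.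
Proof. by move=> F0 Pi; rewrite (bigD1 i) //= lerDl sumr_ge0. Qed.

(** * Separation of low vertices *)

Section Separation.
Variables (R : realType) (n m0 m1 D : nat) (x : R).
Local Notation N := 'C(n, 2).
Hypotheses (n_ge : (100 <= n)%N) (m1N : (m1 <= N)%N) (m01 : (m0 <= m1)%N).
Hypotheses (x_ge0 : 0 <= x) (DE : D%:R = 16 * x).
Hypotheses (m0E : m0%:R = 400 * x * n%:R).

Let n_gt1 : (1 < n)%N. Proof. exact: leq_trans n_ge. Qed.

(** The case [i = j] is that of adjacent vertices; distinct i and j include the paths of length
    two. *)
Definition close_pair (i j : 'I_N) (u v : 'I_n) (e : edge_seq n) : R :=
  [&& u \in e i, v \in e j, u != v & ~~ [disjoint e i & e j]]%:R.

(** Given the edges at i and j, the other positions are exchangeable and meet {u, v} with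
    probability at least 3.9/n, whereas low u and v allow at most 2 * D such edges. The exponent is
    96 x - 1170 x = - 1074 x, and the 1 absorbs the two positions left out. *)
Lemma prob_close_low (i j : 'I_N) (u v : 'I_n) :
  Ex (fun e => close_pair i j u v e * ((u \in low e m0 D) && (v \in low e m0 D))%:R)
    <= expR (1 - 1074 * x) * Ex (close_pair i j u v).
Proof.
have [uv|uv] := eqVneq u v.
  rewrite !(@eq_Ex R n _ (fun=> 0)) ?Ex_cst ?mulr0 //.
  - by move=> e _; rewrite /close_pair uv eqxx !andbF.
  - by move=> e _; rewrite /close_pair uv eqxx !andbF mul0r.
pose s := [set i; j]; pose G := inner (~: [set u; v]).
have s2 : (#|s| <= 2)%N by rewrite cards2; case: (i != j).
have sf : supported s (close_pair i j u v).
  move=> k l e; rewrite !inE !negb_or => /andP[ki kj] /andP[li lj].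
  by rewrite /close_pair !ffunE !tpermD.
have f0 e : 0 <= close_pair i j u v e by [].
have fout e k : close_pair i j u v e != 0 -> k \in s -> e k \notin G.
  rewrite pnatr_eq0 eqb0 negbK => /and3P[ui vj _] ks.
  apply/negP; rewrite inE => /andP[_ /subsetP sub].
  by case/set2P: ks sub => -> sub; [have := sub u ui | have := sub v vj]; rewrite !inE eqxx ?orbT.
have nR : (100 : R) <= n%:R by rewrite ler_nat.
have GR := card_inner2 R n_gt1 uv; rewrite -/G in GR.
have NR : N%:R = n%:R * (n%:R - 1) / 2 :> R by rewrite bin2R.
have N3 : (3 <= N)%N.
  by rewrite -(ler_nat R) NR; move: (n%:R : R) nR => y y100; nra.
have Gle2 : (#|G| + 2 <= N)%N.
  by rewrite -(ler_nat R) natrD NR GR; move: (n%:R : R) nR => y y100; nra.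
have Gle : (#|G| <= N - #|s|)%N by move: s2 Gle2; move: #|s| #|G| => a b; clear; lia.
have dis : [disjoint s & initial n m0 :\: s].
  by rewrite -setI_eq0; apply/eqP/setP => k; rewrite !in_setI in_setD in_set0; case: (k \in s).
have n0 : (0 : R) < n%:R by rewrite ltr0n ltnW.
have rho0 : 0 <= 39 / 10 / n%:R :> R by rewrite !divr_ge0.
have pr : #|G|%:R / (N - #|s|)%:R <= 1 - 39 / 10 / n%:R :> R.
  apply: (@le_trans _ _ (#|G|%:R / (N - 2)%:R)).
    apply: ler_wpM2l => //; rewrite lef_pV2 ?posrE ?ltr0n ?subn_gt0 //.
    - by rewrite ler_nat leq_sub2l.
    - exact: leq_ltn_trans s2 N3.
  rewrite ler_pdivrMr ?ltr0n ?subn_gt0 // natrB ?(ltnW N3) // GR NR.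
  move: (n%:R : R) nR n0 => y y100 y0; rewrite -subr_ge0.
  rewrite (_ : _ - _ = (5 * y ^+ 2 - 305 * y + 780) / (100 * y)); last first.
    by field; rewrite gt_eqF.
  by rewrite divr_ge0 //; nra.
have := lower_tail_expR sf f0 (innerK _) fout Gle dis (2 * D) rho0 pr.
have Bge : 400 * x * n%:R - 2 <= #|initial n m0 :\: s|%:R :> R.
  rewrite -m0E lerBlDr -natrD ler_nat.
  rewrite -[X in (X <= _)%N](card_initial (leq_trans m01 m1N)) -(cardsID s).
  by rewrite addnC leq_add2l (leq_trans _ s2) // subset_leq_card // subsetIr.
move=> H; refine (le_trans (le_trans _ H) _).
  apply: le_Ex => e eO; apply: ler_wpM2l => //.
  case: (boolP (_ && _)) => // /andP[]; rewrite !inE => du dv; rewrite ler_nat lt0b.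
  apply: (@leq_trans (deg e m0 u + deg e m0 v)); last first.
    by rewrite mul2n -addnn leq_add // ltnW.
  rewrite (leq_trans _ (leq_card_setU _ _)) // subset_leq_card //.
  apply/subsetP => k /setIdP[/setDP[km _]]; rewrite in_inner // => nsub.
  rewrite !in_set (_ : (k < m0)%N); last by move: km; rewrite inE.
  apply: contraNT nsub; rewrite negb_or => /andP[nu nv].
  by apply/subsetP => w wk; rewrite !inE negb_or; apply/andP; split;
    apply: contraTneq wk => ->.
apply: ler_wpM2r; first by apply: Ex_ge0.
rewrite ler_expR natrM DE.
have : (400 * x * n%:R - 2) * (3 / 4 * (39 / 10 / n%:R)) <=
    #|initial n m0 :\: s|%:R * (3 / 4 * (39 / 10 / n%:R)) :> R.
  by apply: ler_wpM2r => //; rewrite mulr_ge0 ?divr_ge0.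
have -> : (400 * x * n%:R - 2) * (3 / 4 * (39 / 10 / n%:R)) = 1170 * x - 117 / 20 / n%:R :> R.
  by field; rewrite gt_eqF.
have : 117 / 20 / n%:R <= 1 :> R by rewrite ler_pdivrMr // mul1r; lra.
by move: (_ * (3 / 4 * _)) (_ / n%:R) => a b; lra.
Qed.

Lemma sum_close_pairs (i j : 'I_N) (e : edge_seq n) : e \in orderings n ->
  \sum_u \sum_v close_pair i j u v e <= 4 * (~~ [disjoint e i & e j])%:R.
Proof.
move=> eO; have [dis|ndis] := boolP [disjoint e i & e j].
  rewrite mulr0 big1 // => u _; rewrite big1 // => v _.
  by rewrite /close_pair dis !andbF.
rewrite mulr1 (_ : 4 = (\sum_(u in e i) \sum_(v in e j) 1 : R)); last first.
  rewrite (eq_bigr (fun=> 2)) => [|u _]; rewrite sumr_const (ordering_card _ eO) //.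
  by rewrite -mulrnA.
rewrite [leRHS]big_mkcond; apply: ler_sum => u _.
case: (boolP (u \in e i)) => ui; last first.
  by rewrite big1 // => v _; rewrite /close_pair (negPf ui).
rewrite [leRHS]big_mkcond; apply: ler_sum => v _; rewrite /close_pair ui /=.
by case: (v \in e j) => //=; rewrite lern1 leq_b1.
Qed.

(** The [m1] diagonal pairs (i, j) count fully, the others with probability 4/n: in all, order x^2 n
    against e^(-1074 x). *)
Lemma prob_not_separated :
  Ex (fun e : edge_seq n => (~~ separated e m0 m1 D)%:R) <=
    expR (1 - 1074 * x) * (4 * (m1%:R + m1%:R ^+ 2 * (4 / n%:R))).
Proof.
pose I := initial n m1.
apply: (@le_trans _ _ (\sum_(i in I) \sum_(j in I) \sum_u \sum_v
    Ex (fun e => close_pair i j u v e * ((u \in low e m0 D) && (v \in low e m0 D))%:R))).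
  rewrite (eq_bigr (fun i => Ex (fun e => \sum_(j in I) \sum_u \sum_v
     close_pair i j u v e * ((u \in low e m0 D) && (v \in low e m0 D))%:R))) => [|i _]; last first.
    rewrite Ex_sum; apply: eq_bigr => j _; rewrite Ex_sum; apply: eq_bigr => u _.
    by rewrite Ex_sum.
  rewrite -Ex_sum; apply: le_Ex => e eO.
  have c0 i j u v : 0 <= close_pair i j u v e * ((u \in low e m0 D) && (v \in low e m0 D))%:R.
    by rewrite mulr_ge0.
  have [_|/forallPn[u]] := boolP (separated e m0 m1 D).
    by do 4! (apply: sumr_ge0 => ? _).
  rewrite negb_imply => /andP[uL /forallPn[v]].
  rewrite negb_imply => /andP[vL /forallPn[i]].
  rewrite negb_imply => /andP[iI /forallPn[j]].
  rewrite negb_imply => /andP[jI]; rewrite negb_imply => /andP[/and3P[uv ui vj] ndis].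
  apply: le_trans (ler_term_sum _ iI) => [|k]; last by do 3! (apply: sumr_ge0 => ? _).
  apply: le_trans (ler_term_sum _ jI) => [|k]; last by do 2! (apply: sumr_ge0 => ? _).
  apply: le_trans (ler_term_sum _ (isT : xpredT u)) => [|k]; last by apply: sumr_ge0 => ? _.
  apply: le_trans (ler_term_sum _ (isT : xpredT v)) => [|k //].
  by rewrite uL vL mulr1 /close_pair ui vj uv ndis.
apply: (@le_trans _ _ (\sum_(i in I) \sum_(j in I) expR (1 - 1074 * x) *
    (4 * Ex (fun e : edge_seq n => (~~ [disjoint e i & e j])%:R)))).
  apply: ler_sum => i _; apply: ler_sum => j _.
  rewrite -ExZ; apply: (@le_trans _ _ (expR (1 - 1074 * x) *
    Ex (fun e => \sum_u \sum_v close_pair i j u v e))).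
    rewrite Ex_sum big_distrr /=; apply: ler_sum => u _.
    by rewrite Ex_sum big_distrr /=; apply: ler_sum => v _; apply: prob_close_low.
  by apply: ler_wpM2l; rewrite ?expR_ge0 //; apply: le_Ex => e eO; apply: sum_close_pairs.
have -> : expR (1 - 1074 * x) * (4 * (m1%:R + m1%:R ^+ 2 * (4 / n%:R))) =
    \sum_(i in I) \sum_(j in I) expR (1 - 1074 * x) * (4 * ((i == j)%:R + 4 / n%:R)).
  rewrite (eq_bigr (fun=> expR (1 - 1074 * x) * (4 * (1 + m1%:R * (4 / n%:R))))) => [|i iI].
    by rewrite sumr_const card_initial // -[RHS]mulr_natl; ring.
  rewrite -!big_distrr /= big_split /= (bigD1 i) //= eqxx big1 ?addr0 => [|j /andP[_ /negPf]].
    by rewrite sumr_const card_initial // -(mulr_natl (4 / n%:R)).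
  by rewrite eq_sym => ->.
apply: ler_sum => i _; apply: ler_sum => j _.
apply: ler_wpM2l; rewrite ?expR_ge0 //; apply: ler_wpM2l => //.
have [_|ij] := eqVneq i j; last by rewrite add0r meet_prob.
by rewrite (le_trans (Ex_le1 _ _)) // lerDl divr_ge0.
Qed.

End Separation.

(** * Second moment of the number of isolated vertices *)

Section ExactHit.
Variables (R : realFieldType) (n : nat).
Local Notation N := 'C(n, 2).

(** The second moment compares the probabilities for one and for two vertices, which calls for the
    exact product in place of the bound [all_hit]. *)
Lemma all_hit_exact (G : {set {set 'I_n}}) (k : nat) : G \subset K_edges n -> (k <= N)%N ->
  Ex (fun e => [forall i in initial n k, e i \in G]%:R : R) =
    \prod_(i < k) ((#|G| - i)%:R / (N - i)%:R).
Proof.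
move=> GK; elim: k => [|k IHk] kN.
  rewrite big_ord0 -[RHS](Ex_cst n); apply: eq_Ex => e _.
  by case: forall_inP => // H; case: H => i; rewrite inE.
rewrite big_ord_recr /= -(IHk (ltnW kN)).
pose one : edge_seq n -> R := fun=> 1.
have s1 : supported set0 one by [].
have oo e (j : 'I_N) : one e != 0 -> j \in (set0 : {set 'I_N}) -> e j \notin G.
  by rewrite inE.
have dis : [disjoint (set0 : {set 'I_N}) & initial n k] by rewrite -setI_eq0 set0I.
pose i := Ordinal kN.
have iI : i \notin initial n k by rewrite inE /= ltnn.
have iS : initial n k.+1 = i |: initial n k.
  by apply/setP => j; rewrite !inE ltnS leq_eqVlt -val_eqE.
have hitE (J : {set 'I_N}) : Ex (hit one G J) = Ex (fun e => [forall i in J, e i \in G]%:R : R).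
  apply: eq_Ex => e _; rewrite /hit mul1r.
  have [/forall_inP all|] := boolP [forall i in J, e i \in G].
    by rewrite big1 // => j jJ; rewrite all.
  case/forallPn => j; rewrite negb_imply => /andP[jJ /negPf ej].
  by rewrite (bigD1 j) //= ej mul0r.
have := hit_step s1 GK oo dis (negbT (in_set0 i)) iI.
rewrite -iS !hitE cards0 add0n card_initial ?(ltnW kN) // => E.
have N0 : (N - k)%:R != 0 :> R by rewrite pnatr_eq0 -lt0n subn_gt0.
by apply: (mulfI N0); rewrite E; field.
Qed.

End ExactHit.

Section EarlyDisconnected.
Variables (R : realType) (n m0 : nat) (x : R).
Local Notation N := 'C(n, 2).
Hypotheses (n_ge : (100 <= n)%N) (m0N : (m0 <= N)%N) (x_ge0 : 0 <= x).
Hypotheses (m0E : m0%:R = 400 * x * n%:R) (n_large : 16800 * x + 1 <= n%:R).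

Let n_gt1 : (1 < n)%N. Proof. exact: leq_trans n_ge. Qed.
Let n0 : (0 : R) < n%:R. Proof. by rewrite ltr0n ltnW. Qed.

Let avoid (v : 'I_n) (e : edge_seq n) : bool :=
  [forall i in initial n m0, e i \in inner (~: [set v])].
Let avoid2 (u v : 'I_n) (e : edge_seq n) : bool :=
  [forall i in initial n m0, e i \in inner (~: [set u; v])].

Let p1 : R := \prod_(i < m0) (('C(n.-1, 2) - i)%:R / (N - i)%:R).

Let Ex_avoid v : Ex (fun e => (avoid v e)%:R) = p1.
Proof. by rewrite all_hit_exact ?innerK // card_inner cardsC1 card_ord. Qed.

Let g1E : 'C(n.-1, 2)%:R = (n%:R - 1) * (n%:R - 2) / 2 :> R.
Proof. by rewrite bin2R -subn1 (natrB R (ltnW n_gt1)); ring. Qed.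

(* Sampling without replacement makes isolations negatively correlated. *)
Let Ex_avoid2 u v : u != v -> Ex (fun e => (avoid2 u v e)%:R) <= p1 ^+ 2.
Proof.
move=> uv; rewrite all_hit_exact ?innerK // /p1 -prodrXl.
apply: ler_prod => i _; rewrite divr_ge0 //=.
have iN : (i < N)%N := leq_trans (ltn_ord i) m0N.
have M0 : 0 < (N - i)%:R :> R by rewrite ltr0n subn_gt0.
rewrite expr_div_n ler_pdivrMr // mulrAC ler_pdivlMr ?exprn_gt0 // expr2 mulrA.
apply: ler_wpM2r; first exact: ltW.
have g2R := card_inner2 R n_gt1 uv.
have NR : N%:R = n%:R * (n%:R - 1) / 2 :> R by rewrite bin2R.
have nR : (100 : R) <= n%:R by rewrite ler_nat.
have [le|/ltnW lt] := leqP i #|inner (~: [set u; v])|; last first.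
  by move: lt; rewrite -subn_eq0 => /eqP->; rewrite mul0r sqr_ge0.
have g12 : (#|inner (~: [set u; v])| <= 'C(n.-1, 2))%N.
  rewrite -(ler_nat R) g2R g1E; move: (n%:R : R) nR => y y100; nra.
rewrite (natrB R le) (natrB R (ltnW iN)) (natrB R (leq_trans le g12)) g2R g1E NR.
move: (n%:R : R) (i%:R : R) nR (ler0n R i) => y t y100 t0.
rewrite -subr_ge0 (_ : _ - _ = (y - 1) * (y - 2) / 2 + t); last by field.
by rewrite addr_ge0 // divr_ge0 // mulr_ge0 //; lra.
Qed.

(** Each factor is 1 - (n - 1) / (N - i), at least 1 - 2.1/n once i <= n(n - 1) / 42; hence 16800 =
    42 * 400 in [n_large]. The rate 2.2 in place of 2.1 pays for second-order terms, and 2.2 * 400 =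
    880. *)
Let p1_ge : expR (- (880 * x)) <= p1.
Proof.
have -> : - (880 * x) = m0%:R * - (11 / 5 / n%:R) by rewrite m0E; field; rewrite gt_eqF.
rewrite expRM_natl -[X in _ ^+ X]card_ord -prodr_const.
apply: ler_prod => i _; rewrite expR_ge0 /=.
have nR : (100 : R) <= n%:R by rewrite ler_nat.
have NR : N%:R = n%:R * (n%:R - 1) / 2 :> R by rewrite bin2R.
have iR : (i%:R : R) <= 400 * x * n%:R by rewrite -m0E ler_nat ltnW.
have i2 : (i%:R : R) <= n%:R * (n%:R - 1) / 42.
  apply: (le_trans iR); rewrite mulrC -mulrA; apply: ler_wpM2l; first exact: ltW.
  by move: (n%:R : R) n_large => y; lra.
have i0 : (0 : R) <= i%:R by [].
have ig1 : (i <= 'C(n.-1, 2))%N.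
  by rewrite -(ler_nat R) g1E; move: (n%:R : R) (i%:R : R) nR i2 => y t; nra.
have iN : (i <= N)%N by rewrite ltnW // (leq_trans (ltn_ord i) m0N).
rewrite natrB // natrB // g1E NR.
apply: (@le_trans _ _ (1 - 21 / 10 / n%:R)).
  rewrite expRN -[X in X <= _]div1r ler_pdivrMr ?expR_gt0 //.
  have h := expR_ge1Dx (11 / 5 / n%:R : R).
  have c0 : 0 <= 1 - 21 / 10 / n%:R :> R.
    by rewrite subr_ge0 ler_pdivrMr // mul1r; move: (n%:R : R) nR => y; lra.
  apply: (le_trans _ (ler_wpM2l c0 h)); rewrite -subr_ge0.
  rewrite (_ : _ - _ = (10 * n%:R - 462) / (100 * n%:R ^+ 2)); last by field; rewrite gt_eqF.
  rewrite divr_ge0 //; last by rewrite mulr_ge0 // sqr_ge0.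
  by move: (n%:R : R) nR => y; lra.
have M0 : 0 < n%:R * (n%:R - 1) / 2 - i%:R :> R.
  by move: (n%:R : R) (i%:R : R) nR i2 => y t; nra.
rewrite ler_pdivlMr // -subr_ge0.
rewrite (_ : _ - _ = (n%:R * (n%:R - 1) / 20 - 21 / 10 * i%:R) / n%:R); last first.
  by field; rewrite gt_eqF.
apply: divr_ge0; last exact: ltW.
by move: (n%:R * (n%:R - 1)) i2 => y; lra.
Qed.

(** Chebyshev's inequality: the number Y of isolated vertices has variance at most its mean mu, and
    connectedness forces Y = 0, where the squared deviation is mu^2. *)
Lemma prob_connected_early :
  Ex (fun e : edge_seq n => (graph_connected (e @: initial n m0))%:R) <=
    (n%:R * expR (- (880 * x)))^-1.
Proof.
pose Y (e : edge_seq n) : R := \sum_v (avoid v e)%:R.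
pose mu := n%:R * p1.
have p1_gt0 : 0 < p1 by apply: lt_le_trans (expR_gt0 _) p1_ge.
have mu0 : 0 < mu by rewrite mulr_gt0.
have EY : Ex Y = mu.
  by rewrite /Y Ex_sum (eq_bigr _ (fun v _ => Ex_avoid v)) sumr_const card_ord /mu mulr_natl.
have EY2 : Ex (fun e => Y e ^+ 2) <= mu + mu ^+ 2.
  rewrite (@eq_Ex R n _ (fun e => \sum_u \sum_v (avoid u e && avoid v e)%:R)); last first.
    move=> e _; rewrite expr2 /Y big_distrl /=; apply: eq_bigr => u _.
    by rewrite big_distrr /=; apply: eq_bigr => v _; rewrite -natrM mulnb.
  rewrite Ex_sum (@le_trans _ _ (\sum_(u : 'I_n) (p1 + n%:R * p1 ^+ 2))) //; last first.
    rewrite sumr_const card_ord -mulr_natl /mu le_eqVlt; apply/orP; left; apply/eqP; ring.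
  apply: ler_sum => u _; rewrite Ex_sum (bigD1 u) //=; apply: lerD.
    by rewrite -(Ex_avoid u); apply: le_Ex => e _; rewrite andbb.
  apply: (@le_trans _ _ (\sum_(v | v != u) p1 ^+ 2)).
    apply: ler_sum => v vu; apply: le_trans (Ex_avoid2 vu); apply: le_Ex => e eO.
    case: (boolP (_ && _)) => // /andP[/forall_inP au /forall_inP av].
    suff -> : avoid2 v u e by [].
    apply/forall_inP => i iI; have := au i iI; have := av i iI; rewrite !in_inner //.
    move=> /subsetP sv /subsetP su; apply/subsetP => w wi.
    by have := sv w wi; have := su w wi; rewrite !inE negb_or => -> ->.
  rewrite sumr_const -[leLHS]mulr_natl; apply: ler_wpM2r; first by rewrite sqr_ge0.
  by rewrite ler_nat -[leqRHS](card_ord n) max_card.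
apply: (@le_trans _ _ mu^-1); last first.
  by rewrite lef_pV2 ?posrE ?mulr_gt0 ?expR_gt0 // /mu ler_wpM2l // ltW.
rewrite -(ler_pM2l (exprn_gt0 2 mu0)) -ExZ.
apply: (@le_trans _ _ (Ex (fun e => Y e ^+ 2 + (- (2 * mu) * Y e + mu ^+ 2)))).
  apply: le_Ex => e eO.
  have -> : Y e ^+ 2 + (- (2 * mu) * Y e + mu ^+ 2) = (Y e - mu) ^+ 2 by ring.
  case: (boolP (graph_connected _)) => [conn|_]; last by rewrite mulr0 sqr_ge0.
  have -> : Y e = 0.
    rewrite /Y big1 // => v _; have [i iI vi] := connected_degree v n_gt1 conn.
    have [/forall_inP/(_ i iI)|//] := boolP (avoid v e).
    by rewrite in_inner // => /subsetP/(_ v vi); rewrite !inE eqxx.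
  by rewrite mulr1 sub0r sqrrN.
rewrite !ExD ExZ Ex_cst EY; move: EY2; move: (Ex _) => z zle.
have -> : mu ^+ 2 / mu = mu by field; rewrite gt_eqF.
by move: zle; rewrite expr2; nra.
Qed.

End EarlyDisconnected.

(** * Assembly of the estimates *)

Lemma prob_indep_uniformE (R : realType) (n : nat) (E : edge_seq n -> edge_seq n -> bool) :
  prob_indep_uniform R (orderings n) E = Ex (fun e1 => Ex (fun e2 => (E e1 e2)%:R)).
Proof.
rewrite /prob_indep_uniform /Ex big_distrl /= [RHS]big_mkcond /=.
apply: eq_bigr => e1 _; rewrite /uniform; case: (e1 \in orderings n); last first.
  by rewrite big1 // => e2 _; rewrite mul0r.
rewrite [in RHS]big_distrl /= big_distrl /= big_mkcond [RHS]big_mkcond /=.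
apply: eq_bigr => e2 _; case: (e2 \in orderings n); case: (E e1 e2) => //=;
by rewrite ?mulr0 ?mul0r ?mul1r.
Qed.

Lemma Ex_exchange (R : realFieldType) (n : nat) (F : edge_seq n -> edge_seq n -> R) :
  Ex (fun e1 => Ex (fun e2 => F e1 e2)) = Ex (fun e2 => Ex (fun e1 => F e1 e2)).
Proof.
rewrite /Ex -!big_distrl /=; congr (_ * _ * _).
exact: exchange_big.
Qed.

(** * Sizes of the error terms *)

Section ExpEstimates.
Variables (R : realType) (n : nat) (x : R).
Hypotheses (x_ge : 5000 <= x).
Hypotheses (n_lo : expR (1000 * x) <= n%:R) (n_hi : n%:R <= expR (1000 * x + 1000)).
Local Notation q := (expR (- x)).

Local Ltac xlra := move: x_ge; lra.

Let x0 : 0 <= x. Proof. by xlra. Qed.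

Lemma n_ge_quad : 1000 * x + (500 * x) ^+ 2 <= n%:R.
Proof.
apply: (@le_trans _ _ (expR (500 * x) * expR (500 * x))); last first.
  by rewrite -expRD; apply: le_trans n_lo; rewrite ler_expR; xlra.
have h := expR_ge1Dx (500 * x); have y0 : 0 <= 500 * x by xlra.
apply: (@le_trans _ _ ((1 + 500 * x) * (1 + 500 * x))); first by xlra.
by apply: ler_pM => //; xlra.
Qed.

(** The offset 1000 in [n_hi] stems from rounding (ln n) / 1000 down; it turns into constant factors
    such as e^1000. *)
Lemma n_expR_le (a b : R) : b <= 1000 + a - 1000 * x -> n%:R * expR b <= expR (2000 + a).
Proof.
move=> ba; apply: (@le_trans _ _ (expR (1000 * x + 1000) * expR b)).
  by apply: ler_wpM2r; rewrite ?expR_ge0.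
by rewrite -expRD ler_expR; xlra.
Qed.

Lemma expR_neg_half (y : R) : y <= - 1 -> expR y <= 1 / 2.
Proof.
move=> y1; apply: (@le_trans _ _ (expR (- 1))); first by rewrite ler_expR.
rewrite expRN div1r lef_pV2 ?posrE ?expR_gt0 //.
by apply: le_trans (expR_ge1Dx 1); rewrite -(natrD _ 1 1).
Qed.

Lemma n_expR_half : n%:R * expR (- (1001 * x)) <= 1 / 2.
Proof.
apply: le_trans (expR_neg_half (_ : 1000 - x <= - 1)); last by xlra.
have -> : 1000 - x = 2000 + (- 1000 - x) by ring.
by apply: n_expR_le; xlra.
Qed.

Lemma x_le_expR : x <= expR x.
Proof. by apply: le_trans (expR_ge1Dx x); rewrite lerDr. Qed.

Lemma sqr_x_le_expR : x ^+ 2 <= expR (2 * x).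
Proof.
have -> : 2 * x = x + x by ring.
rewrite expRD expr2; apply: ler_pM => //; exact: x_le_expR.
Qed.

Lemma term_early : (n%:R * expR (- (880 * x)))^-1 <= q.
Proof.
rewrite [leRHS]expRN lef_pV2 ?posrE ?mulr_gt0 ?expR_gt0 //; last first.
  by apply: lt_le_trans n_lo; rewrite expR_gt0.
apply: (@le_trans _ _ (expR (1000 * x) * expR (- (880 * x)))).
  by rewrite -expRD ler_expR; xlra.
by apply: ler_wpM2r; rewrite ?expR_ge0.
Qed.

Lemma term_disconnected : 2 * (n%:R * expR (- (2000 * x))) <= 2 * expR 1000 * q.
Proof.
rewrite -mulrA -expRD; apply: ler_wpM2l => //.
have -> : 1000 - x = 2000 + (- 1000 - x) by ring.
by apply: n_expR_le; xlra.
Qed.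

Lemma term_sparse : 2 * (n%:R * expR (- (1001 * x))) <= 2 * expR 1000 * q.
Proof.
rewrite -mulrA -expRD; apply: ler_wpM2l => //.
have -> : 1000 - x = 2000 + (- 1000 - x) by ring.
by apply: n_expR_le; xlra.
Qed.

Lemma term_low_edges :
  n%:R * (expR (- (2000 * x)) + expR (- (1012 * x))) <= 2 * expR 1000 * q.
Proof.
rewrite mulrDr -[leRHS]mulrA -expRD [leRHS]mulr_natl mulr2n.
have -> : 1000 - x = 2000 + (- 1000 - x) by ring.
by apply: lerD; apply: n_expR_le; xlra.
Qed.

Lemma term_separated (m1 : R) : m1 = 2000 * x * n%:R ->
  expR (1 - 1074 * x) * (4 * (m1 + m1 ^+ 2 * (4 / n%:R)))
    <= 4 * (2000 + 4 * 2000 ^+ 2) * expR 2000 * q.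
Proof.
move=> ->; have n0 : 0 < n%:R :> R by apply: lt_le_trans n_lo; rewrite expR_gt0.
set c : R := 2000; have c0 : 0 <= c by rewrite ler0n.
have -> : expR (1 - 1074 * x) * (4 * (c * x * n%:R + (c * x * n%:R) ^+ 2 * (4 / n%:R))) =
  4 * (c * x + 4 * c ^+ 2 * x ^+ 2) * (n%:R * expR (1 - 1074 * x)).
  by field; rewrite gt_eqF.
have h1 : n%:R * expR (1 - 1074 * x) <= expR (c + - (3 * x)) by apply: n_expR_le; xlra.
clearbody c.
have h2 : c * x + 4 * c ^+ 2 * x ^+ 2 <= (c + 4 * c ^+ 2) * expR (2 * x).
  rewrite [leRHS]mulrDl; apply: lerD; apply: ler_wpM2l => //.
  - by apply: (le_trans x_le_expR); rewrite ler_expR; xlra.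
  - by rewrite mulr_ge0 ?sqr_ge0.
  - exact: sqr_x_le_expR.
apply: (@le_trans _ _ (4 * ((c + 4 * c ^+ 2) * expR (2 * x)) * expR (c + - (3 * x)))).
  apply: ler_pM => //; last by apply: ler_wpM2l.
  - by rewrite mulr_ge0 // addr_ge0 ?mulr_ge0 // sqr_ge0.
  - by rewrite mulr_ge0 ?expR_ge0.
rewrite -!mulrA; do 2! (apply: ler_wpM2l; rewrite ?addr_ge0 ?mulr_ge0 ?sqr_ge0 //).
by rewrite -!expRD ler_expR; xlra.
Qed.

Lemma term_matched (r : R) : r = 12000 * x ->
  (expR (460 * x) * r) ^+ 2 * (4 / n%:R) <= 4 * 12000 ^+ 2 * q.
Proof.
move=> ->; have n0 : 0 < n%:R :> R by apply: lt_le_trans n_lo; rewrite expR_gt0.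
rewrite [leLHS]mulrA ler_pdivrMr //; set c : R := 12000; have c0 : 0 <= c by rewrite ler0n.
clearbody c.
have -> : (expR (460 * x) * (c * x)) ^+ 2 * 4 =
  4 * c ^+ 2 * (x ^+ 2 * (expR (460 * x) * expR (460 * x))) by ring.
rewrite -[leRHS]mulrA; apply: ler_wpM2l; first by rewrite mulr_ge0 // sqr_ge0.
apply: (@le_trans _ _ (expR (- x) * expR (1000 * x))); last first.
  by apply: ler_wpM2l; rewrite ?expR_ge0.
apply: (@le_trans _ _ (expR (2 * x) * (expR (460 * x) * expR (460 * x)))).
  by apply: ler_wpM2r; [rewrite mulr_ge0 ?expR_ge0 | exact: sqr_x_le_expR].
by rewrite -!expRD ler_expR; xlra.
Qed.

(** The number of times is at most a constant times e^(2n) and the 2^n sets cost at most e^n,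
    against a deviation bound of e^(-4n); the remaining e^(-n) is at most e^(-x). *)
Lemma term_unbalanced (eps m0 m1 : R) : m0 = 400 * x * n%:R -> m1 = 2000 * x * n%:R ->
  4 <= 50 * x * eps ^+ 2 ->
  (m1 + 1) * (2 * (2 ^+ n * expR (- (m0 * (eps ^+ 2 / 8))))) <= 2 * (2000 + 1) * q.
Proof.
move=> -> -> xe.
have nq := n_ge_quad.
have xn : x <= n%:R by have := sqr_ge0 x; xlra.
have n1 : 1 <= n%:R :> R by xlra.
have nn : n%:R <= expR n%:R :> R by apply: le_trans (expR_ge1Dx _); rewrite lerDr.
have h2 : 2 ^+ n <= expR (n%:R * 1) :> R.
  by apply: exprn_le_expR => //; apply: le_trans (expR_ge1Dx 1); rewrite -(natrD _ 1 1).
rewrite mulr1 in h2.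
set c : R := 2000; have c0 : 0 <= c by rewrite ler0n.
clearbody c.
have h3 : c * x * n%:R + 1 <= (c + 1) * (expR n%:R * expR n%:R).
  have : x * n%:R <= expR n%:R * expR n%:R by apply: ler_pM => //; exact: (le_trans xn nn).
  have : 1 <= expR n%:R * expR n%:R :> R.
    by have e1 := le_trans n1 nn; apply: (le_trans e1); rewrite ler_peMr ?expR_ge0.
  move: (expR _ * expR _) => z z1; rewrite -mulrA; move: (x * _) => y yz.
  by have := ler_wpM2l c0 yz; rewrite mulrDl mul1r; lra.
have h4 : expR (- (400 * x * n%:R * (eps ^+ 2 / 8))) <= expR (- (4 * n%:R)).
  rewrite ler_expR lerN2 (_ : 400 * x * n%:R * (eps ^+ 2 / 8) = 50 * x * eps ^+ 2 * n%:R); last by field.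
  exact: ler_wpM2r.
apply: (@le_trans _ _ ((c + 1) * (expR n%:R * expR n%:R) * (2 * (expR n%:R * expR (- (4 * n%:R)))))).
  apply: ler_pM => //.
  - by rewrite addr_ge0 ?mulr_ge0.
  - by rewrite !mulr_ge0 ?exprn_ge0 ?expR_ge0.
  - by apply: ler_wpM2l => //; apply: ler_pM; rewrite ?exprn_ge0 ?expR_ge0.
have -> : (c + 1) * (expR n%:R * expR n%:R) * (2 * (expR n%:R * expR (- (4 * n%:R)))) =
  2 * (c + 1) * (expR n%:R * expR n%:R * expR n%:R * expR (- (4 * n%:R))) by ring.
apply: ler_wpM2l; first by rewrite mulr_ge0 ?addr_ge0.
by rewrite -!expRD ler_expR; xlra.
Qed.

End ExpEstimates.

(** One summand per conjunct of [typical], in the same order. *)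
Definition single_const (R : realType) : R :=
  1 + 2 * expR 1000 + 2 * expR 1000 + 4 * (2000 + 4 * 2000 ^+ 2) * expR 2000 +
  2 * expR 1000 + 2 * (2000 + 1).

Section Assembly.
Variables (R : realType) (n l : nat) (t : R) (m0 m1 r : nat).
Local Notation N := 'C(n, 2).
Local Notation x := (l%:R : R).
Hypotheses (t0 : 0 <= t) (tE : t - 2000 = 1001) (x_large : 5000 * expR (2 * t) <= x).
Hypotheses (n_lo : expR (1000 * x) <= n%:R) (n_hi : n%:R <= expR (1000 * x + 1000)).
Hypotheses (m0E : m0 = (400 * l * n)%N) (m1E : m1 = (2000 * l * n)%N).
Hypothesis rE : r%:R = 12000 * x.

Let D := (16 * l)%N.
Let eta : R := expR (- t).
(** Chosen so that 120 * eps * n is half of eta * n, hence at most [s0], its integer part. *)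
Let eps : R := eta / 240.
Let s0 := Num.truncn (eta * n%:R).

Let x_ge : 5000 <= x.
Proof.
apply: le_trans x_large; rewrite ler_peMr // -[leLHS](expR0 R) ler_expR.
by rewrite mulr_ge0.
Qed.

Let x_ge0 : 0 <= x. Proof. exact: ler0n. Qed.

Let nq : 1000 * x + (500 * x) ^+ 2 <= n%:R.
Proof. exact: n_ge_quad. Qed.

Let n_large : 16800 * x + 1 <= n%:R.
Proof. by move: nq x_ge; move: (x) => y; nra. Qed.

Let n_ge : (100 <= n)%N.
Proof. by rewrite -(ler_nat R); move: n_large x_ge; move: (x) => y; lra. Qed.

Let n_gt1 : (1 < n)%N. Proof. exact: leq_trans n_ge. Qed.
Let n0 : (0 : R) < n%:R. Proof. by rewrite ltr0n ltnW. Qed.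

Let m0R : m0%:R = 400 * x * n%:R. Proof. by rewrite m0E !natrM. Qed.
Let m1R : m1%:R = 2000 * x * n%:R. Proof. by rewrite m1E !natrM. Qed.
Let DR : D%:R = 16 * x. Proof. by rewrite natrM. Qed.

Let m1N : (m1 <= N)%N.
Proof.
rewrite -(ler_nat R) m1R bin2R [leLHS]mulrC -[leRHS]mulrA.
apply: ler_wpM2l; first exact: ltW.
by move: n_large x_ge; move: (x) (n%:R : R) => y z; lra.
Qed.

Let m01 : (m0 <= m1)%N.
Proof.
rewrite -(ler_nat R) m0R m1R; apply: ler_wpM2r; first exact: ltW.
by move: x_ge; move: (x) => y; lra.
Qed.

Let eta0 : 0 < eta. Proof. exact: expR_gt0. Qed.

Let eta1 : eta <= 1.
Proof. by rewrite -[leRHS](expR0 R) ler_expR oppr_le0. Qed.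

Let x_eta : 5000 <= x * eta ^+ 2.
Proof.
have E : expR (2 * t) * eta ^+ 2 = 1 by rewrite /eta -expRM_natl mulrN expRxMexpNx_1.
have -> : 5000 = 5000 * expR (2 * t) * eta ^+ 2 by rewrite -mulrA E mulr1.
by apply: ler_wpM2r; [exact: sqr_ge0 | exact: x_large].
Qed.

Let n_eta : 5000 <= eta * n%:R.
Proof.
apply: (le_trans x_eta); rewrite mulrC expr2 -mulrA; apply: ler_wpM2l; first exact: ltW.
apply: (@le_trans _ _ (1 * x)); first by apply: ler_wpM2r.
by rewrite mul1r; move: n_large x_ge; move: (x) => y; lra.
Qed.

Let s0_le : s0%:R <= eta * n%:R.
Proof. by rewrite Num.Theory.truncn_le mulr_ge0 // ltW. Qed.

Let s0_gt : eta * n%:R < s0%:R + 1.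
Proof. by rewrite natr1 truncnS_gt. Qed.

Let eps0 : 0 < eps. Proof. by rewrite divr_gt0. Qed.
Let eps1 : eps <= 1 / 100.
Proof. by rewrite /eps; move: eta1 eta0; lra. Qed.

Let eps_s0 : 1 <= eps * s0%:R.
Proof.
have h : eta * n%:R / 2 <= s0%:R by move: s0_gt n_eta; move: (eta * _) => y; lra.
apply: (le_trans _ (ler_wpM2l (ltW eps0) h)).
rewrite /eps; have := x_eta.
have : eta ^+ 2 * x <= eta ^+ 2 * n%:R.
  apply: ler_wpM2l; first exact: sqr_ge0.
  by move: n_large x_ge; move: (x) => y; lra.
rewrite [x * _]mulrC (_ : eta / 240 * (eta * n%:R / 2) = eta ^+ 2 * n%:R / 480); last by field.
by move: (eta ^+ 2 * x) (eta ^+ 2 * n%:R) => a b; lra.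
Qed.

Let eps_n : 120 * eps * n%:R <= s0%:R.
Proof.
have h : eta * n%:R / 2 <= s0%:R by move: s0_gt n_eta; move: (eta * _) => y; lra.
apply: le_trans h; rewrite /eps (_ : 120 * (eta / 240) * n%:R = eta * n%:R / 2) //.
by field.
Qed.

Let x_eps : 4 <= 50 * x * eps ^+ 2.
Proof.
rewrite (_ : 50 * x * eps ^+ 2 = x * eta ^+ 2 / 1152); last by rewrite /eps; field.
by rewrite ler_pdivlMr //; move: x_eta; move: (x * _) => y; lra.
Qed.

Definition typical (e : edge_seq n) : bool :=
  [&& ~~ graph_connected (e @: initial n m0), graph_connected (e @: initial n m1),
      sparse e m1 l s0, separated e m0 m1 D,
      #|low_edges e m0 m1 D|%:R <= expR (460 * x) * r%:R :> R
    & [forall m : 'I_m1.+1, (m0 <= m)%N ==> balanced e eps m]].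

Lemma prob_not_typical :
  Ex (fun e => (~~ typical e)%:R) <= single_const R * expR (- x) :> R.
Proof.
have T1 := le_trans (prob_connected_early n_ge (leq_trans m01 m1N) m0R n_large)
  (term_early x_ge n_lo).
have h2 := n_expR_half x_ge n_hi.
have h2' : n%:R * expR (- (2000 * x)) <= 1 / 2.
  apply: le_trans h2; apply: ler_wpM2l; first exact: ltW.
  by rewrite ler_expR; move: x_ge0; move: (x) => y; lra.
have T2 := le_trans (prob_disconnected n_gt1 m1N m1R h2') (term_disconnected x_ge n_hi).
have T3 : Ex (fun e : edge_seq n => (~~ sparse e m1 l s0)%:R) <= 2 * expR 1000 * expR (- x).
  apply: (le_trans _ (term_sparse x_ge n_hi)); rewrite -tE.
  by apply: (prob_not_sparse n_gt1 m1N x_ge0 (erefl _) m1R t0 s0_le); rewrite tE.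
have T4 := le_trans (prob_not_separated n_ge m1N m01 DR m0R)
  (term_separated x_ge n_lo n_hi m1R).
have T5 := le_trans (prob_low_edges n_gt1 m1N m01 x_ge0 DR m0R m1R rE) (term_low_edges x_ge n_hi).
have T6 : Ex (fun e : edge_seq n =>
    (~~ [forall m : 'I_m1.+1, (m0 <= m)%N ==> balanced e eps m])%:R) <=
    2 * (2000 + 1) * expR (- x).
  apply: (le_trans _ (term_unbalanced x_ge n_lo m0R m1R x_eps)).
  apply: (@le_trans _ _ (\sum_(m : 'I_m1.+1 | (m0 <= m)%N)
      Ex (fun e : edge_seq n => (~~ balanced e eps m)%:R))).
    apply: Ex_union => e _ /forallPn[m]; rewrite negb_imply => /andP[mm nb].
    by exists m.
  have le0 : 0 <= 2 * (2 ^+ n * expR (- (m0%:R * (eps ^+ 2 / 8)))) :> R.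
    by rewrite !mulr_ge0 ?exprn_ge0 ?expR_ge0.
  apply: (@le_trans _ _ (\sum_(m : 'I_m1.+1 | (m0 <= m)%N)
      2 * (2 ^+ n * expR (- (m0%:R * (eps ^+ 2 / 8)))))).
    apply: ler_sum => m mm.
    have mN : (m <= N)%N by apply: leq_trans m1N; rewrite -ltnS.
    have e1 : eps <= 1 by apply: (le_trans eps1); rewrite ler_pdivrMr // mul1r ler1n.
    apply: (le_trans (prob_unbalanced n_gt1 eps0 e1 mN)).
    apply: ler_wpM2l => //; apply: ler_wpM2l; first exact: exprn_ge0.
    rewrite ler_expR lerN2; apply: ler_wpM2r; last by rewrite ler_nat.
    by rewrite divr_ge0 ?sqr_ge0.
  rewrite sumr_const -[leLHS]mulr_natl natr1; apply: ler_wpM2r => //.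
  by rewrite ler_nat -[leqRHS](card_ord m1.+1) max_card.
rewrite /single_const; do 5! rewrite mulrDl; rewrite mul1r.
apply: (le_trans _ (lerD (lerD (lerD (lerD (lerD T1 T2) T3) T4) T5) T6)).
rewrite -!ExD; apply: le_Ex => e _; rewrite /typical.
rewrite !negb_and negbK -ltNge -!natrD ler_nat.
have or6 (b1 b2 b3 b4 b5 b6 : bool) :
    ([|| b1, b2, b3, b4, b5 | b6] <= b1 + b2 + b3 + b4 + b5 + b6)%N.
  by case: b1 b2 b3 b4 b5 b6 => [] [] [] [] [] [].
exact: or6.
Qed.

Lemma typical_pair (e1 e2 : edge_seq n) :
  e1 \in orderings n -> e2 \in orderings n -> typical e1 -> typical e2 ->
  matched e1 (low_edges e2 m0 m1 D) -> matched e2 (low_edges e1 m0 m1 D) ->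
  m_star e1 e2 == maxn (m_conn e1) (m_conn e2).
Proof.
move=> e1O e2O /and5P[dis1 conn1 sp1 sep1 /andP[_ /forallP bal1]].
move=> /and5P[_ conn2 sp2 sep2 /andP[_ /forallP bal2]] mat1 mat2.
apply: (m_star_eq m1N dis1 conn1 conn2) => m le0 le1 c1 c2.
have lm : (m < m1.+1)%N by rewrite ltnS.
have l_gt0 : (0 < l)%N by rewrite -(ltr_nat R); apply: lt_le_trans x_ge; rewrite ltr0n.
apply: (@multitree_exists R n m0 m m1 l D s0 eps n_gt1 le0 le1 (leq_trans le1 m1N)) => //.
- rewrite /D; move: l_gt0; clear; lia.
- by rewrite m0E.
- by rewrite m0E !muln_gt0 l_gt0 (ltnW n_gt1).
- exact: (implyP (bal1 (Ordinal lm)) le0).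
- exact: (implyP (bal2 (Ordinal lm)) le0).
Qed.

(** Independence is exploited through [mis]: for a fixed typical e2 the low edges occupy a fixed
    small set of positions, and only e1 is random. *)
Lemma prob_failure :
  Ex (fun e1 : edge_seq n => Ex (fun e2 : edge_seq n =>
     (m_star e1 e2 != maxn (m_conn e1) (m_conn e2))%:R)) <=
  2 * (single_const R + 4 * 12000 ^+ 2) * expR (- x).
Proof.
pose bad e : R := (~~ typical e)%:R.
pose mis e1 e2 : R := (typical e2 && ~~ matched e1 (low_edges e2 m0 m1 D))%:R.
have misE e2 : Ex (fun e1 => mis e1 e2) <= 4 * 12000 ^+ 2 * expR (- x).
  rewrite /mis; have [/and5P[_ _ _ _ /andP[small _]]|_] := boolP (typical e2); last first.
    rewrite (Ex_cst n (0 : R)); apply: mulr_ge0; last exact: expR_ge0.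
    by apply: mulr_ge0 => //; apply: exprn_ge0; exact: ler0n.
  apply: (le_trans (prob_not_matched R n_gt1 _)).
  apply: (le_trans _ (term_matched x_ge n_lo rE)).
  apply: ler_wpM2r; first by rewrite divr_ge0.
  by apply: lerXn2r => //; rewrite nnegrE // mulr_ge0 // expR_ge0.
have mis1 : Ex (fun e1 => Ex (fun e2 => mis e1 e2)) <= 4 * 12000 ^+ 2 * expR (- x).
  rewrite Ex_exchange -[leRHS](Ex_cst n); apply: le_Ex => e2 _; exact: misE.
have mis2 : Ex (fun e1 => Ex (fun e2 => mis e2 e1)) <= 4 * 12000 ^+ 2 * expR (- x).
  by rewrite -[leRHS](Ex_cst n); apply: le_Ex => e1 _; exact: misE.
have bad1 := prob_not_typical.
have E1 : Ex (fun e1 => Ex (fun e2 : edge_seq n => bad e1)) = Ex bad.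
  by apply: eq_Ex => e1 _; rewrite Ex_cst.
have E2 : Ex (fun e1 : edge_seq n => Ex (fun e2 => bad e2)) = Ex bad by rewrite Ex_cst.
apply: (@le_trans _ _ (Ex (fun e1 => Ex (fun e2 => bad e1 + bad e2 + (mis e1 e2 + mis e2 e1))))).
  apply: le_Ex => e1 e1O; apply: le_Ex => e2 e2O.
  rewrite /bad /mis -!natrD ler_nat.
  have := @typical_pair e1 e2 e1O e2O.
  case: (typical e1); case: (typical e2) => //=; try by case: (_ == _).
  case: (matched e1 _); case: (matched e2 _) => //=; try by case: (_ == _).
  by move=> /(_ isT isT isT isT) ->.
rewrite (@eq_Ex R n _ (fun e1 => (Ex (fun e2 : edge_seq n => bad e1) + Ex (fun e2 => bad e2)) +
   (Ex (fun e2 => mis e1 e2) + Ex (fun e2 => mis e2 e1)))); last first.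
  by move=> e1 _; rewrite !ExD.
rewrite !ExD E1 E2.
have := lerD (lerD bad1 bad1) (lerD mis1 mis2); rewrite -/bad => /le_trans; apply.
move: (single_const R) (4 * 12000 ^+ 2) (expR _) => a b c.
by rewrite le_eqVlt; apply/orP; left; apply/eqP; ring.
Qed.

End Assembly.

Lemma log_scale (R : realType) (n : nat) : (0 < n)%N ->
  exists2 l : nat, expR (1000 * l%:R) <= n%:R :> R &
    n%:R <= expR (1000 * l%:R + 1000) :> R.
Proof.
move=> n_gt0; have n0 : (0 : R) < n%:R by rewrite ltr0n.
have nE : expR (ln n%:R) = n%:R :> R by rewrite lnK.
have ln0 : 0 <= ln (n%:R : R) / 1000 by rewrite divr_ge0 // ln_ge0 // ler1n.
have /andP[lo hi] := Num.Theory.truncn_itv ln0.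
exists (Num.truncn (ln (n%:R : R) / 1000)).
  by rewrite -[leRHS]nE ler_expR mulrC -ler_pdivlMr.
rewrite -[leLHS]nE ler_expR; move: hi; rewrite ltr_pdivrMr // -natr1 => /ltW.
by rewrite mulrC mulrDr mulr1.
Qed.

From mathcomp Require Import classical_sets reals topology normedtype.
Import numFieldNormedType.Exports.

Local Open Scope classical_set_scope.
Local Open Scope ring_scope.
Unset Implicit Arguments.

Theorem theorem2 (R : realType) :
  (fun n : nat =>
     prob_indep_uniform R (orderings n)
       (fun e1 e2 => m_star e1 e2 == maxn (m_conn e1) (m_conn e2)))
    @ \oo --> (1 : R).
Proof.
apply/cvgrPdist_le => eps eps0.
(* With t = 3001 the sparsity price per vertex is e^(-1001 x), which beats the factor n. *)
have [t [t0 tE]] : exists t : R, 0 <= t /\ t - 2000 = 1001.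
  by exists 3001; split; [rewrite ler0n | rewrite -natrB].
pose C := 2 * (single_const R + 4 * 12000 ^+ 2).
(* The first summand provides [x_large]; the second makes |C| e^(-l) at most eps, because e^l >= l
   >= |C| / eps. *)
pose M := 5000 * expR (2 * t) + `|C| / eps.
exists (Num.truncn (expR (1000 * M + 1000))).+1 => // n /= n_ge.
have nM : expR (1000 * M + 1000) <= n%:R.
  by apply: le_trans (ltW (Num.Theory.truncnS_gt _)) _; rewrite ler_nat.
have n_gt0 : (0 < n)%N by apply: leq_trans n_ge.
have [l n_lo n_hi] := log_scale R n_gt0.
have Ml : M <= l%:R.
  by have := le_trans nM n_hi; rewrite ler_expR lerD2r ler_pM2l.
have Ce : 0 <= `|C| / eps by rewrite divr_ge0 // ltW.
have x_large : 5000 * expR (2 * t) <= l%:R by apply: le_trans Ml; rewrite lerDl.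
have rE : (12000 * l)%N%:R = 12000 * l%:R :> R by rewrite natrM.
have := prob_failure t0 tE x_large n_lo n_hi erefl erefl rE; rewrite -/C => fail.
rewrite prob_indep_uniformE.
have -> : 1 - Ex (fun e1 : edge_seq n => Ex (fun e2 : edge_seq n =>
    (m_star e1 e2 == maxn (m_conn e1) (m_conn e2))%:R)) =
  Ex (fun e1 : edge_seq n => Ex (fun e2 : edge_seq n =>
    (m_star e1 e2 != maxn (m_conn e1) (m_conn e2))%:R)) :> R.
  apply/eqP; rewrite subr_eq -ExD; apply/eqP; rewrite -[LHS](Ex_cst n).
  apply: eq_Ex => e1 _; rewrite -ExD -[LHS](Ex_cst n); apply: eq_Ex => e2 _.
  by case: (_ == _); rewrite ?addr0 ?add0r.
rewrite ger0_norm; last by do 2! (apply: Ex_ge0 => ? _).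
apply: (le_trans fail); apply: (@le_trans _ _ (`|C| * expR (- l%:R))).
  by apply: ler_wpM2r; [exact: expR_ge0 | exact: ler_norm].
rewrite expRN ler_pdivrMr ?expR_gt0 //.
apply: (@le_trans _ _ (eps * l%:R)).
  by rewrite mulrC -ler_pdivrMr //; apply: le_trans Ml; rewrite lerDr mulr_ge0 ?expR_ge0.
apply: ler_wpM2l; first exact: ltW.
by apply: le_trans (expR_ge1Dx _); rewrite lerDr.
Qed.
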